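(* Let $L<M$, let $0\in\partial\Omega_{L,2}$, and fix $x^0\in\Omega_L$. Assume that $B_1\cap\{x_n>1/4\}\subseteq\Omega_{L,2}$. Let $\alpha_1$ be the degree of homogeneity of $u_M$, and assume that $M$ is small enough that $2-\alpha_1>0$. Let $u,v\in\mathcal{S}(\Omega_{L,2},d^{0})$ with $u\ge0$, $\Delta u\le0$ in $\Omega_{L,2}$, and $u(x^0)=v(x^0)=1$ (no sign condition is imposed on $v$ or on $\Delta v$), and write $f:=\Delta v$. Then there exist $\beta>0$ depending on $M$ and $M-L$, and a constant $C$ depending only on $n$, $M$, $M-L$ and $\operatorname{dist}(x^0,\partial\Omega_{L,2})$, such that $$\left\|\frac{v}{u}\right\|_{C^{0,\beta}(B_{1/2}\cap\Omega_L)}\le C\,\frac{\|v\|_{L^\infty(\Omega_L)}+\|f\|_{L^\infty(\Omega_L)}}{u(e_n/2)}.$$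
   Context: $B_R$ is the open ball of radius $R$ centered at the origin in $\mathbb{R}^n$; points are written $x=(x',x_n)$ and $e_n=(0,\dots,0,1)$. $\Omega_{L,R}:=\{(x',x_n)\in B_R: x_n>g(x')\}$, where $g$ is a Lipschitz function with constant $L$, i.e. $|g(x')-g(y')|\le L|x'-y'|$, and $g(0)=0$; $\Omega_L:=\Omega_{L,1}$ (same $g$). $u\in\mathcal{S}(\Omega_{L,R},d^{0})$ means $|\Delta u(x)|\le1$ in $\Omega_{L,R}$ and $u=0$ on $\Omega_{L,R}^c\cap B_R$ (boundary values attained continuously). $\mathcal{C}_M:=\{(x',x_n): x_n>M|x'|\}$, and $u_M$ denotes the (not identically zero) nonnegative harmonic function on $\mathcal{C}_M$ vanishing on $\partial\mathcal{C}_M$; it is unique up to a positive multiplicative constant and homogeneous, of the form $r^{\alpha_1}f_1(\theta)$ in spherical coordinates. *)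

(* Defs.v *)
From HB Require Import structures.
From mathcomp Require Import all_boot all_order all_algebra.
From mathcomp Require Import all_classical all_reals all_analysis.

Set Implicit Arguments.
Unset Strict Implicit.
Unset Printing Implicit Defensive.

Import Order.TTheory GRing.Theory Num.Theory.
Import numFieldNormedType.Exports.

Local Open Scope classical_set_scope.
Local Open Scope ring_scope.

(* Lebesgue measure on R^n = 'rV[R]_n.  The sigma-algebra is the one generated
   by the coordinates, i.e. the Borel sets of R^n. *)

Definition rV_display : measure_display -> measure_display.
Proof. exact. Qed.

Section measurable_rV.
Context {d} {T : sigmaRingType d}.
Variable n : nat.

Let coors : 'I_n -> 'rV[T]_n -> T := fun i x => x ord0 i.

Let rV_set0 : g_sigma_preimage coors set0.
Proof. exact: sigma_algebra0. Qed.

Let rV_setC A : g_sigma_preimage coors A -> g_sigma_preimage coors (~` A).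
Proof. exact: sigma_algebraC. Qed.

Let rV_bigcup (F : _^nat) : (forall i, g_sigma_preimage coors (F i)) ->
  g_sigma_preimage coors (\bigcup_i (F i)).
Proof. exact: sigma_algebra_bigcup. Qed.

HB.instance Definition _ := @isMeasurable.Build (rV_display d)
  'rV[T]_n (g_sigma_preimage coors) rV_set0 rV_setC rV_bigcup.

End measurable_rV.

Lemma measurable_coord d (T : sigmaRingType d) n (i : 'I_n) :
  measurable_fun [set: 'rV[T]_n] (fun x => x ord0 i).
Proof.
move=> _ Y mY; rewrite setTI; apply: sub_sigma_algebra => /=.
rewrite -bigcup_seq/=; exists i => /=; first by rewrite mem_index_enum.
by exists Y => //; rewrite setTI.
Qed.

Lemma measurable_fun_rV d1 d2 (T1 : measurableType d1) (T2 : measurableType d2)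
    n (f : T1 -> 'rV[T2]_n) :
  (forall i, measurable_fun [set: T1] (fun x => f x ord0 i)) ->
  measurable_fun [set: T1] f.
Proof.
move=> mf _ A mA; rewrite setTI; move: mA; rewrite /measurable/=.
move=> /(_ (image_set_system setT f measurable)); rewrite /image_set_system/=.
rewrite setTI; apply; split.
  by apply: sigma_algebra_image; exact: sigma_algebra_measurable.
move=> B; rewrite -bigcup_seq => -[i _ [C mC <-]] /=.
rewrite !setTI; have := mf i measurableT C mC.
by rewrite setTI.
Qed.

(* [measurableTypeR R] is R, with the measurable structure that carries
   [lebesgue_measure]. *)

Definition rV_cons (R : realType) n (p : measurableTypeR R * 'rV[R]_n) :
    'rV[R]_n.+1 :=
  \row_i oapp (p.2 ord0) p.1 (unlift ord0 i).

Definition rV_split (R : realType) n (x : 'rV[R]_n.+1) :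
    measurableTypeR R * 'rV[R]_n :=
  (x ord0 ord0, \row_j x ord0 (lift ord0 j)).

Lemma rV_consK (R : realType) n : cancel (@rV_cons R n) (@rV_split R n).
Proof.
move=> [t x]; rewrite /rV_split mxE unlift_none/=; congr pair.
by apply/rowP => j; rewrite !mxE liftK.
Qed.

Lemma measurable_rV_cons (R : realType) n : measurable_fun setT (@rV_cons R n).
Proof.
apply: measurable_fun_rV => i.
rewrite (_ : (fun _ => _) =
    (fun p : measurableTypeR R * 'rV[R]_n =>
       oapp (p.2 ord0) p.1 (unlift ord0 i))); last first.
  by apply/funext => p; rewrite mxE.
case: unliftP => [j _|_] /=.
  exact: (measurableT_comp (measurable_coord j) measurable_snd).
exact: (@measurable_fst _ _ (measurableTypeR R) 'rV[R]_n).
Qed.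

Lemma measurable_rV_split (R : realType) n :
  measurable_fun setT (@rV_split R n).
Proof.
apply/measurable_fun_pairP; split; first exact: measurable_coord.
apply: measurable_fun_rV => i.
rewrite (_ : (fun _ => _) = fun x : 'rV[R]_n.+1 => x ord0 (lift ord0 i)).
  exact: measurable_coord.
by apply/funext => x /=; rewrite mxE.
Qed.

Section lebesgue_step.
Context (R : realType) (n : nat).
Variable mu : {sigma_finite_measure set 'rV[R]_n -> \bar R}.

Definition leb_step : set 'rV[R]_n.+1 -> \bar R :=
  pushforward (@lebesgue_measure R \x mu)%E (@rV_cons R n).

Let leb_step0 : leb_step set0 = 0%E.
Proof. by rewrite /leb_step /pushforward preimage_set0 measure0. Qed.

Let leb_step_ge0 A : (0 <= leb_step A)%E.
Proof. by rewrite /leb_step /pushforward; exact: measure_ge0. Qed.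

Let leb_step_sigma_additive : semi_sigma_additive leb_step.
Proof.
pose m := [the {measure set _ -> \bar R} of
  (@lebesgue_measure R \x mu)%E].
exact: (@measure_semi_sigma_additive _ _ _
  (measure_function_pushforward__canonical__measure_function_Measure
     m (@measurable_rV_cons R n))).
Qed.

HB.instance Definition _ := isMeasure.Build _ _ _ leb_step
  leb_step0 leb_step_ge0 leb_step_sigma_additive.

Let leb_step_sigma_finite : sigma_finite setT leb_step.
Proof.
have /sigma_finiteP[F [FT ndF Foo]] := sigma_finiteT (@lebesgue_measure R).
have /sigma_finiteP[G [GT ndG Goo]] := sigma_finiteT mu.
exists (fun k => @rV_split R n @^-1` (F k `*` G k)) => [|k].
  rewrite -preimage_bigcup (_ : \bigcup_k _ = setT) ?preimage_setT//.
  rewrite -subTset -setXTT FT GT => -[x y] [/= [a _ Fax] [b _ Gby]].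
  exists (maxn a b) => //; split.
  - by move: x Fax; exact/subsetPset/ndF/leq_maxl.
  - by move: y Gby; exact/subsetPset/ndG/leq_maxr.
have [mF Fk] := Foo k; have [mG Gk] := Goo k; split.
  rewrite -[X in measurable X]setTI.
  by apply: measurable_rV_split => //; exact: measurableX.
rewrite /leb_step /pushforward -comp_preimage.
rewrite (_ : _ \o _ = idfun); last by apply/funext => p; exact: rV_consK.
by rewrite preimage_id product_measure1E// lte_mul_pinfty// ge0_fin_numE.
Qed.

HB.instance Definition _ := Measure_isSigmaFinite.Build _ _ _ leb_step
  leb_step_sigma_finite.

End lebesgue_step.

Fixpoint leb (R : realType) n : {sigma_finite_measure set 'rV[R]_n -> \bar R} :=
  match n with
  | 0 => [the {sigma_finite_measure set 'rV[R]_0 -> \bar R} of \d_(0 : 'rV[R]_0)]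
  | k.+1 => [the {sigma_finite_measure set 'rV[R]_k.+1 -> \bar R} of
              leb_step (leb R k)]
  end.

(* The norm of the library on 'rV[R]_n is the sup norm: it induces the usual
   topology, but Euclidean balls and distances need the norm below. *)
Definition eucl_norm (R : realType) n (x : 'rV[R]_n) : R :=
  Num.sqrt (\sum_i x ord0 i ^+ 2).

Definition eucl_dist (R : realType) n (x : 'rV[R]_n) (A : set 'rV[R]_n) : R :=
  inf [set eucl_norm (x - y) | y in A].

Definition eucl_ball (R : realType) n (r : R) : set 'rV[R]_n :=
  [set x | eucl_norm x < r].

Definition boundary (T : topologicalType) (A : set T) : set T :=
  closure A `\` interior A.

(* x = (x', x_n) *)
Definition xprime (R : realType) n (x : 'rV[R]_n.+1) : 'rV[R]_n := col' ord_max x.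
Definition xlast (R : realType) n (x : 'rV[R]_n.+1) : R := x ord0 ord_max.
Definition e_last (R : realType) n : 'rV[R]_n.+1 := delta_mx ord0 ord_max.

Definition partial (R : realType) n (i : 'I_n) (f : 'rV[R]_n -> R) :
    'rV[R]_n -> R :=
  fun x => 'D_(delta_mx ord0 i) f x.

Definition partials (R : realType) n (s : seq 'I_n) (f : 'rV[R]_n -> R) :
    'rV[R]_n -> R :=
  foldr (@partial R n) f s.

Definition laplacian (R : realType) n (f : 'rV[R]_n -> R) : 'rV[R]_n -> R :=
  fun x => \sum_i partials [:: i; i] f x.

(* [f] is of class C^k on the open set [D]. *)
Definition Ck_on (R : realType) n (k : nat) (D : set 'rV[R]_n)
    (f : 'rV[R]_n -> R) : Prop :=
  forall (s : seq 'I_n) x, (size s <= k)%N -> D x ->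
    {for x, continuous (partials s f)} /\
    ((size s < k)%N -> forall i, derivable (partials s f) x (delta_mx ord0 i)).

Definition harmonic_on (R : realType) n (D : set 'rV[R]_n)
    (f : 'rV[R]_n -> R) : Prop :=
  Ck_on 2 D f /\ forall x, D x -> laplacian f x = 0.

Definition test_function (R : realType) n (D : set 'rV[R]_n)
    (phi : 'rV[R]_n -> R) : Prop :=
  [/\ forall k, Ck_on k setT phi,
      compact (closure [set x | phi x != 0]) &
      closure [set x | phi x != 0] `<=` D].

Definition loc_integrable (R : realType) n (D : set 'rV[R]_n)
    (f : 'rV[R]_n -> R) : Prop :=
  forall K, compact K -> K `<=` D -> (leb R n).-integrable K (EFin \o f).

(* Delta u = f in the open set [D], in the sense of distributions; [f] is
   determined by [u] and [D] up to a null subset of [D]. *)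
Definition weak_laplacian (R : realType) n (D : set 'rV[R]_n)
    (u f : 'rV[R]_n -> R) : Prop :=
  [/\ loc_integrable D u, loc_integrable D f &
      forall phi, test_function D phi ->
        \int[leb R n]_(x in D) (u x * laplacian phi x) =
        \int[leb R n]_(x in D) (f x * phi x)].

Definition Linfty_norm (R : realType) n (D : set 'rV[R]_n)
    (f : 'rV[R]_n -> R) : \bar R :=
  Lnorm (leb R n) +oo%E (fun x => (\1_D x * f x)%:E).

(* The full C^{0,beta} norm: sup norm plus Holder seminorm. *)
Definition holder_norm (R : realType) n (beta : R) (A : set 'rV[R]_n)
    (w : 'rV[R]_n -> R) : \bar R :=
  (ereal_sup [set `|w x|%:E | x in A] +
   ereal_sup [set t | exists x y, [/\ A x, A y, x != y &
     t = (`|w x - w y| / eucl_norm (x - y) `^ beta)%:E]])%E.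

(* Lipschitz for the Euclidean norm, and normalized by g(0) = 0. *)
Definition lipschitz_graph (R : realType) n (L : R) (g : 'rV[R]_n -> R) : Prop :=
  (forall x y, `|g x - g y| <= L * eucl_norm (x - y)) /\ g 0 = 0.

(* Omega_{L,r}, for the function [g]. *)
Definition Omega (R : realType) n (g : 'rV[R]_n -> R) (r : R) :
    set 'rV[R]_n.+1 :=
  [set x | eucl_ball r x /\ g (xprime x) < xlast x].

(* [u] belongs to S(Omega_{L,r}, d^0), with Delta u = [Du]. The function [u] is
   only relevant on B_r; its continuity there encodes that the boundary values
   are attained continuously. *)
Definition classS (R : realType) n (g : 'rV[R]_n -> R) (r : R)
    (u Du : 'rV[R]_n.+1 -> R) : Prop :=
  [/\ forall x, eucl_ball r x -> {for x, continuous u},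
      forall x, eucl_ball r x -> ~ Omega g r x -> u x = 0,
      weak_laplacian (Omega g r) u Du &
      {ae leb R n.+1, forall x, Omega g r x -> `|Du x| <= 1}].

Definition lcone (R : realType) n (M : R) : set 'rV[R]_n.+1 :=
  [set x | M * eucl_norm (xprime x) < xlast x].

Definition cone_solution (R : realType) n (M : R) (w : 'rV[R]_n.+1 -> R) :
    Prop :=
  [/\ harmonic_on (lcone M) w,
      {within closure (lcone M), continuous w},
      forall x, lcone M x -> 0 <= w x,
      forall x, boundary (@lcone R n M) x -> w x = 0 &
      exists2 x, lcone M x & w x != 0].

Definition homogeneous_on (R : realType) n (D : set 'rV[R]_n) (alpha : R)
    (w : 'rV[R]_n -> R) : Prop :=
  forall t x, 0 < t -> D x -> w (t *: x) = t `^ alpha * w x.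

(* Main.v *)
(* The only information needed from [u_M] is dimensional: if [n M^2 > 1], then for [m < M] close to
   [M] the function [x_n^2 - m^2 |x'|^2] is a superharmonic barrier of degree two on the cone, and
   comparison with it kills every nonnegative solution of degree [alpha_1 < 2]. Hence [n M^2 <= 1],
   only finitely many dimensions occur, and for [n >= 1] there is [m] with [L < m <= 1] and
   [n m^2 < 1], so that [x_n^2 - m^2 |x'|^2] is strictly subharmonic. This barrier forces positive
   solutions to grow from the graph like a power of degree less than two, so that a bounded
   right-hand side is negligible at small scales.

   Everything else rests on the comparison principle. Positivity spreads from a ball to a larger
   one, which yields interior Harnack inequalities and chains; a solution decays geometrically
   towards the graph, which yields the Carleson estimate; and a solution that is bounded below far
   from the graph and almost nonnegative near it is nonnegative by iterating the cone barrier over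
   the scales [rho^k]. Applied to [C u - v] and [C u + v] the last principle bounds [v / u];
   applied to [v - a u] and [b u - v] it improves bounds [a u <= v <= b u] by a fixed factor when
   the scale shrinks by [rho], and iterating gives the Hölder estimate. *)
From HB Require Import structures.
Require Import Defs.
From mathcomp Require Import all_boot all_order all_algebra.
From mathcomp Require Import all_classical all_reals all_analysis.
From mathcomp Require Import measurable_realfun ess_sup_inf.
From mathcomp Require Import ring lra.

Set Implicit Arguments.
Unset Strict Implicit.
Unset Printing Implicit Defensive.

Import Order.TTheory GRing.Theory Num.Theory.
Import numFieldNormedType.Exports.

Local Open Scope classical_set_scope.
Local Open Scope ring_scope.

(** * Smooth bump functions *)

Section smooth1.
Variable R : realType.
Implicit Types (f g : R -> R) (p : {poly R}) (t x : R).

Fixpoint smoothn (k : nat) (f : R -> R) : Prop :=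
  if k is k'.+1 then
    exists df : R -> R, (forall x, is_derive x 1 f (df x)) /\ smoothn k' df
  else continuous f.

Definition smooth f := forall k, smoothn k f.

Lemma is_derive_continuous f x d : is_derive x 1 f d -> {for x, continuous f}.
Proof. by move=> [/derivable1_diffP/differentiable_continuous]. Qed.

Lemma smoothnS k f : smoothn k.+1 f -> smoothn k f.
Proof.
elim: k f => [|k IH] f.
  by move=> [df [fdf _]] x; exact: is_derive_continuous (fdf x).
move=> [df [fdf sdf]]; exists df; split => //; exact: IH.
Qed.

Lemma smoothnM k f g : smoothn k f -> smoothn k g -> smoothn k (f \* g).
Proof.
elim: k f g => [|k IH] f g sf sg.
  by move=> x; apply: cvgM; [exact: sf|exact: sg].
have sf0 := smoothnS sf; have sg0 := smoothnS sg.
case: sf sg => [df [fdf sdf]] [dg [gdg sdg]].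
exists ((f \* dg) \+ (g \* df)); split.
  by move=> x; have := fdf x; have := gdg x => ? ?; exact: is_deriveM.
have : smoothn k (f \* dg) by exact: IH.
have : smoothn k (g \* df) by exact: IH.
move: (f \* dg) (g \* df) => a b {IH sf0 sg0 fdf sdf gdg sdg}.
elim: k a b => [|k IH] a b sb sa.
  by move=> x; apply: cvgD; [exact: sa|exact: sb].
case: sa sb => [da [ada sda]] [db [bdb sdb]].
exists (da \+ db); split; last exact: IH.
by move=> x; exact: (is_deriveD (ada x) (bdb x)).
Qed.

Lemma smoothM f g : smooth f -> smooth g -> smooth (f \* g).
Proof. by move=> sf sg k; apply: smoothnM. Qed.

Lemma smoothnZ k f (c : R) : smoothn k f -> smoothn k (c \*o f).
Proof.
elim: k f => [|k IH] f.
  by move=> cf x; apply: cvgM; [exact: cvg_cst|exact: cf].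
move=> [df [fdf sdf]]; exists (c \*o df); split; last exact: IH.
by move=> x; exact: (is_deriveZ c (fdf x)).
Qed.

Lemma smooth_affine f (a c : R) : smooth f -> smooth (fun t => f (a + c * t)).
Proof.
move=> sf k; have {sf} := sf k.
elim: k f => [|k IH] f.
  move=> cf x; apply: (@continuous_comp _ _ _ (fun t => a + c * t) f).
    by apply: cvgD; [exact: cvg_cst|apply: cvgM; [exact: cvg_cst|exact: cvg_id]].
  exact: cf.
move=> [df [fdf sdf]]; exists (fun x => c * df (a + c * x)); split; last first.
  by apply: smoothnZ; exact: IH.
move=> x.
have h : is_derive x 1 (fun t => a + c * t) c.
  by apply: is_derive_eq; rewrite /GRing.scale/= mulr1; ring.
have := @is_derive1_comp _ f (fun t => a + c * t) x _ _ (fdf _) h.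
by rewrite mulrC.
Qed.

Lemma smooth_deriveP f : smooth f ->
  exists df, (forall x, is_derive x 1 f (df x)) /\ smooth df.
Proof.
move=> sf; have [df [fdf _]] := sf 1%N.
exists df; split => // k; have [df' [fdf' sdf']] := sf k.+1.
suff -> : df = df' by [].
by apply/funext => x; rewrite -(@derive_val _ _ _ _ _ _ _ (fdf x)) (@derive_val _ _ _ _ _ _ _ (fdf' x)).
Qed.

Definition flat p t := if 0 < t then p.[t^-1] * expR (- t^-1) else 0.

Lemma poly_growth p : exists C : R, 0 <= C /\
  forall t, 1 <= t -> `|p.[t]| <= C * t ^+ size p.
Proof.
exists (\sum_(i < size p) `|p`_i|); split; first exact: sumr_ge0.
move=> t t1; rewrite horner_coef mulr_suml.
apply: le_trans (ler_norm_sum _ _ _) _; apply: ler_sum => i _.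
rewrite normrM ler_wpM2l// normrX ger0_norm ?(le_trans ler01)//.
by apply: ler_weXn2l => //; exact: ltnW.
Qed.

Lemma flat_bound p : exists C : R, 0 <= C /\ forall t, `|t| <= 1 -> `|flat p t| <= C * t ^+ 2.
Proof.
have [C [C0 hC]] := poly_growth p.
exists (C * (size p).+2`!%:R); split; first by rewrite mulr_ge0.
move=> t t1; rewrite /flat; case: ifP => [t0|]; last first.
  by rewrite normr0 mulr_ge0 ?sqr_ge0// mulr_ge0.
rewrite normrM (ger0_norm (expR_ge0 _)).
have s1 : 1 <= t^-1 by rewrite invf_ge1//; apply: le_trans t1; rewrite ler_norm.
have h := hC _ s1.
have : t^-1 ^+ (size p).+2 / (size p).+2`!%:R <= expR t^-1.
  have /(_ (size p).+1) h3 := @expR_ge1Dxn _ t^-1 _ (le_trans ler01 s1).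
  by apply: le_trans h3; rewrite lerDr.
rewrite ler_pdivrMr ?ltr0n ?fact_gt0// => h2.
apply: le_trans (ler_wpM2r (expR_ge0 _) h) _.
rewrite -!mulrA ler_wpM2l// expRN ler_pdivrMr ?expR_gt0//.
have -> : t^-1 ^+ size p = t ^+ 2 * t^-1 ^+ (size p).+2.
  by rewrite -(addn2 (size p)) exprD mulrC -mulrA -exprMn mulVf ?gt_eqF// expr1n mulr1.
rewrite [leRHS](_ : _ = t ^+ 2 * (expR t^-1 * (size p).+2`!%:R)); last by ring.
by rewrite ler_wpM2l ?sqr_ge0.
Qed.

Lemma flat_derive p t : is_derive t 1 (flat p) (flat ('X^2 * (p - p^`())) t).
Proof.
have [t0|t0|->] := ltgtP t 0.
- have -> : flat ('X^2 * (p - p^`())) t = 0 by rewrite /flat ltNge (ltW t0).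
  apply: (@near_eq_is_derive _ _ _ (cst 0)).
    near=> s; rewrite /flat ltNge ifF//; apply/negbTE; rewrite negbK.
    by apply: ltW; near: s; exact: lt_nbhsl.
- have h1 : is_derive t 1 (fun s : R => s^-1) (- t ^- 2).
    have := @is_deriveV _ id t 1 1 _ (is_derive_id _ _).
    move=> /(_ _)/is_derive_eq; apply; first by rewrite gt_eqF.
    by rewrite /GRing.scale/= mulr1.
  have h2 := @is_derive1_comp _ (horner p) _ t _ _ (is_derive_poly p _) h1.
  have h3 := @is_derive1_comp _ expR (fun s => - s^-1) t _ _ (is_derive_expR _) (is_deriveN h1).
  have h4 := is_deriveM h2 h3.
  have h5 : is_derive t 1 (fun s => p.[s^-1] * expR (- s^-1)) (flat ('X^2 * (p - p^`())) t).
    apply: (is_derive_eq h4).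
    rewrite /flat t0 !hornerE /GRing.scale/= /comp.
    by rewrite exprVn; ring.
  apply: (near_eq_is_derive _ h5).
  near=> s; rewrite /flat ifT//.
  by near: s; exact: lt_nbhsr.
- have -> : flat ('X^2 * (p - p^`())) 0 = 0 by rewrite /flat ltxx.
  have [C [C0 hC]] := flat_bound p.
  have f0 : flat p 0 = 0 by rewrite /flat ltxx.
  have H : h^-1 *: (flat p (h *: 1 + 0) - flat p 0) @[h --> 0^'] --> (0 : R).
    apply/cvgr0Pnorm_le => e e0.
    have mp : 0 < Num.min 1 (e / (C + 1)).
      by rewrite lt_min ltr01/= divr_gt0// ltr_wpDl.
    near=> h.
    rewrite f0 subr0 addr0 /GRing.scale/= mulr1 normrM normfV.
    have hn0 : h != 0 by near: h; exact: nbhs_dnbhs_neq.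
    have n0 : 0 < `|h| by rewrite normr_gt0.
    have h1 : `|h| <= Num.min 1 (e / (C + 1)).
      by near: h; exact: (@dnbhs0_le R R _ mp).
    move: h1; rewrite le_min => /andP[h1 h2].
    rewrite mulrC ler_pdivrMr//; apply: le_trans (hC _ h1) _.
    rewrite -(real_normK (num_real h)) expr2 mulrA ler_wpM2r//.
    move: h2; rewrite ler_pdivlMr ?ltr_wpDl//; apply: le_trans.
    by rewrite mulrC ler_wpM2l// lerDl.
  split; first by apply: cvgP H.
  exact: cvg_lim H.
Unshelve. all: end_near. Qed.

Lemma smooth_flat p : smooth (flat p).
Proof.
move=> k; elim: k p => [|k IH] p.
  by move=> x; exact: is_derive_continuous (flat_derive p x).
by exists (flat ('X^2 * (p - p^`()))); split => // x; exact: flat_derive.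
Qed.

Lemma bump_exists (e : R) : 0 < e -> exists b : R -> R,
  [/\ smooth b, forall t, 0 <= b t, forall t, e <= `|t| -> b t = 0 & 0 < b 0].
Proof.
move=> e0.
pose b1 t := flat 1 (e + (-1) * t); pose b2 t := flat 1 (e + 1 * t).
have fge0 t : 0 <= flat 1 t.
  by rewrite /flat; case: ifP => // _; rewrite hornerE mul1r expR_ge0.
exists (b1 \* b2); split.
- by apply: smoothM; apply: smooth_affine; exact: smooth_flat.
- by move=> t; rewrite mulr_ge0// fge0.
- move=> t; rewrite ler_normr => /orP[h|h].
  + rewrite /= /b1 /flat ltNge (_ : e + -1 * t <= 0) ?mul0r//.
    by rewrite mulN1r subr_le0.
  + rewrite /= /b2 /flat [in X in _ * X]ltNge (_ : e + 1 * t <= 0) ?mulr0//.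
    by rewrite mul1r -(opprK t) subr_le0.
- have h : 0 < flat 1 e by rewrite /flat e0 hornerE ?mul1r expR_gt0.
  by rewrite /= /b1 /b2 !mulr0 addr0 mulr_gt0.
Qed.

Lemma smooth_cont f : smooth f -> continuous f.
Proof. by move/(_ 0%N). Qed.

Lemma supp_derive f df (e : R) : (forall x, is_derive x 1 f (df x)) ->
  (forall t, e <= `|t| -> f t = 0) -> forall t, e < `|t| -> df t = 0.
Proof.
move=> fdf f0 t et.
rewrite -(@derive_val _ _ _ _ _ _ _ (fdf t)).
have <- : 'D_1 (cst (0:R)) t = 0 by rewrite derive_cst.
apply: near_eq_derive.
near=> s; rewrite f0//; apply: ltW.
near: s.
by apply: (cvgr_gt `|t|) => //; exact: norm_continuous.
Unshelve. all: end_near. Qed.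

Lemma supp_bounded f (e : R) : continuous f ->
  (forall t, e < `|t| -> f t = 0) -> exists C : R, 0 <= C /\ forall t, `|f t| <= C.
Proof.
move=> cf f0.
have [e0|e0] := ltP e 0.
  by exists 0; split => // t; rewrite f0 ?normr0// (lt_le_trans e0).
have cnf : {within `[-e, e], continuous (fun x => `|f x|)}.
  apply: continuous_subspaceT => x.
  apply: (@continuous_comp _ _ _ f (fun x => `|x|)); first exact: cf.
  exact: norm_continuous.
have [|c cab hc] := @EVT_max _ (fun x => `|f x|) (-e) e _ cnf; first by lra.
exists `|f c|; split => // t.
have [et|et] := ltP e `|t|; first by rewrite f0// normr0.
by apply: hc; rewrite in_itv/= -ler_norml.
Qed.

Lemma derive_lipschitz f df (C : R) : (forall x, is_derive x 1 f (df x)) ->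
  (forall x, `|df x| <= C) -> forall x y, `|f x - f y| <= C * `|x - y|.
Proof.
move=> fdf hC.
have H x y : x < y -> `|f y - f x| <= C * `|y - x|.
  move=> xy; have [|c _ ->] := MVT xy (fun z _ => fdf z).
    by apply: continuous_subspaceT => z; exact: is_derive_continuous (fdf z).
  by rewrite normrM ler_wpM2r.
move=> x y; have [xy|yx|->] := ltgtP x y.
- by rewrite distrC (distrC x); exact: H.
- exact: H.
- by rewrite !subrr normr0 mulr0.
Qed.

Lemma second_difference f f1 f2 f3 (C : R) :
  (forall x, is_derive x 1 f (f1 x)) -> (forall x, is_derive x 1 f1 (f2 x)) ->
  (forall x, is_derive x 1 f2 (f3 x)) -> (forall x, `|f3 x| <= C) ->
  forall s t, 0 < t ->
  `|f (s + t) + f (s - t) - f s *+ 2 - t ^+ 2 * f2 s| <= 2 * C * t ^+ 3.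
Proof.
move=> h1 h2 h3 hC s t t0.
pose psi (r : R) := f (s + 1 * r) + f (s + (-1) * r) - f s *+ 2 - r * (r * f2 s).
pose dpsi (r : R) := f1 (s + 1 * r) - f1 (s + (-1) * r) - 2 * r * f2 s.
have aff (c r : R) : is_derive r 1 (fun u => s + c * u) c.
  by apply: is_derive_eq; rewrite /GRing.scale/= mulr1; ring.
have C0 : 0 <= C by apply: le_trans (hC 0).
have dP (r : R) : is_derive r 1 psi (dpsi r).
  have d1 := @is_derive1_comp _ f _ r _ _ (h1 (s + 1 * r)) (aff 1 r).
  have d2 := @is_derive1_comp _ f _ r _ _ (h1 (s + (-1) * r)) (aff (-1) r).
  have d3 : is_derive r 1 (fun u => u * (u * f2 s)) (2 * r * f2 s).
    apply: is_derive_eq.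
    by rewrite /GRing.scale/= ; ring.
  have d4 := is_deriveB (is_deriveB (is_deriveD d1 d2) (is_derive_cst (f s *+ 2) r 1)) d3.
  apply: is_derive_eq.
  by rewrite /dpsi; ring.
have lip2 := derive_lipschitz h3 hC.
have dbound (r : R) : 0 < r -> `|dpsi r| <= 2 * C * r ^+ 2.
  move=> r0.
  have sr : s - r < s + r by lra.
  have [|c cab hc] := MVT sr (fun z _ => h2 z).
  - by apply: continuous_subspaceT => z; exact: is_derive_continuous (h2 z).
  - rewrite /dpsi mul1r mulN1r hc.
    have -> : f2 c * (s + r - (s - r)) - 2 * r * f2 s = 2 * r * (f2 c - f2 s) by ring.
    rewrite normrM ger0_norm; last by lra.
    have := lip2 c s.
    have cs : `|c - s| <= r.
      by move: cab; rewrite in_itv/= => /andP[? ?]; rewrite ler_norml; lra.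
    move=> h; have : `|f2 c - f2 s| <= C * r.
      by apply: le_trans h _; rewrite ler_wpM2l.
    by move=> h'; nra.
have [|c] := MVT t0 (fun z _ => dP z).
  by apply: continuous_subspaceT => z; exact: is_derive_continuous (dP z).
rewrite in_itv/= => /andP[c0 ct].
have -> : psi 0 = 0 by rewrite /psi !mulr0 !addr0 mul0r subr0 mulr2n subrr.
rewrite !subr0 => hc.
have <- : psi t = f (s + t) + f (s - t) - f s *+ 2 - t ^+ 2 * f2 s.
  by rewrite /psi mul1r mulN1r mulrA -expr2.
rewrite hc normrM (gtr0_norm t0).
have -> : 2 * C * t ^+ 3 = (2 * C * t ^+ 2) * t by ring.
rewrite ler_wpM2r ?(ltW t0)//; apply: le_trans (dbound _ c0) _.
by rewrite ler_wpM2l ?mulr_ge0// lerXn2r ?nnegrE ?(ltW c0) ?(ltW t0) ?(ltW ct).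
Qed.

End smooth1.

Section prodf.
Variables (R : realType).
Local Notation "'e_ i" := (delta_mx ord0 i) (at level 8, i at level 2, format "''e_' i").

Lemma contM (T : topologicalType) (f g : T -> R) x :
  {for x, continuous f} -> {for x, continuous g} ->
  {for x, continuous (fun y => f y * g y)}.
Proof. by move=> cf cg; apply: cvgM. Qed.

Lemma contD (T : topologicalType) (f g : T -> R) x :
  {for x, continuous f} -> {for x, continuous g} ->
  {for x, continuous (fun y => f y + g y)}.
Proof. by move=> cf cg; apply: cvgD. Qed.

Lemma contN (T : topologicalType) (f : T -> R) x :
  {for x, continuous f} -> {for x, continuous (fun y => - f y)}.
Proof. by move=> cf; apply: cvgN. Qed.

Lemma contB (T : topologicalType) (f g : T -> R) x :
  {for x, continuous f} -> {for x, continuous g} ->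
  {for x, continuous (fun y => f y - g y)}.
Proof. by move=> cf cg; apply: contD => //; exact: contN. Qed.

Lemma cont_coord n (i : 'I_n) (x : 'rV[R]_n) :
  {for x, continuous (fun z : 'rV[R]_n => z ord0 i)}.
Proof. exact: coord_continuous. Qed.

Lemma cont_prod (T : topologicalType) (I : Type) (s : seq I) (F : I -> T -> R) x :
  (forall i, {for x, continuous (F i)}) ->
  {for x, continuous (fun y => \prod_(i <- s) F i y)}.
Proof.
move=> cF; elim: s => [|i s IH].
  have -> : (fun z : T => \prod_(i <- [::]) F i z) = cst 1.
    by apply/funext => y; rewrite big_nil.
  exact: cst_continuous.
have -> : (fun z => \prod_(j <- i :: s) F j z) =
    (fun y => F i y * \prod_(j <- s) F j y).
  by apply/funext => y; rewrite big_cons.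
exact: contM.
Qed.

Lemma cont_sum (T : topologicalType) (I : Type) (s : seq I) (F : I -> T -> R) x :
  (forall i, {for x, continuous (F i)}) ->
  {for x, continuous (fun y => \sum_(i <- s) F i y)}.
Proof.
move=> cF; elim: s => [|i s IH].
  have -> : (fun z : T => \sum_(i <- [::]) F i z) = cst 0.
    by apply/funext => y; rewrite big_nil.
  exact: cst_continuous.
have -> : (fun z => \sum_(j <- i :: s) F j z) =
    (fun y => F i y + \sum_(j <- s) F j y).
  by apply/funext => y; rewrite big_cons.
exact: contD.
Qed.

Definition prodf n (F : 'I_n -> R -> R) (z : 'rV[R]_n) : R :=
  \prod_i F i (z ord0 i).

Lemma prodfD1 n (F : 'I_n -> R -> R) z i :
  prodf F z = F i (z ord0 i) * \prod_(j | j != i) F j (z ord0 j).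
Proof. by rewrite /prodf (bigD1 i). Qed.

Lemma coord_shift n (z : 'rV[R]_n) i (t : R) j :
  (z + t *: 'e_i) ord0 j = z ord0 j + t * (j == i)%:R.
Proof. by rewrite !mxE eqxx andTb. Qed.

Lemma prodf_shift n (F : 'I_n -> R -> R) z i t :
  prodf F (z + t *: 'e_i) = F i (z ord0 i + t) * \prod_(j | j != i) F j (z ord0 j).
Proof.
rewrite (prodfD1 _ _ i) coord_shift eqxx mulr1; congr (_ * _).
by apply: eq_bigr => j ji; rewrite coord_shift (negbTE ji) mulr0 addr0.
Qed.

Definition upd n (F : 'I_n -> R -> R) i (h : R -> R) : 'I_n -> R -> R :=
  fun j => if j == i then h else F j.

Lemma prodf_upd n (F : 'I_n -> R -> R) i h z :
  prodf (upd F i h) z = h (z ord0 i) * \prod_(j | j != i) F j (z ord0 j).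
Proof.
rewrite (prodfD1 _ _ i) /upd eqxx; congr (_ * _).
by apply: eq_bigr => j /negbTE ->.
Qed.

Lemma is_derive_prodf n (F : 'I_n -> R -> R) i h :
  (forall x : R, is_derive x 1 (F i) (h x)) ->
  forall z, is_derive z 'e_i (prodf F) (prodf (upd F i h) z).
Proof.
move=> Fh z.
have H : t^-1 *: (prodf F (t *: 'e_i + z) - prodf F z) @[t --> 0^'] -->
    prodf (upd F i h) z.
  rewrite prodf_upd (_ : (fun t => _) = (fun t =>
      t^-1 *: (F i (t *: 1 + z ord0 i) - F i (z ord0 i))
      * \prod_(j | j != i) F j (z ord0 j))); last first.
    apply/funext => t; rewrite [t *: _ + z]addrC prodf_shift (prodfD1 _ _ i) /GRing.scale/= mulr1.
    by rewrite -mulrA mulrBl (addrC t).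
  apply: cvgM; last exact: cvg_cst.
  have /derivableP := (@ex_derive _ _ _ _ _ _ _ (Fh (z ord0 i))).
  rewrite derive_val => -[_ <-].
  exact: (@ex_derive _ _ _ _ _ _ _ (Fh (z ord0 i))).
split; first exact: cvgP H.
exact: cvg_lim H.
Qed.

Lemma continuous_prodf n (F : 'I_n -> R -> R) :
  (forall i, continuous (F i)) -> continuous (prodf F).
Proof.
move=> cF z; apply: (@cont_prod 'rV[R]_n) => i.
apply: (@continuous_comp 'rV[R]_n); [exact: cont_coord|exact: cF].
Qed.

Lemma measurable_prodf n (F : 'I_n -> R -> R) :
  (forall i, continuous (F i)) -> measurable_fun [set: 'rV[R]_n] (prodf F).
Proof.
move=> cF; rewrite /prodf.
apply: measurable_prod => i _.
apply: (measurableT_comp (f := F i)); last exact: (@measurable_coord _ R).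
exact: continuous_measurable_fun.
Qed.

Lemma partial_prodf n (F : 'I_n -> R -> R) i h :
  (forall x : R, is_derive x 1 (F i) (h x)) ->
  partial i (prodf F) = prodf (upd F i h).
Proof.
move=> Fh; apply/funext => z; rewrite /partial.
by have := is_derive_prodf Fh z => ?; rewrite derive_val.
Qed.

Lemma smooth_upd n (F : 'I_n -> R -> R) i h :
  (forall j, smooth (F j)) -> smooth h -> forall j, smooth (upd F i h j).
Proof. by move=> sF sh j; rewrite /upd; case: ifP. Qed.

Lemma partials_prodf n (F : 'I_n -> R -> R) (s : seq 'I_n) :
  (forall i, smooth (F i)) ->
  exists G, (forall i, smooth (G i)) /\ partials s (prodf F) = prodf G.
Proof.
move=> sF; elim: s => [|i s [G [sG IH]]]; first by exists F.
have [h [Gh sh]] := smooth_deriveP (sG i).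
exists (upd G i h); split; first exact: smooth_upd.
by rewrite /= IH (partial_prodf Gh).
Qed.

Lemma Ck_prodf n (F : 'I_n -> R -> R) k D : (forall i, smooth (F i)) ->
  Ck_on k D (prodf F).
Proof.
move=> sF s x _ _; have [G [sG ->]] := partials_prodf s sF; split.
  by apply: continuous_prodf => i; exact: smooth_cont.
move=> _ i; have [h [Gh sh]] := smooth_deriveP (sG i).
exact: (@ex_derive _ _ _ _ _ _ _ (is_derive_prodf Gh x)).
Qed.

Lemma integral_prodf n (F : 'I_n -> R -> R) (I : 'I_n -> R) :
  (forall i, continuous (F i)) -> (forall i t, 0 <= F i t) ->
  (forall i, (\int[@lebesgue_measure R]_t (F i t)%:E = (I i)%:E)%E) ->
  (\int[leb R n]_z (prodf F z)%:E = (\prod_i I i)%:E)%E.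
Proof.
elim: n F I => [|n IH] F I cF F0 FI.
  rewrite big_ord0 /=.
  under eq_integral do rewrite /prodf big_ord0.
  by rewrite integral_cst//= mul1e diracT.
have P0 m (G : 'I_m -> R -> R) z : (forall i t, 0 <= G i t) -> 0 <= prodf G z.
  by move=> G0; apply: prodr_ge0.
pose G := fun j : 'I_n => F (lift ord0 j).
have cG i : continuous (G i) by exact: cF.
have G0 i t : 0 <= G i t by exact: F0.
have E p : prodf F (@rV_cons R n p) = F ord0 p.1 * prodf G p.2.
  rewrite /prodf big_ord_recl; congr (_ * _).
    by rewrite mxE unlift_none.
  by apply: eq_bigr => i _; rewrite mxE liftK.
transitivity (\int[pushforward (@lebesgue_measure R \x leb R n)%E (@rV_cons R n)]_z (prodf F z)%:E)%E.
  by [].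
rewrite ge0_integral_pushforward//; last 3 first.
- exact: measurable_rV_cons.
- by apply/measurable_EFinP; exact: measurable_prodf.
- by move=> y _; rewrite lee_fin P0.
rewrite preimage_setT.
under eq_integral do rewrite /= E.
rewrite fubini_tonelli1//=; last 2 first.
- apply/measurable_EFinP; apply: measurable_funM.
    apply: (measurableT_comp (f := F ord0)); last exact: measurable_fst.
    exact: continuous_measurable_fun.
  apply: (measurableT_comp (f := prodf G)); last exact: measurable_snd.
  exact: measurable_prodf.
- by move=> p; rewrite lee_fin mulr_ge0 ?P0.
rewrite /fubini_F/=.
under eq_integral => t _.
  rewrite (_ : (fun y => _) = (fun y => (F ord0 t)%:E * (prodf G y)%:E)%E)//.
  rewrite ge0_integralZl//; last 3 first.
  - by apply/measurable_EFinP; exact: measurable_prodf.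
  - by move=> y _; rewrite lee_fin P0.
  - by rewrite lee_fin.
  rewrite (IH G (fun j => I (lift ord0 j)))//; last by move=> i; exact: FI.
  rewrite muleC.
  over.
rewrite ge0_integralZl//; last 3 first.
- by apply/measurable_EFinP; exact: continuous_measurable_fun.
- by move=> t _; rewrite lee_fin.
- rewrite lee_fin; apply: prodr_ge0 => i _.
  by rewrite -lee_fin -FI; apply: integral_ge0 => t _; rewrite lee_fin.
by rewrite FI big_ord_recl -EFinM mulrC.
Qed.

End prodf.

Section local_approx.
Variables (R : realType).
Local Notation "'e_ i" := (delta_mx ord0 i) (at level 8, i at level 2, format "''e_' i").

Lemma rV_norm_le n (z : 'rV[R]_n) r : 0 <= r ->
  (`|z| <= r) <-> (forall i, `|z ord0 i| <= r).
Proof.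
move=> r0; rewrite {1}/Num.norm/= mx_normrE; split.
  by move=> /bigmax_leP[_ h] i; exact: (h (ord0, i)).
by move=> h; apply/bigmax_leP; split => // -[i j] _ /=; rewrite (ord1 i).
Qed.

Lemma rV_coord_le n (z : 'rV[R]_n) i : `|z ord0 i| <= `|z|.
Proof. by have /rV_norm_le := lexx `|z|; apply. Qed.

Lemma cball_compact n (x : 'rV[R]_n) r : compact [set z | `|z - x| <= r].
Proof.
have [r0|r0] := ltP r 0.
  have -> : [set z : 'rV[R]_n | `|z - x| <= r] = set0; last exact: compact0.
  by apply/seteqP; split => // z /= /le_lt_trans/(_ r0); rewrite normr_lt0.
have -> : [set z | `|z - x| <= r] =
    [set z | forall i, `[x ord0 i - r, x ord0 i + r]%classic (z ord0 i)].
  apply/seteqP; split => z /=.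
    move=> /(rV_norm_le _ r0) h i; have := h i; rewrite !mxE in_itv/= ler_distl.
    by [].
  move=> h; apply/(rV_norm_le _ r0) => i; have := h i; rewrite in_itv/= !mxE.
  by rewrite ler_distl.
apply: (@rV_compact R n (fun i => `[x ord0 i - r, x ord0 i + r]%classic)) => i.
exact: segment_compact.
Qed.

Lemma cball_nbhs n (x : 'rV[R]_n) (A : set 'rV[R]_n) : nbhs x A ->
  exists2 r, 0 < r & forall z, `|z - x| <= r -> A z.
Proof.
move=> /nbhs_ballP[r /= r0 h]; exists (r / 2); first by rewrite divr_gt0.
move=> z zr; apply: h; rewrite mx_norm_ball /ball_/= distrC.
by apply: le_lt_trans zr _; rewrite ltr_pdivrMr// ltr_pMr// ltr1n.
Qed.

Lemma nbhs_cball n (x : 'rV[R]_n) r (A : set 'rV[R]_n) : 0 < r ->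
  (forall z, `|z - x| < r -> A z) -> nbhs x A.
Proof.
move=> r0 h; apply/nbhs_ballP; exists r => // z; rewrite mx_norm_ball /ball_/= => zx.
by apply: h; rewrite distrC.
Qed.

Lemma cont_nearP (T : topologicalType) (f : T -> R) x : {for x, continuous f} <->
  forall e, 0 < e -> nbhs x [set z | `|f z - f x| <= e].
Proof.
split.
  move=> cf e e0; have /cvgrPdist_le/(_ e e0) := cf.
  by apply: filterS => z /=; rewrite distrC.
move=> h; apply/cvgrPdist_le => e /h; apply: filterS => z /=.
by rewrite distrC.
Qed.

Lemma cont_cball n (f : 'rV[R]_n -> R) x : {for x, continuous f} <->
  forall e, 0 < e -> exists2 r, 0 < r & forall z, `|z - x| <= r -> `|f z - f x| <= e.
Proof.
split.
  by move=> /(@cont_nearP 'rV[R]_n) cf e /cf/cball_nbhs.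
move=> h; apply/(@cont_nearP 'rV[R]_n) => e e0.
have [r r0 hr] := h e e0.
by apply: (nbhs_cball r0) => z zx; apply: hr; exact: ltW.
Qed.

Lemma cball_unif_cont n (u : 'rV[R]_n -> R) x r e : 0 < e ->
  (forall y, `|y - x| <= r -> {for y, continuous u}) ->
  exists2 d, 0 < d & forall y z, `|y - x| <= r -> `|z - y| <= d ->
    `|u z - u y| <= e.
Proof.
move=> e0 cu.
pose P (d : R) (y : 'rV[R]_n) := forall z, `|z - y| <= d -> `|u z - u y| <= e.
have : \forall d \near (0 : R)^'+, [set z | `|z - x| <= r] `<=` P d.
  have /compact_near_coveringP := @cball_compact n x r.
  apply => y yr.
  have e20 : 0 < e / 2 by rewrite divr_gt0.
  have [d d0 hd] := (cont_cball u y).1 (cu _ yr) _ e20.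
  exists ([set z | `|z - y| < d / 2], [set t : R | t <= d / 2]) => /=.
    split; first by apply: (@nbhs_cball _ _ (d / 2)) => //; rewrite divr_gt0.
    by apply: nbhs_right_le; rewrite divr_gt0.
  move=> [z t] /= [zy td] w wz.
  have h1 : `|u w - u y| <= e / 2.
    apply: hd; rewrite -(subrKA z); apply: le_trans (ler_normD _ _) _.
    by move/ltW: zy => zy; rewrite (splitr d) lerD// (le_trans wz).
  have h2 : `|u z - u y| <= e / 2.
    by apply: hd; apply: le_trans (ltW zy) _; rewrite ler_pdivrMr// ler_pMr// ler1n.
  rewrite -(subrKA (u y)); apply: le_trans (ler_normD _ _) _.
  by rewrite (splitr e) lerD// distrC.
move=> H.
have : \forall d \near (0 : R)^'+, (0 < d) /\ [set z | `|z - x| <= r] `<=` P d.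
  near=> d; split; first by near: d; exact: nbhs_right_gt.
  by near: d.
move=> /filter_ex[d [d0 hd]]; exists d => // y z yr zy.
exact: hd.
Unshelve. all: end_near. Qed.

Definition lapdiff n (t : R) (U : 'rV[R]_n -> R) (x : 'rV[R]_n) : R :=
  \sum_i (U (x + t *: 'e_i) + U (x - t *: 'e_i) - U x *+ 2).

Definition haslap n (U : 'rV[R]_n -> R) x (lam : R) :=
  forall eta, 0 < eta -> exists2 t0, 0 < t0 & forall t, 0 < t < t0 ->
    `|lapdiff t U x - lam * t ^+ 2| <= eta * t ^+ 2.

(* The form of [c1 <= Delta u <= c2] used throughout: [u] is a locally uniform limit of functions
   whose second differences satisfy the bounds pointwise. The mollifications of a distributional
   solution are such functions, and the maximum principle passes to the limit. *)
Definition lap_between n (D : set 'rV[R]_n) (c1 c2 : R) (u : 'rV[R]_n -> R) :=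
  forall x, D x -> exists2 s, 0 < s & forall eta, 0 < eta ->
    exists U : 'rV[R]_n -> R, forall y, `|y - x| <= s ->
      [/\ `|U y - u y| <= eta, {for y, continuous U} &
          exists2 lam, c1 <= lam <= c2 & haslap U y lam].

End local_approx.

(** * Mollification of distributional solutions *)

Section mollify.
Variables (R : realType).
Local Notation "'e_ i" := (delta_mx ord0 i) (at level 8, i at level 2, format "''e_' i").

Lemma prod_norm_le (I : Type) (s : seq I) (a : I -> R) (K : R) :
  0 <= K -> (forall i, `|a i| <= K) -> `|\prod_(i <- s) a i| <= K ^+ size s.
Proof.
move=> K0 aK; elim: s => [|i s IH]; first by rewrite big_nil normr1 expr0.
by rewrite big_cons normrM /= exprS ler_pM.
Qed.

Lemma prod_lip (I : Type) (s : seq I) (a b : I -> R) (K d : R) :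
  1 <= K -> 0 <= d -> (forall i, `|a i| <= K) -> (forall i, `|b i| <= K) ->
  (forall i, `|a i - b i| <= d) ->
  `|\prod_(i <- s) a i - \prod_(i <- s) b i| <= (size s)%:R * K ^+ size s * d.
Proof.
move=> K1 d0 aK bK abd; have K0 : 0 <= K by lra.
elim: s => [|i s IH]; first by rewrite !big_nil subrr normr0 !mul0r.
rewrite !big_cons.
set A := \prod_(j <- s) a j in IH *; set B := \prod_(j <- s) b j in IH *.
have -> : a i * A - b i * B = (a i - b i) * A + b i * (A - B) by ring.
apply: le_trans (ler_normD _ _) _; rewrite !normrM.
have hA : `|A| <= K ^+ size s by exact: prod_norm_le.
have h1 : `|a i - b i| * `|A| <= d * K ^+ size s by rewrite ler_pM.
have h2 : `|b i| * `|A - B| <= K * ((size s)%:R * K ^+ size s * d) by rewrite ler_pM.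
rewrite /= -natr1 exprS.
have : d * K ^+ size s <= d * (K * K ^+ size s).
  by rewrite ler_wpM2l// ler_peMl// exprn_ge0.
by move: (K ^+ size s) h1 h2 => X; lra.
Qed.

Lemma integral_translation (b : R -> R) (a : R) :
  continuous b -> (forall t, 0 <= b t) ->
  (\int[@lebesgue_measure R]_t (b (- a + 1 * t))%:E =
   \int[@lebesgue_measure R]_t (b t)%:E)%E.
Proof.
move=> cb b0; apply/esym.
pose F (t : R) := - a + 1 * t.
have dF (t : R) : is_derive t 1 F 1.
  by apply: is_derive_eq; rewrite /GRing.scale/= mulr1; ring.
have F' : derive1 F = cst 1.
  by apply/funext => t; rewrite derive1E derive_val.
rewrite (@increasing_ge0_integration_by_substitutionT _ F b)//; last 6 first.
- by move=> x y; rewrite /F; lra.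
- by rewrite F'; exact: cst_continuous.
- by rewrite F'; exact: is_cvg_cst.
- by rewrite F'; exact: is_cvg_cst.
- apply/cvgrNyPle => /= B; apply: filterS (nbhs_ninfty_le (num_real (B + a))).
  by move=> t /=; rewrite /F; lra.
- apply/cvgryPge => /= B; apply: filterS (nbhs_pinfty_ge (num_real (B + a))).
  by move=> t /=; rewrite /F; lra.
by apply: eq_integral => t _; rewrite F' /= mulr1.
Qed.

Lemma integral_bump (b : R -> R) (e : R) : continuous b -> (forall t, 0 <= b t) ->
  (forall t, e <= `|t| -> b t = 0) -> 0 < b 0 ->
  exists2 J, 0 < J & (\int[@lebesgue_measure R]_t (b t)%:E = J%:E)%E.
Proof.
move=> cb b0 be bp.
have e0 : 0 < e.
  by rewrite ltNge; apply/negP => e0; move: bp; rewrite be ?ltxx// normr0.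
have [C [C0 hC]] : exists C, 0 <= C /\ forall t, `|b t| <= C.
  by apply: (@supp_bounded _ _ e) => // t et; apply: be; exact: ltW.
have indm (c d : R) : measurable (`[c, d]%classic : set R) by exact: measurable_itv.
have hI (c d : R) : c < d ->
    (\int[@lebesgue_measure R]_x (\1_(`[c, d]%classic : set R) x)%:E = (d - c)%:E)%E.
  move=> cd; rewrite integral_indic// setIT.
  have := @lebesgue_measure_itv R `[c, d]; rewrite /= lte_fin cd -EFinD; exact.
have mb : measurable_fun [set: R] (fun t => (b t)%:E).
  by apply/measurable_EFinP; exact: continuous_measurable_fun.
have hi : (\int[@lebesgue_measure R]_t (b t)%:E <= (C * (2 * e))%:E)%E.
  apply: (@le_trans _ _ (\int[@lebesgue_measure R]_t (C%:E * (\1_(`[- e, e]%classic : set R) t)%:E))%E).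
    apply: ge0_le_integral => //.
    - by move=> t _; rewrite lee_fin.
    - apply/emeasurable_funM; first exact: measurable_cst.
      by apply/measurable_EFinP; exact: measurable_indic.
    - move=> t _; rewrite -EFinM lee_fin indicE.
      have [te|te] := leP e `|t|; first by rewrite be// mulr_ge0.
      rewrite mem_set ?mulr1; last by rewrite /= in_itv/= -ler_norml ltW.
      by apply: le_trans (hC t); exact: ler_norm.
  rewrite ge0_integralZl//; last first.
    by apply/measurable_EFinP; exact: measurable_indic.
  rewrite hI//; last by lra.
  by rewrite -EFinM lee_fin; apply: ler_wpM2l => //; lra.
have lo : exists2 J, 0 < J & (J%:E <= \int[@lebesgue_measure R]_t (b t)%:E)%E.
  have b20 : 0 < b 0 / 2 by rewrite divr_gt0.
  have /cont_nearP/(_ _ b20) /nbhs_ballP[d /= d0 hd] := cb 0.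
  exists (b 0 / 2 * (d / 2)); first by rewrite mulr_gt0// divr_gt0.
  apply: (@le_trans _ _ (\int[@lebesgue_measure R]_t ((b 0 / 2)%:E * (\1_(`[0, d / 2]%classic : set R) t)%:E))%E).
    rewrite ge0_integralZl//; last 2 first.
    - by apply/measurable_EFinP; exact: measurable_indic.
    - by rewrite lee_fin ltW// divr_gt0.
    by rewrite hI ?divr_gt0// subr0 -EFinM lexx.
  apply: ge0_le_integral => //.
  - by move=> t _; rewrite mule_ge0// lee_fin// ltW.
  - apply/emeasurable_funM; first exact: measurable_cst.
    by apply/measurable_EFinP; exact: measurable_indic.
  - move=> t _; rewrite -EFinM lee_fin indicE.
    have [/set_mem /=|_] := boolP (_ \in _); last by rewrite mulr0.
    rewrite in_itv/= mulr1 => /andP[t0 td].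
    have : ball 0 d t.
      by rewrite /ball/= /ball_ sub0r normrN ger0_norm//; lra.
    by move=> /hd /=; rewrite ler_norml; lra.
have [J J0 hJ] := lo.
have fI : (\int[@lebesgue_measure R]_t (b t)%:E)%E \is a fin_num.
  rewrite ge0_fin_numE; first exact: (le_lt_trans hi (ltry _)).
  by apply: integral_ge0 => t _; rewrite lee_fin.
exists (fine (\int[@lebesgue_measure R]_t (b t)%:E)%E); last by rewrite fineK.
by apply: (lt_le_trans J0); rewrite -lee_fin fineK.
Qed.

Lemma measurable_cball n (x : 'rV[R]_n) r : measurable [set z | `|z - x| <= r].
Proof.
have [r0|r0] := ltP r 0.
  have -> : [set z : 'rV[R]_n | `|z - x| <= r] = set0; last exact: measurable0.
  by apply/seteqP; split => // z /= /le_lt_trans/(_ r0); rewrite normr_lt0.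
have -> : [set z | `|z - x| <= r] = \big[setI/setT]_(i < n)
    (setT `&` (fun z : 'rV[R]_n => z ord0 i) @^-1` `[x ord0 i - r, x ord0 i + r]%classic).
  rewrite -bigcap_seq; apply/seteqP; split => z /=.
    move=> /(rV_norm_le _ r0) h i _; split => //=; have := h i; rewrite !mxE in_itv/= ler_distl.
    by [].
  move=> h; apply/(rV_norm_le _ r0) => i; have [_] /= := h i (mem_index_enum i); rewrite in_itv/= !mxE.
  by rewrite ler_distl.
apply: bigsetI_measurable => i _.
apply: (@measurable_coord _ R) => //; exact: measurable_itv.
Qed.

Section integrals.
Context d (T : measurableType d) (mu : {measure set T -> \bar R}).
Implicit Types (B D : set T) (k g h : T -> R) (C : R).

Lemma Rintegral_supp B D k : B `<=` D -> (forall z, ~ B z -> k z = 0) ->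
  \int[mu]_(z in D) k z = \int[mu]_(z in B) k z.
Proof.
move=> BD k0; rewrite Rintegral_mkcond [RHS]Rintegral_mkcond.
congr Rintegral; apply/funext => z; rewrite !patchE.
have [zB|zB] := boolP (z \in B).
  by rewrite mem_set//; apply: BD; exact: set_mem.
rewrite k0 ?if_same// => Bz; move/negP: zB; apply; exact: mem_set.
Qed.

Lemma integrable_mul_bounded B k h C : measurable B ->
  mu.-integrable B (EFin \o k) -> measurable_fun setT h ->
  (forall z, `|h z| <= C) -> mu.-integrable B (EFin \o (fun z => k z * h z)).
Proof.
move=> mB ik mh hC.
have -> : EFin \o (fun z => k z * h z) = ((EFin \o k) \* (EFin \o h))%E.
  by apply/funext => z /=; rewrite EFinM.
apply: integrableMl => //; first exact: measurable_funS mh.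
exists C; split; first exact: num_real.
by move=> M CM z _ /=; apply: le_trans (hC z) (ltW CM).
Qed.

Lemma ae_le_Rintegral B k g : measurable B ->
  mu.-integrable B (EFin \o k) -> mu.-integrable B (EFin \o g) ->
  {ae mu, forall z, B z -> k z <= g z} ->
  \int[mu]_(z in B) k z <= \int[mu]_(z in B) g z.
Proof.
move=> mB ik ig [N [mN N0 hN]].
have E h : mu.-integrable B (EFin \o h) ->
    \int[mu]_(z in B) h z = \int[mu]_(z in B `\` N) h z.
  by move=> ih; rewrite /Rintegral; congr fine; exact: (negligible_integral mN mB ih N0).
rewrite (E _ ik) (E _ ig).
have mBN : measurable (B `\` N) by exact: measurableD.
have SB : B `\` N `<=` B by move=> z [].
apply: le_Rintegral => //; [exact: integrableS ik|exact: integrableS ig|].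
move=> z [Bz Nz]; apply: contrapT => kg; apply: Nz; apply: hN => /= /(_ Bz).
exact: kg.
Qed.

End integrals.
End mollify.

Section weak.
Variables (R : realType).
Local Notation "'e_ i" := (delta_mx ord0 i) (at level 8, i at level 2, format "''e_' i").

Definition bumps n (b : R -> R) (y : 'rV[R]_n) : 'I_n -> R -> R :=
  fun i t => b (- y ord0 i + 1 * t).

Definition bumpf n (b : R -> R) (y : 'rV[R]_n) : 'rV[R]_n -> R :=
  prodf (bumps b y).

Lemma bumpf_shift n b (y z : 'rV[R]_n) i t :
  bumpf b (y + t *: 'e_i) z = bumpf b y (z + (- t) *: 'e_i).
Proof.
rewrite /bumpf prodf_shift (prodfD1 _ _ i) /bumps coord_shift eqxx mulr1; congr (_ * _).
  by congr b; ring.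
apply: eq_bigr => j /negbTE ji; rewrite coord_shift ji mulr0 addr0.
by [].
Qed.

Lemma lapdiff_bumpf n b (y z : 'rV[R]_n) t :
  lapdiff t (bumpf b ^~ z) y = lapdiff t (bumpf b y) z.
Proof.
apply: eq_bigr => i _; rewrite bumpf_shift -scaleNr bumpf_shift opprK.
by congr (_ - _); rewrite addrC.
Qed.

Section bump.
Variables (n : nat) (b : R -> R) (e : R).
Hypotheses (sb : smooth b) (b0 : forall t, 0 <= b t)
  (be : forall t, e <= `|t| -> b t = 0).

Lemma bumpf_ge0 (y z : 'rV[R]_n) : 0 <= bumpf b y z.
Proof. by apply: prodr_ge0 => i _; exact: b0. Qed.

Lemma bumps_smooth (y : 'rV[R]_n) i : smooth (bumps b y i).
Proof. exact: smooth_affine. Qed.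

Lemma bumpf_supp (y z : 'rV[R]_n) : 0 < e -> e < `|z - y| -> bumpf b y z = 0.
Proof.
move=> e0 ezy.
have [i hi] : exists i, e <= `|z ord0 i - y ord0 i|.
  apply: contrapT => h; move: ezy; apply/negP; rewrite -leNgt.
  apply/(rV_norm_le _ (ltW e0)) => i; rewrite !mxE leNgt; apply/negP => ei.
  by apply: h; exists i; exact: ltW.
by rewrite /bumpf (prodfD1 _ _ i) /bumps be ?mul0r// mul1r addrC.
Qed.

Lemma bumpf_test (D : set 'rV[R]_n) (y : 'rV[R]_n) : 0 < e ->
  (forall z, `|z - y| <= e -> D z) -> test_function D (bumpf b y).
Proof.
move=> e0 hD.
have sub : closure [set z | bumpf b y z != 0] `<=` [set z | `|z - y| <= e].
  have cl : closed [set z : 'rV[R]_n | `|z - y| <= e].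
    exact: (compact_closed (@norm_hausdorff _ _) (@cball_compact R n y e)).
  rewrite [X in _ `<=` X]((closure_id _).1 cl); apply: closure_subset => z /=.
  by rewrite leNgt; apply: contraNN => /(bumpf_supp e0) ->.
split.
- by move=> k; apply: Ck_prodf => i; exact: bumps_smooth.
- exact: (subclosed_compact (@closed_closure _ _) (@cball_compact R n y e) sub).
- by move=> z /sub /=; exact: hD.
Qed.

Lemma laplacian_bumpf (y : 'rV[R]_n) b1 b2 :
  (forall x : R, is_derive x 1 b (b1 x)) -> (forall x : R, is_derive x 1 b1 (b2 x)) ->
  laplacian (bumpf b y) = fun z =>
    \sum_i b2 (- y ord0 i + 1 * z ord0 i) *
      \prod_(j | j != i) bumps b y j (z ord0 j).
Proof.
move=> h1 h2; apply/funext => z; apply: eq_bigr => i _.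
have aff (t : R) : is_derive t 1 (fun u : R => - y ord0 i + 1 * u) 1.
  by apply: is_derive_eq; rewrite /GRing.scale/= mulr1; ring.
have d1 (t : R) : is_derive t 1 (bumps b y i) (b1 (- y ord0 i + 1 * t)).
  have := @is_derive1_comp _ b _ t _ _ (h1 _) (aff t).
  by rewrite mulr1.
have d2 (t : R) : is_derive t 1 (fun t => b1 (- y ord0 i + 1 * t)) (b2 (- y ord0 i + 1 * t)).
  have := @is_derive1_comp _ b1 _ t _ _ (h2 _) (aff t).
  by rewrite mulr1.
rewrite /= (partial_prodf d1).
have d2' (t : R) : is_derive t 1 (upd (bumps b y) i (fun t => b1 (- y ord0 i + 1 * t)) i)
    (b2 (- y ord0 i + 1 * t)).
  by rewrite /upd eqxx.
rewrite (partial_prodf d2') prodf_upd; congr (_ * _).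
by apply: eq_bigr => j /negbTE ji; rewrite /upd ji.
Qed.

Lemma laplacian_bumpf_supp (y z : 'rV[R]_n) : 0 < e -> e < `|z - y| ->
  laplacian (bumpf b y) z = 0.
Proof.
move=> e0 ezy.
have [b1 [d1 s1]] := smooth_deriveP sb.
have [b2 [d2 s2]] := smooth_deriveP s1.
have [i hi] : exists i, e < `|- y ord0 i + 1 * z ord0 i|.
  apply: contrapT => h; move: ezy; apply/negP; rewrite -leNgt.
  apply/(rV_norm_le _ (ltW e0)) => i; rewrite !mxE leNgt; apply/negP => ei.
  by apply: h; exists i; rewrite mul1r addrC.
rewrite (laplacian_bumpf y d1 d2) big1// => j _.
have [->|ji] := eqVneq j i.
  have be1 := supp_derive d1 be.
  have be1' t : (e + `|- y ord0 i + 1 * z ord0 i|) / 2 <= `|t| -> b1 t = 0.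
    by move=> ?; apply: be1; lra.
  by rewrite (supp_derive d2 be1') ?mul0r//; lra.
rewrite (bigD1 i) 1?eq_sym//= /bumps be ?mul0r ?mulr0//.
exact: ltW.
Qed.

Lemma bumpf_estimates : exists C : R, [/\ 0 <= C,
  forall y z : 'rV[R]_n, `|bumpf b y z| <= C,
  forall y y' z : 'rV[R]_n, `|bumpf b y z - bumpf b y' z| <= C * `|y - y'|,
  forall y z : 'rV[R]_n, `|laplacian (bumpf b y) z| <= C &
  forall (y z : 'rV[R]_n) t, 0 < t ->
    `|lapdiff t (bumpf b y) z - t ^+ 2 * laplacian (bumpf b y) z| <= C * t ^+ 3].
Proof.
have [b1 [d1 s1]] := smooth_deriveP sb.
have [b2 [d2 s2]] := smooth_deriveP s1.
have [b3 [d3 s3]] := smooth_deriveP s2.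
have be1 := supp_derive d1 be.
have be1' t : e + 1 <= `|t| -> b1 t = 0 by move=> ?; apply: be1; lra.
have be2 := supp_derive d2 be1'.
have be2' t : e + 1 + 1 <= `|t| -> b2 t = 0 by move=> ?; apply: be2; lra.
have be3 := supp_derive d3 be2'.
have [|C0 [C00 hC0]] := supp_bounded (smooth_cont sb) (e := e).
  by move=> t ?; apply: be; exact: ltW.
have [C1 [C10 hC1]] := supp_bounded (smooth_cont s1) be1.
have [C2 [C20 hC2]] := supp_bounded (smooth_cont s2) be2.
have [C3 [C30 hC3]] := supp_bounded (smooth_cont s3) be3.
pose K := 1 + C0.
have K1 : 1 <= K by rewrite lerDl.
have bK t : `|b t| <= K by apply: le_trans (hC0 t) _; rewrite lerDr.
pose P : R := K ^+ n.
have P0 : 0 <= P by rewrite exprn_ge0//; lra.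
have sz : size (index_enum _ : seq 'I_n) = n.
  by rewrite -[RHS]size_enum_ord enumT [index_enum _]unlock.
have prodK (y z : 'rV[R]_n) i : `|\prod_(j | j != i) bumps b y j (z ord0 j)| <= P.
  rewrite -big_filter; apply: le_trans (prod_norm_le _ _ _) _; first exact: (le_trans ler01 K1).
    by move=> j; exact: bK.
  rewrite /P; apply: ler_weXn2l => //.
  by rewrite size_filter (leq_trans (count_size _ _))// sz.
pose C := P + n%:R * P * C1 + n%:R * (C2 * P) + n%:R * (2 * C3 * P).
have p1 : 0 <= n%:R * P * C1 by rewrite !mulr_ge0.
have p2 : 0 <= n%:R * (C2 * P) by rewrite !mulr_ge0.
have p3 : 0 <= n%:R * (2 * C3 * P) by rewrite !mulr_ge0.
exists C; split.
- by rewrite /C; lra.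
- move=> y z; rewrite /bumpf /prodf.
  apply: le_trans (prod_norm_le _ _ _) _; first exact: (le_trans ler01 K1).
    by move=> j; exact: bK.
  by rewrite sz /C -/P; lra.
- move=> y y' z; rewrite /bumpf /prodf.
  apply: le_trans (@prod_lip _ _ _ _ _ K (C1 * `|y - y'|) _ _ _ _ _) _ => //.
  + by rewrite mulr_ge0.
  + by move=> i; exact: bK.
  + by move=> i; exact: bK.
  + move=> i; rewrite /bumps; apply: le_trans (derive_lipschitz d1 hC1 _ _) _.
    rewrite ler_wpM2l// (_ : _ - _ = - (y - y') ord0 i) ?normrN ?rV_coord_le//.
    by rewrite !mxE; ring.
  + rewrite sz -/P mulrA ler_wpM2r// /C; lra.
- move=> y z; rewrite (laplacian_bumpf y d1 d2).
  apply: le_trans (ler_norm_sum _ _ _) _.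
  apply: (@le_trans _ _ (\sum_(i < n) C2 * P)).
    by apply: ler_sum => i _; rewrite normrM ler_pM.
  by rewrite sumr_const card_ord -mulr_natl /C; lra.
- move=> y z t t0; rewrite (laplacian_bumpf y d1 d2) mulr_sumr -sumrB.
  apply: le_trans (ler_norm_sum _ _ _) _.
  apply: (@le_trans _ _ (\sum_(i < n) 2 * C3 * P * t ^+ 3)).
    apply: ler_sum => i _.
    rewrite -scaleNr /bumpf !prodf_shift (prodfD1 _ _ i).
    set Q := \prod_(j | j != i) _; rewrite /bumps.
    have := second_difference d1 d2 d3 hC3 (- y ord0 i + 1 * z ord0 i) t0.
    have -> : - y ord0 i + 1 * (z ord0 i + t) = - y ord0 i + 1 * z ord0 i + t by ring.
    have -> : - y ord0 i + 1 * (z ord0 i - t) = - y ord0 i + 1 * z ord0 i - t by ring.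
    set s := - y ord0 i + 1 * z ord0 i => h.
    have -> : b (s + t) * Q + b (s - t) * Q - b s * Q *+ 2 - t ^+ 2 * (b2 s * Q) =
      (b (s + t) + b (s - t) - b s *+ 2 - t ^+ 2 * b2 s) * Q by rewrite !mulr2n; ring.
    rewrite normrM (_ : 2 * C3 * P * t ^+ 3 = (2 * C3 * t ^+ 3) * P); last by ring.
    by apply: ler_pM => //; exact: prodK.
  rewrite sumr_const card_ord -mulr_natl.
  have t30 : 0 <= t ^+ 3 by rewrite exprn_ge0// ltW.
  rewrite [leLHS](_ : _ = (n%:R * (2 * C3 * P)) * t ^+ 3); last by ring.
  by apply: ler_wpM2r => //; rewrite /C; lra.
Qed.

End bump.
End weak.

Section weak_lap.
Variables (R : realType).
Local Notation "'e_ i" := (delta_mx ord0 i) (at level 8, i at level 2, format "''e_' i").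

Lemma e_norm_le n (i : 'I_n) : `|('e_i : 'rV[R]_n)| <= 1.
Proof.
apply/rV_norm_le => // j; rewrite !mxE eqxx /=.
by case: (j == i); rewrite ?normr1 ?normr0.
Qed.

Lemma shift_cball n (x y : 'rV[R]_n) i (s t : R) : `|y - x| <= s ->
  `|y + t *: 'e_i - x| <= s + `|t|.
Proof.
move=> yx; rewrite addrAC; apply: le_trans (ler_normD _ _) _; rewrite lerD// normrZ.
by rewrite ler_piMr// e_norm_le.
Qed.

Lemma Rintegral_sum d (T : measurableType d) (mu : {measure set T -> \bar R})
    (B : set T) (I : Type) (s : seq I) (k : I -> T -> R) : measurable B ->
  (forall i, mu.-integrable B (EFin \o k i)) ->
  \int[mu]_(z in B) (\sum_(i <- s) k i z) = \sum_(i <- s) \int[mu]_(z in B) k i z.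
Proof.
move=> mB ik; elim: s => [|i s IH].
  rewrite big_nil /Rintegral.
  by under eq_integral do rewrite big_nil; rewrite integral0.
rewrite big_cons -IH -RintegralD//.
  by apply: eq_Rintegral => z _; rewrite big_cons.
have -> : EFin \o (fun z => \sum_(j <- s) k j z) =
    (fun z => \sum_(j <- s) (EFin \o k j) z)%E.
  by apply/funext => z /=; rewrite sumEFin.
exact: integrable_sum.
Qed.

Lemma mollify n (D : set 'rV[R]_n) (u f : 'rV[R]_n -> R) (x : 'rV[R]_n) (r e J : R)
    (b : R -> R) :
  0 < r -> 0 < e <= r -> (forall z : 'rV[R]_n, `|z - x| <= r *+ 3 -> D z) ->
  weak_laplacian D u f -> 0 < J ->
  smooth b -> (forall t, 0 <= b t) -> (forall t, e <= `|t| -> b t = 0) ->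
  (forall y : 'rV[R]_n, (\int[leb R n]_z (bumpf b y z)%:E = J%:E)%E) ->
  forall c1 c2, {ae leb R n, forall z, D z -> c1 <= f z <= c2} ->
  let B := [set z : 'rV[R]_n | `|z - x| <= r *+ 3] in
  let U (y : 'rV[R]_n) : R := J^-1 * \int[leb R n]_(z in B) (u z * bumpf b y z) in
  forall y : 'rV[R]_n, `|y - x| <= r ->
   [/\ forall eta, (forall z, `|z - y| <= e -> `|u z - u y| <= eta) ->
         `|U y - u y| <= eta,
       {for y, continuous U} &
       exists2 lam, c1 <= lam <= c2 & haslap U y lam].
Proof.
move=> r0 /andP[e0 er] BD [liu lif wk] J0 sb b0 be IJ c1 c2 hf B U y yx.
have mB : measurable B by exact: measurable_cball.
have cB : compact B by exact: cball_compact.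
have iu : (leb R n).-integrable B (EFin \o u) by exact: liu.
have if_ : (leb R n).-integrable B (EFin \o f) by exact: lif.
have [C [C0 hC hlip hlapC hlap]] := bumpf_estimates n sb be.
have cbump (z : 'rV[R]_n) i : continuous (bumps b z i).
  by apply: smooth_cont; exact: bumps_smooth.
have mbump (z : 'rV[R]_n) : measurable_fun setT (bumpf b z) by exact: measurable_prodf.
have ub (z : 'rV[R]_n) : (leb R n).-integrable B (EFin \o (fun w => u w * bumpf b z w)).
  exact: (integrable_mul_bounded mB iu (mbump z) (hC z)).
have zeroB (z w : 'rV[R]_n) : `|z - x| <= r *+ 2 -> ~ B w -> bumpf b z w = 0.
  move=> zx Bw; apply: (bumpf_supp be e0); rewrite ltNge; apply/negP => wz.
  apply: Bw; rewrite /B/= -(subrKA z); apply: le_trans (ler_normD _ _) _.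
  by rewrite mulrSr addrC lerD// (le_trans wz).
have r2 : r <= r *+ 2 by rewrite mulr2n lerDl ltW.
have yx2 : `|y - x| <= r *+ 2 by exact: le_trans yx _.
have ib1 : (leb R n).-integrable B (EFin \o (bumpf b y)).
  apply/integrableP; split; first by apply/measurable_EFinP; exact: measurable_funS (mbump y).
  apply: (@le_lt_trans _ _ (\int[leb R n]_z (bumpf b y z)%:E)%E); last by rewrite IJ ltry.
  rewrite [leLHS]integral_mkcond; apply: ge0_le_integral => //.
  - by move=> z _; rewrite patchE; case: ifP.
  - apply/(measurable_restrictT _ mB); apply: measurableT_comp => //.
    by apply/measurable_EFinP; exact: measurable_funS (mbump y).
  - by apply/measurable_EFinP.
  - move=> z _; rewrite patchE; case: ifP => _ //=; rewrite lee_fin ?bumpf_ge0//.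
    by rewrite ger0_norm ?bumpf_ge0.
have IB : \int[leb R n]_(z in B) bumpf b y z = J.
  have := @Rintegral_supp R _ _ (leb R n) B setT (bumpf b y) (fun _ _ => I).
  move=> <-; last by move=> z; exact: zeroB.
  by rewrite /Rintegral IJ.
have icst (c : R) : (leb R n).-integrable B (EFin \o (fun z => c * bumpf b y z)).
  by have := integrableZl mB c ib1.
have Icst (c : R) : \int[leb R n]_(z in B) (c * bumpf b y z) = c * J.
  by rewrite RintegralZl// IB.
have JJ (a : R) : J^-1 * (a * J) = a by rewrite mulrC mulfK// gt_eqF.
split.
- move=> eta heta.
  have -> : U y - u y = J^-1 * \int[leb R n]_(z in B) (u z * bumpf b y z - u y * bumpf b y z).
    by rewrite RintegralB// Icst mulrBr JJ.
  rewrite normrM ger0_norm ?invr_ge0 ?(ltW J0)//.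
  rewrite -(JJ eta) ler_wpM2l ?invr_ge0 ?(ltW J0)//.
  have iB : (leb R n).-integrable B
      (EFin \o (fun z => u z * bumpf b y z - u y * bumpf b y z)).
    exact: (integrableB mB (ub y) (icst (u y))).
  apply: le_trans (le_normr_Rintegral mB iB) _.
  rewrite -Icst; apply: le_Rintegral => //.
    exact: integrable_norm.
  move=> z Bz; rewrite -mulrBl normrM (ger0_norm (bumpf_ge0 b0 _ _)).
  have [ze|ez] := leP `|z - y| e.
    by rewrite ler_wpM2r ?bumpf_ge0// heta.
  by rewrite (bumpf_supp be e0 ez) !mulr0.
- pose A := \int[leb R n]_(z in B) `|u z|.
  have A0 : 0 <= A by apply: Rintegral_ge0.
  have iau : (leb R n).-integrable B (EFin \o (fun z => `|u z|)).
    exact: integrable_norm.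
  have lipU w : `|U w - U y| <= J^-1 * (A * C) * `|w - y|.
    rewrite /U -mulrBr -RintegralB// normrM ger0_norm ?invr_ge0 ?(ltW J0)// -mulrA.
    rewrite ler_wpM2l ?invr_ge0 ?(ltW J0)//.
    have iB : (leb R n).-integrable B
        (EFin \o (fun z => u z * bumpf b w z - u z * bumpf b y z)).
      exact: (integrableB mB (ub w) (ub y)).
    apply: le_trans (le_normr_Rintegral mB iB) _.
    rewrite -mulrA -RintegralZr//; apply: le_Rintegral => //.
    + exact: integrable_norm.
    + have -> : EFin \o (fun z => `|u z| * (C * `|w - y|)) =
        ((EFin \o (fun z => `|u z|)%R) \* cst (C * `|w - y|)%:E)%E.
        by apply/funext => z /=; rewrite EFinM.
      exact: integrableZr.
    + by move=> z Bz; rewrite -mulrBr normrM ler_wpM2l.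
  have K0 : 0 <= J^-1 * (A * C) by rewrite !mulr_ge0// invr_ge0 (ltW J0).
  apply/cont_cball => eta eta0.
  have K1 : 0 < J^-1 * (A * C) + 1 by lra.
  exists (eta / (J^-1 * (A * C) + 1)); first by rewrite divr_gt0.
  move=> z zy; apply: le_trans (lipU z) _; move: zy; rewrite ler_pdivlMr// => zy.
  by apply: le_trans zy; rewrite mulrC ler_wpM2l//; lra.
- pose I := \int[leb R n]_(z in B) (f z * bumpf b y z).
  have ifb : (leb R n).-integrable B (EFin \o (fun w => f w * bumpf b y w)).
    exact: (integrable_mul_bounded mB if_ (mbump y) (hC y)).
  exists (J^-1 * I).
    have h1 : c1 * J <= I.
      rewrite -Icst; apply: ae_le_Rintegral => //.
      apply: filterS hf => z hz Bz; rewrite ler_wpM2r ?bumpf_ge0//.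
      by have /andP[] := hz (BD z Bz).
    have h2 : I <= c2 * J.
      rewrite -Icst; apply: ae_le_Rintegral => //.
      apply: filterS hf => z hz Bz; rewrite ler_wpM2r ?bumpf_ge0//.
      by have /andP[] := hz (BD z Bz).
    by rewrite -(JJ c1) -(JJ c2) !ler_wpM2l// invr_ge0 (ltW J0).
  have test : test_function D (bumpf b y).
    apply: (bumpf_test sb be e0) => z zy; apply: BD.
    rewrite -(subrKA y); apply: le_trans (ler_normD _ _) _.
    by rewrite mulrSr addrC lerD// (le_trans zy).
  have mlap : measurable_fun setT (laplacian (bumpf b y)).
    have [b1 [d1 s1]] := smooth_deriveP sb.
    have [b2 [d2 s2]] := smooth_deriveP s1.
    apply: measurable_sum => i.
    have [G [sG ->]] := partials_prodf [:: i; i] (bumps_smooth sb y).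
    by apply: measurable_prodf => j; exact: smooth_cont.
  have lap0 z : ~ B z -> laplacian (bumpf b y) z = 0.
    move=> Bz; apply: (laplacian_bumpf_supp sb be e0); rewrite ltNge; apply/negP => zy.
    apply: Bz; rewrite /B/= -(subrKA y); apply: le_trans (ler_normD _ _) _.
    by rewrite mulrSr addrC lerD// (le_trans zy).
  have ulap : (leb R n).-integrable B (EFin \o (fun z => u z * laplacian (bumpf b y) z)).
    exact: (integrable_mul_bounded mB iu mlap (hlapC y)).
  have EI : \int[leb R n]_(z in B) (u z * laplacian (bumpf b y) z) = I.
    rewrite -(@Rintegral_supp R _ _ _ B D)//; last by move=> z /lap0 ->; rewrite mulr0.
    rewrite (wk _ test) (@Rintegral_supp R _ _ _ B D)// => z Bz.
    by rewrite (zeroB _ _ yx2 Bz) mulr0.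
  have lapU t : lapdiff t U y =
      J^-1 * \int[leb R n]_(z in B) (u z * lapdiff t (bumpf b y) z).
    transitivity (J^-1 * \int[leb R n]_(z in B) (\sum_i (u z * bumpf b (y + t *: 'e_i) z
        + u z * bumpf b (y - t *: 'e_i) z - u z * bumpf b y z *+ 2))).
      have iterm i : (leb R n).-integrable B (EFin \o (fun z => u z * bumpf b (y + t *: 'e_i) z
          + u z * bumpf b (y - t *: 'e_i) z - u z * bumpf b y z *+ 2)).
        apply: (@integrableB _ _ _ _ _ mB (fun z => (u z * bumpf b (y + t *: 'e_i) z
          + u z * bumpf b (y - t *: 'e_i) z)%:E) (fun z => (u z * bumpf b y z *+ 2)%:E)).
          by apply: (integrableD mB (ub (y + t *: 'e_i)) (ub (y - t *: 'e_i))).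
        by apply: (integrableD mB (ub y) (ub y)).
      rewrite Rintegral_sum// mulr_sumr; apply: eq_bigr => i _.
      rewrite /U RintegralB//; last 2 first.
      - by apply: (integrableD mB (ub (y + t *: 'e_i)) (ub (y - t *: 'e_i))).
      - by apply: (integrableD mB (ub y) (ub y)).
      rewrite RintegralD// (RintegralD mB (ub y) (ub y)).
      by rewrite !mulr2n; ring.
    congr (_ * _); apply: eq_Rintegral => z _.
    rewrite -lapdiff_bumpf /lapdiff mulr_sumr; apply: eq_bigr => i _.
    by rewrite mulrBr mulrDr mulrnAr.
  pose A := \int[leb R n]_(z in B) `|u z|.
  have A0 : 0 <= A by apply: Rintegral_ge0.
  have iau : (leb R n).-integrable B (EFin \o (fun z => `|u z|)).
    exact: integrable_norm.
  move=> eta eta0.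
  have K0 : 0 <= J^-1 * (A * C) by rewrite !mulr_ge0// invr_ge0 (ltW J0).
  have K1 : 0 < J^-1 * (A * C) + 1 by lra.
  exists (eta / (J^-1 * (A * C) + 1)); first by rewrite divr_gt0.
  move=> t /andP[t0]; rewrite ltr_pdivlMr// => t1.
  have mlapdiff : measurable_fun setT (lapdiff t (bumpf b y)).
    have -> : lapdiff t (bumpf b y) = fun z => \sum_i (bumpf b (y + t *: 'e_i) z
        + bumpf b (y - t *: 'e_i) z - bumpf b y z *+ 2).
      by apply/funext => z; rewrite -lapdiff_bumpf.
    apply: measurable_sum => i; apply: measurable_funB.
      by apply: measurable_funD; exact: mbump.
    by apply: measurable_funD; exact: mbump.
  pose E z := lapdiff t (bumpf b y) z - t ^+ 2 * laplacian (bumpf b y) z.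
  have mE : measurable_fun setT E.
    by apply: measurable_funB => //; apply: measurable_funM.
  have EC z : `|E z| <= C * t ^+ 3 by exact: hlap.
  have iuE : (leb R n).-integrable B (EFin \o (fun z => u z * E z)).
    exact: (integrable_mul_bounded mB iu mE EC).
  have -> : lapdiff t U y - J^-1 * I * t ^+ 2 =
      J^-1 * \int[leb R n]_(z in B) (u z * E z).
    have i2 : (leb R n).-integrable B (EFin \o (fun z => t ^+ 2 * (u z * laplacian (bumpf b y) z))).
      by have := integrableZl mB (t ^+ 2) ulap.
    rewrite lapU.
    have -> : \int[leb R n]_(z in B) (u z * lapdiff t (bumpf b y) z) =
        \int[leb R n]_(z in B) (u z * E z + t ^+ 2 * (u z * laplacian (bumpf b y) z)).
      by apply: eq_Rintegral => z _; rewrite /E; ring.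
    by rewrite RintegralD// RintegralZl// EI; ring.
  rewrite normrM ger0_norm ?invr_ge0 ?(ltW J0)//.
  apply: (@le_trans _ _ (J^-1 * (A * (C * t ^+ 3)))).
    rewrite ler_wpM2l ?invr_ge0 ?(ltW J0)//.
    apply: le_trans (le_normr_Rintegral mB iuE) _.
    rewrite -RintegralZr//; apply: le_Rintegral => //.
    + exact: integrable_norm.
    + have -> : EFin \o (fun z => `|u z| * (C * t ^+ 3)) =
        ((EFin \o (fun z => `|u z|)%R) \* cst (C * t ^+ 3)%:E)%E.
        by apply/funext => z /=; rewrite EFinM.
      exact: integrableZr.
    + by move=> z Bz; rewrite normrM ler_wpM2l.
  have -> : J^-1 * (A * (C * t ^+ 3)) = (J^-1 * (A * C)) * t * t ^+ 2 by ring.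
  rewrite ler_wpM2r ?sqr_ge0//; apply: le_trans (ltW t1).
  by rewrite mulrC ler_wpM2l ?(ltW t0)//; lra.
Qed.
End weak_lap.

Section weak_lap2.
Variables (R : realType).

Lemma mollifier_exists n (e : R) : 0 < e -> exists (b : R -> R) (J : R),
  [/\ smooth b, forall t, 0 <= b t, forall t, e <= `|t| -> b t = 0, 0 < J &
  forall y : 'rV[R]_n, (\int[leb R n]_z (bumpf b y z)%:E = J%:E)%E].
Proof.
move=> e0; have [b [sb b0 be bp]] := bump_exists e0.
have [J J0 hJ] := integral_bump (smooth_cont sb) b0 be bp.
exists b, (J ^+ n); split => //; first by rewrite exprn_gt0.
move=> y; rewrite /bumpf (@integral_prodf _ _ _ (fun _ => J)).
- by rewrite prodr_const card_ord.
- by move=> i; apply: smooth_cont; exact: bumps_smooth.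
- by move=> i t; exact: b0.
- move=> i; rewrite -hJ.
  exact: (integral_translation _ (smooth_cont sb) b0).
Qed.

Lemma weak_lap_between n (D : set 'rV[R]_n) u f (c1 c2 : R) :
  (forall x, D x -> nbhs x D) -> (forall x, D x -> {for x, continuous u}) ->
  weak_laplacian D u f ->
  {ae leb R n, forall z, D z -> c1 <= f z <= c2} ->
  lap_between D c1 c2 u.
Proof.
move=> oD cu wk hf x Dx.
have [r3 r30 hr3] := cball_nbhs (oD x Dx).
pose r := r3 / 3; have r0 : 0 < r by rewrite divr_gt0.
have rE : r *+ 3 = r3 by rewrite -mulr_natr divfK.
exists r => // eta eta0.
have rr3 : r <= r3 by rewrite -rE mulrS lerDl mulrn_wge0// ltW.
have cu' (y : 'rV[R]_n) : `|y - x| <= r -> {for y, continuous u}.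
  by move=> yx; apply: cu; apply: hr3; exact: le_trans yx _.
have [d d0 hd] := cball_unif_cont eta0 cu'.
pose e := Num.min d r.
have e0 : 0 < e by rewrite lt_min d0.
have er : 0 < e <= r by rewrite e0 /e ge_min lexx orbT.
have [b [J [sb b0 be J0 hJ]]] := mollifier_exists n e0.
have BD z : `|z - x| <= r *+ 3 -> D z by rewrite rE; exact: hr3.
have H := mollify r0 er BD wk J0 sb b0 be hJ hf.
eexists => y yx; have [h1 h2 h3] := H y yx; split; [|exact: h2|exact: h3].
apply: h1 => z zy; apply: hd => //; apply: le_trans zy _.
by rewrite /e ge_min lexx.
Qed.

Lemma ae_le_continuous n (D : set 'rV[R]_n) (v : 'rV[R]_n -> R) (V : R) :
  (forall x, D x -> nbhs x D) -> (forall x, D x -> {for x, continuous v}) ->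
  {ae leb R n, forall z, D z -> `|v z| <= V} ->
  forall x, D x -> `|v x| <= V.
Proof.
move=> oD cv hv x Dx; rewrite leNgt; apply/negP => Vx.
have [r1 r10 hr1] := cball_nbhs (oD x Dx).
have vV : 0 < (`|v x| - V) / 2 by rewrite divr_gt0 ?subr_gt0.
have [r2 r20 hr2] := (cont_cball v x).1 (cv _ Dx) _ vV.
pose e := Num.min r1 r2.
have e0 : 0 < e by rewrite lt_min r10.
have [b [J [sb b0 be J0 hJ]]] := mollifier_exists n e0.
have bx z : bumpf b x z != 0 -> `|z - x| <= e.
  by rewrite leNgt; apply: contraNN => /(bumpf_supp be e0) ->.
have : (\int[leb R n]_z (bumpf b x z)%:E = \int[leb R n]_z 0)%E.
  apply: ae_eq_integral => //.
    apply/measurable_EFinP; apply: measurable_prodf => i.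
    by apply: smooth_cont; exact: bumps_smooth.
  apply: filterS hv => z hz _; congr EFin.
  apply: contrapT => /eqP /bx ze.
  have z1 : D z by apply: hr1; apply: le_trans ze _; rewrite /e ge_min lexx.
  have : `|v z - v x| <= (`|v x| - V) / 2.
    by apply: hr2; apply: le_trans ze _; rewrite /e ge_min lexx orbT.
  have := hz z1; have := ler_distD (v z) (v x) 0; rewrite !subr0 (distrC (v x)); lra.
rewrite hJ integral0 => -[J00]; by move: J0; rewrite J00 ltxx.
Qed.

End weak_lap2.

(** * The comparison principle *)

Section lap_algebra.
Variables (R : realType) (n : nat).
Local Notation "'e_ i" := (delta_mx ord0 i) (at level 8, i at level 2, format "''e_' i").
Implicit Types (u v w U b : 'rV[R]_n -> R) (x y p : 'rV[R]_n) (D : set 'rV[R]_n).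

Lemma lapdiffD t u v x :
  lapdiff t (fun y => u y + v y) x = lapdiff t u x + lapdiff t v x.
Proof. by rewrite -big_split; apply: eq_bigr => i _; rewrite /= !mulr2n; ring. Qed.

Lemma lapdiffZ t a u x : lapdiff t (fun y => a * u y) x = a * lapdiff t u x.
Proof. by rewrite mulr_sumr; apply: eq_bigr => i _; rewrite !mulr2n; ring. Qed.

Lemma haslapD u v x l1 l2 : haslap u x l1 -> haslap v x l2 ->
  haslap (fun y => u y + v y) x (l1 + l2).
Proof.
move=> hu hv eta eta0; have e20 : 0 < eta / 2 by rewrite divr_gt0.
have [t1 t10 h1] := hu _ e20; have [t2 t20 h2] := hv _ e20.
exists (Num.min t1 t2); first by rewrite lt_min t10.
move=> t /andP[t0]; rewrite lt_min => /andP[tt1 tt2].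
have := h1 t; rewrite t0 tt1 => /(_ isT) {}h1.
have := h2 t; rewrite t0 tt2 => /(_ isT) {}h2.
rewrite lapdiffD mulrDl opprD addrACA; apply: le_trans (ler_normD _ _) _; lra.
Qed.

Lemma haslapZ a u x l : haslap u x l -> haslap (fun y => a * u y) x (a * l).
Proof.
move=> hu eta eta0; have a1 : 0 < `|a| + 1 by rewrite ltr_wpDl.
have e20 : 0 < eta / (`|a| + 1) by rewrite divr_gt0.
have [t1 t10 h1] := hu _ e20; exists t1 => // t /h1 {}h1.
rewrite lapdiffZ -mulrA -mulrBr normrM.
have : `|a| * `|lapdiff t u x - l * t ^+ 2| <= `|a| * (eta / (`|a| + 1) * t ^+ 2).
  by rewrite ler_wpM2l.
move=> /le_trans; apply; rewrite mulrA ler_wpM2r ?sqr_ge0//.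
by rewrite mulrA ler_pdivrMr// mulrC ler_pM2l// lerDl.
Qed.

Lemma lapdiff_cst t (k : R) x : lapdiff t (fun _ : 'rV[R]_n => k) x = 0.
Proof. by rewrite /lapdiff big1// => i _; rewrite mulr2n subrr. Qed.

Lemma haslap_cst (k : R) x : haslap (fun _ : 'rV[R]_n => k) x 0.
Proof.
move=> eta eta0; exists 1 => // t _.
by rewrite lapdiff_cst mul0r subr0 normr0 mulr_ge0 ?sqr_ge0// ltW.
Qed.

Lemma contZ (a : R) u x : {for x, continuous u} ->
  {for x, continuous (fun y => a * u y)}.
Proof. by move=> cu; apply: (@contM R 'rV[R]_n) => //; exact: cst_continuous. Qed.

Lemma lap_betweenD D u v c1 c2 d1 d2 :
  lap_between D c1 c2 u -> lap_between D d1 d2 v ->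
  lap_between D (c1 + d1) (c2 + d2) (fun y => u y + v y).
Proof.
move=> hu hv x Dx; have [s1 s10 h1] := hu x Dx; have [s2 s20 h2] := hv x Dx.
exists (Num.min s1 s2); first by rewrite lt_min s10.
move=> eta eta0; have e20 : 0 < eta / 2 by rewrite divr_gt0.
have [U hU] := h1 _ e20; have [V hV] := h2 _ e20.
exists (fun y => U y + V y) => y; rewrite le_min => /andP[y1 y2].
have [a1 a2 [l1 l1b a3]] := hU y y1; have [b1 b2 [l2 l2b b3]] := hV y y2.
split.
- rewrite opprD addrACA; apply: le_trans (ler_normD _ _) _; lra.
- exact: (@contD R 'rV[R]_n).
- by exists (l1 + l2); [lra|exact: haslapD].
Qed.

Lemma lap_betweenZ D a u c1 c2 : 0 <= a ->
  lap_between D c1 c2 u -> lap_between D (a * c1) (a * c2) (fun y => a * u y).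
Proof.
move=> a0 hu x Dx; have [s1 s10 h1] := hu x Dx.
exists s1 => // eta eta0; have a1 : 0 < a + 1 by rewrite ltr_wpDl.
have e20 : 0 < eta / (a + 1) by rewrite divr_gt0.
have [U hU] := h1 _ e20; exists (fun y => a * U y) => y /hU[a2 a3 [l lb a4]].
split.
- rewrite -mulrBr normrM (ger0_norm a0).
  apply: (@le_trans _ _ (a * (eta / (a + 1)))); first by rewrite ler_wpM2l.
  by rewrite mulrA ler_pdivrMr// mulrC ler_pM2l// lerDl.
- exact: contZ.
- exists (a * l); last exact: haslapZ.
  by case/andP: lb => *; rewrite !ler_wpM2l.
Qed.

Lemma lap_betweenN D u c1 c2 :
  lap_between D c1 c2 u -> lap_between D (- c2) (- c1) (fun y => - u y).
Proof.
move=> hu x Dx; have [s1 s10 h1] := hu x Dx.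
exists s1 => // eta /h1[U hU]; exists (fun y => - U y) => y /hU[a2 a3 [l lb a4]].
split.
- by rewrite -opprD normrN.
- exact: (@contN R 'rV[R]_n).
- exists (- l); first by lra.
  have -> : (fun y => - U y) = (fun y => (-1) * U y).
    by apply/funext => z; rewrite mulN1r.
  by have := haslapZ (-1) a4; rewrite mulN1r.
Qed.

Lemma lap_between_cst D (k : R) : lap_between D 0 0 (fun _ => k).
Proof.
move=> x Dx; exists 1 => // eta eta0; exists (fun _ => k) => y _; split.
- by rewrite subrr normr0 ltW.
- exact: cst_continuous.
- by exists 0; [rewrite lexx|exact: haslap_cst].
Qed.

Lemma lap_between_sub D D' u c1 c2 : D' `<=` D ->
  lap_between D c1 c2 u -> lap_between D' c1 c2 u.
Proof. by move=> DD hu x /DD; exact: hu. Qed.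

Lemma lap_between_le D u c1 c2 d1 d2 : d1 <= c1 -> c2 <= d2 ->
  lap_between D c1 c2 u -> lap_between D d1 d2 u.
Proof.
move=> dc cd hu x /hu[s s0 h]; exists s => // eta /h[U hU].
by exists U => y /hU[? ? [l lb ?]]; split => //; exists l => //; lra.
Qed.

Definition hasjet u x (G H : 'I_n -> R) := exists2 C : R, 0 <= C &
  forall i t, `|t| <= 1 ->
    `|u (x + t *: 'e_i) - (u x + G i * t + H i * t ^+ 2)| <= C * `|t| ^+ 3.

Lemma jet_cst (k : R) x : hasjet (fun _ => k) x (fun=> 0) (fun=> 0).
Proof. by exists 0 => // i t _; rewrite !mul0r !addr0 subrr normr0. Qed.

Lemma jet_coord j (a : R) x :
  hasjet (fun y => y ord0 j - a) x (fun i => (j == i)%:R) (fun=> 0).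
Proof.
exists 0 => // i t _; rewrite coord_shift !mul0r addr0.
rewrite (_ : _ - _ = 0) ?normr0//; ring.
Qed.

Lemma jetD u v x G H G' H' : hasjet u x G H -> hasjet v x G' H' ->
  hasjet (fun y => u y + v y) x (fun i => G i + G' i) (fun i => H i + H' i).
Proof.
move=> [C C0 hC] [C' C'0 hC']; exists (C + C'); first by rewrite addr_ge0.
move=> i t t1; have := hC i t t1; have := hC' i t t1 => h1 h2.
rewrite [leRHS]mulrDl; apply: le_trans _ (lerD h2 h1).
apply: le_trans _ (ler_normD _ _); rewrite [leLHS](_ : _ = `|u (x + t *: 'e_i) -
    (u x + G i * t + H i * t ^+ 2) + (v (x + t *: 'e_i) -
    (v x + G' i * t + H' i * t ^+ 2))|)//.
by congr `|_|; ring.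
Qed.

Lemma jetM u v x G H G' H' : hasjet u x G H -> hasjet v x G' H' ->
  hasjet (fun y => u y * v y) x (fun i => u x * G' i + v x * G i)
    (fun i => u x * H' i + v x * H i + G i * G' i).
Proof.
move=> [C C0 hC] [C' C'0 hC'].
pose S := \sum_i (`|G i| + `|H i| + `|G' i| + `|H' i|).
have S0 : 0 <= S by apply: sumr_ge0 => i _; rewrite !addr_ge0.
have hS i : [/\ `|G i| <= S, `|H i| <= S, `|G' i| <= S & `|H' i| <= S].
  have : `|G i| + `|H i| + `|G' i| + `|H' i| <= S.
    rewrite /S (bigD1 i)//= lerDl; apply: sumr_ge0 => j _; rewrite !addr_ge0//.
  have := normr_ge0 (G i); have := normr_ge0 (H i); have := normr_ge0 (G' i).
  by have := normr_ge0 (H' i) => *; split; lra.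
pose A := `|u x| + S + S; pose A' := `|v x| + S + S + C'.
have A0 : 0 <= A by rewrite !addr_ge0.
have A'0 : 0 <= A' by rewrite !addr_ge0.
exists (C * A' + A * C' + 2 * S * S + S * S).
  by have := mulr_ge0 C0 A'0; have := mulr_ge0 A0 C'0; have := mulr_ge0 S0 S0; lra.
move=> i t t1; have [h1 h2 h3 h4] := hS i.
have := hC i t t1; have := hC' i t t1.
set P := u x + G i * t + H i * t ^+ 2; set P' := v x + G' i * t + H' i * t ^+ 2.
set ut := u _; set vt := v _ => hv hu.
have t0 := normr_ge0 t.
have t2 : `|t| ^+ 2 <= 1 by rewrite expr_le1.
have t3 : `|t| ^+ 3 <= 1 by rewrite expr_le1.
have t30 : 0 <= `|t| ^+ 3 by rewrite exprn_ge0.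
have hP : `|P| <= A.
  rewrite /P; apply: le_trans (ler_normD _ _) _; apply: lerD.
    apply: le_trans (ler_normD _ _) _; rewrite lerD// normrM.
    by rewrite -[S]mulr1 ler_pM.
  by rewrite normrM normrX -[S]mulr1 ler_pM// exprn_ge0.
have hvt : `|vt| <= A'.
  rewrite -(subrK P' vt) addrC; apply: le_trans (ler_normD _ _) _; apply: lerD.
    rewrite /P'; apply: le_trans (ler_normD _ _) _; apply: lerD.
      apply: le_trans (ler_normD _ _) _; rewrite lerD// normrM.
      by rewrite -[S]mulr1 ler_pM.
    by rewrite normrM normrX -[S]mulr1 ler_pM// exprn_ge0.
  by apply: le_trans hv _; rewrite -[leRHS]mulr1 ler_wpM2l.
have -> : ut * vt - (u x * v x + (u x * G' i + v x * G i) * t +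
    (u x * H' i + v x * H i + G i * G' i) * t ^+ 2) =
  (ut - P) * vt + P * (vt - P') + (G i * H' i + H i * G' i) * t ^+ 3 +
    H i * H' i * t * t ^+ 3 by rewrite /P /P'; ring.
have q1 : `|(ut - P) * vt| <= C * `|t| ^+ 3 * A' by rewrite normrM ler_pM.
have q2 : `|P * (vt - P')| <= A * (C' * `|t| ^+ 3) by rewrite normrM ler_pM.
have q3 : `|(G i * H' i + H i * G' i) * t ^+ 3| <= (S * S + S * S) * `|t| ^+ 3.
  rewrite normrM normrX ler_wpM2r//; apply: le_trans (ler_normD _ _) _.
  by rewrite !normrM lerD// ler_pM.
have q4 : `|H i * H' i * t * t ^+ 3| <= (S * S * 1) * `|t| ^+ 3.
  by rewrite normrM normrX ler_wpM2r// !normrM !ler_pM// mulr_ge0.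
apply: le_trans (ler_normD _ _) _; apply: le_trans (lerD (ler_normD _ _) (lexx _)) _.
apply: le_trans (lerD (lerD (ler_normD _ _) (lexx _)) (lexx _)) _.
move: q1 q2 q3 q4; move: (`|t| ^+ 3) => T; lra.
Qed.

Lemma jet_ext u x G H G' H' : hasjet u x G H -> G =1 G' -> H =1 H' ->
  hasjet u x G' H'.
Proof. by move=> h /funext <- /funext <-. Qed.

Lemma jet_haslap u x G H : hasjet u x G H -> haslap u x (2 * \sum_i H i).
Proof.
move=> [C C0 hC] eta eta0.
have C1 : 0 < (n%:R : R) * (2 * C) + 1 by rewrite ltr_wpDl// !mulr_ge0.
exists (Num.min 1 (eta / (n%:R * (2 * C) + 1))).
  by rewrite lt_min ltr01 divr_gt0.
move=> t /andP[t0]; rewrite lt_min => /andP[t1]; rewrite ltr_pdivlMr// => t2.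
rewrite mulr_sumr mulr_suml -sumrB.
apply: le_trans (ler_norm_sum _ _ _) _.
apply: (@le_trans _ _ (\sum_(i < n) 2 * C * t ^+ 3)).
  apply: ler_sum => i _.
  have nt : `|t| <= 1 by rewrite gtr0_norm// ltW.
  have h1 := hC i t nt.
  have h2 : `|- t| <= 1 by rewrite normrN.
  have {}h2 := hC i (- t) h2.
  rewrite scaleNr in h2.
  have -> : u (x + t *: 'e_i) + u (x - t *: 'e_i) - u x *+ 2 - 2 * H i * t ^+ 2 =
    (u (x + t *: 'e_i) - (u x + G i * t + H i * t ^+ 2)) +
    (u (x - t *: 'e_i) - (u x + G i * (- t) + H i * (- t) ^+ 2)).
    by rewrite sqrrN mulr2n; ring.
  apply: le_trans (ler_normD _ _) _.
  move: h1 h2; rewrite normrN (gtr0_norm t0); lra.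
rewrite sumr_const card_ord.
rewrite [leLHS](_ : _ = (n%:R * (2 * C)) * t * t ^+ 2); last first.
  by rewrite -[LHS]mulr_natl; ring.
rewrite ler_wpM2r ?sqr_ge0//; apply: le_trans (ltW t2).
by rewrite mulrC ler_wpM2l ?(ltW t0)//; lra.
Qed.

Definition sqd p x : R := \sum_i (x ord0 i - p ord0 i) ^+ 2.

Lemma cont_coordB i (a : R) x : {for x, continuous (fun y : 'rV[R]_n => y ord0 i - a)}.
Proof.
apply: (@contB R 'rV[R]_n); first exact: cont_coord.
exact: cst_continuous.
Qed.

Lemma cont_sqd p x : {for x, continuous (sqd p)}.
Proof.
apply: (@cont_sum R 'rV[R]_n) => i.
have -> : (fun y : 'rV[R]_n => (y ord0 i - p ord0 i) ^+ 2) =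
  (fun y => (y ord0 i - p ord0 i) * (y ord0 i - p ord0 i)).
  by apply/funext => y; rewrite expr2.
by apply: (@contM R 'rV[R]_n); exact: cont_coordB.
Qed.

Lemma sqd_ge0 p x : 0 <= sqd p x.
Proof. by apply: sumr_ge0 => i _; rewrite sqr_ge0. Qed.

Lemma sqdxx p : sqd p p = 0.
Proof. by rewrite /sqd big1// => i _; rewrite subrr expr0n. Qed.

Lemma norm_sqd p x : `|x - p| ^+ 2 <= sqd p x.
Proof.
have [-> |] := eqVneq x p; first by rewrite subrr normr0 expr0n /= sqd_ge0.
rewrite -subr_eq0 -normr_eq0 => /mx_norm_neq0 [[i j] h].
rewrite {1}/Num.norm/= h /= (ord1 i) !mxE /sqd (bigD1 j)//= real_normK ?num_real//.
by rewrite lerDl; apply: sumr_ge0 => k _; rewrite sqr_ge0.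
Qed.

Lemma jet_sqd p x : hasjet (sqd p) x (fun i => 2 * (x ord0 i - p ord0 i)) (fun=> 1).
Proof.
exists 0 => // i t _; rewrite mul0r normr_le0 subr_eq0; apply/eqP.
rewrite /sqd (bigD1 i)//= [in RHS](bigD1 i)//= coord_shift eqxx mulr1.
under eq_bigr => j /negbTE ji do rewrite coord_shift ji mulr0 addr0.
set S := bigop.body _ _ _; move: S => S; ring.
Qed.

Lemma haslap_sqd p x : haslap (sqd p) x (2 * n%:R).
Proof.
have := jet_haslap (jet_sqd p x).
by rewrite sumr_const card_ord.
Qed.

Lemma comparison (K D : set 'rV[R]_n) w b c1 c2 mu :
  compact K -> (forall x, D x -> nbhs x D) -> D `<=` K ->
  {within K, continuous w} -> (forall x, {for x, continuous b}) ->
  lap_between D c1 c2 w -> 0 < mu ->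
  (forall x, D x -> exists2 lam, c2 + mu <= lam & haslap b x lam) ->
  (forall x, K x -> ~ D x -> b x <= w x) -> forall x, K x -> b x <= w x.
Proof.
move=> cK oD DK cw cb lw mu0 lb hb x Kx; rewrite leNgt; apply/negP => wb.
have cwb : {within K, continuous (fun y => w y - b y)}.
  move=> y; apply: (@contB R (subspace K)); first exact: cw.
  by apply: continuous_subspaceT => z; exact: cb.
have [x0 /set_mem Kx0 hmin] := EVT_min_rV (ex_intro _ x Kx) cK cwb.
have neg : w x0 < b x0 by have := hmin x (mem_set Kx); lra.
have Dx0 : D x0.
  by apply: contrapT => /(hb _ Kx0); rewrite leNgt neg.
have [s s0 happ] := lw _ Dx0.
have [r r0 hr] := cball_nbhs (oD _ Dx0).
pose s1 := Num.min s r.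
have s10 : 0 < s1 by rewrite lt_min s0.
pose k := mu / (4 * (n%:R + 1)).
have n1 : 0 < (n%:R + 1 : R) by rewrite ltr_wpDl.
have k0 : 0 < k by rewrite divr_gt0// mulr_gt0.
have kn : 2 * n%:R * k <= mu / 2.
  rewrite /k mulrA ler_pdivrMr ?mulr_gt0//.
  have : (n%:R : R) * mu <= (n%:R + 1) * mu by rewrite ler_wpM2r ?(ltW mu0)// lerDl.
  lra.
have e0 : 0 < k * s1 ^+ 2 / 4 by rewrite divr_gt0// mulr_gt0// exprn_gt0.
have [U hU] := happ _ e0.
pose gg y := U y + (-1) * b y + k * sqd x0 y.
have inD y : `|y - x0| <= s1 -> D y.
  by move=> h; apply: hr; apply: le_trans h _; rewrite ge_min lexx orbT.
have inS y : `|y - x0| <= s1 -> `|y - x0| <= s.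
  by move=> h; apply: le_trans h _; rewrite ge_min lexx.
have cg : {within [set y | `|y - x0| <= s1], continuous gg}.
  apply: continuous_in_subspaceT => y /set_mem /= ys.
  apply: (@contD R 'rV[R]_n); last by apply: contZ; exact: cont_sqd.
  apply: (@contD R 'rV[R]_n); last by apply: contZ; exact: cb.
  by have [] := hU y (inS _ ys).
have x00 : `|x0 - x0| <= s1 by rewrite subrr normr0 ltW.
have ne : [set y | `|y - x0| <= s1] !=set0 by exists x0.
have [x1 /set_mem /= x1s hx1] := EVT_min_rV ne (@cball_compact R n x0 s1) cg.
have x1lt : `|x1 - x0| < s1.
  have := hx1 x0 (mem_set x00); rewrite /gg sqdxx mulr0.
  have [hU0 _ _] := hU x0 (inS _ x00); have [hU1 _ _] := hU x1 (inS _ x1s).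
  have := hmin x1 (mem_set (DK _ (inD _ x1s))).
  move: hU0 hU1; rewrite !ler_norml => /andP[? ?] /andP[? ?] ? ?.
  have : k * `|x1 - x0| ^+ 2 <= k * sqd x0 x1 by rewrite ler_wpM2l ?norm_sqd// ltW.
  move=> ?; have : k * `|x1 - x0| ^+ 2 < k * s1 ^+ 2.
    have : 0 < k * s1 ^+ 2 by rewrite mulr_gt0// exprn_gt0.
    lra.
  by rewrite ltr_pM2l// ltr_pXn2r// nnegrE// ltW.
have [_ _ [lU /andP[_ lUc] hlU]] := hU x1 (inS _ x1s).
have [lb1 lbc hlb] := lb x1 (inD _ x1s).
have := haslapD (haslapD hlU (haslapZ (-1) hlb)) (haslapZ k (haslap_sqd x0 x1)).
rewrite -/gg; set lam := (_ + _)%R => hl.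
have laml : lam <= - (mu / 2) by rewrite /lam; lra.
have mu40 : 0 < mu / 4 by rewrite divr_gt0.
have [t0 t00 ht0] := hl _ mu40.
pose t := Num.min (t0 / 2) ((s1 - `|x1 - x0|) / 2).
have tp : 0 < t by rewrite lt_min !divr_gt0// subr_gt0.
have tt0 : 0 < t < t0.
  rewrite tp /t gt_min; apply/orP; left; lra.
have ts : t <= s1 - `|x1 - x0|.
  have : 0 < s1 - `|x1 - x0| by rewrite subr_gt0.
  by move=> ?; rewrite /t ge_min; apply/orP; right; lra.
have ge0 : 0 <= lapdiff t gg x1.
  apply: sumr_ge0 => i _.
  have h (r' : R) : `|r'| = t -> gg x1 <= gg (x1 + r' *: 'e_i).
    move=> rt; apply: hx1; apply: mem_set => /=.
    have := shift_cball i r' (lexx `|x1 - x0|); rewrite rt; lra.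
  have h1 := h t (gtr0_norm tp).
  have h2 := h (- t) (etrans (normrN _) (gtr0_norm tp)).
  by rewrite -scaleNr mulr2n; lra.
have := ht0 _ tt0; rewrite ler_norml => /andP[_].
have t20 : 0 < t ^+ 2 by rewrite exprn_gt0.
have : lam * t ^+ 2 <= - (mu / 2) * t ^+ 2 by rewrite ler_wpM2r// ltW.
have : 0 < mu * t ^+ 2 by rewrite mulr_gt0.
lra.
Qed.

End lap_algebra.

(** * Spreading of positivity *)

Section euclid.
Variables (R : realType) (n : nat).
Implicit Types (x y p : 'rV[R]_n) (D : set 'rV[R]_n).

Lemma eucl_norm_ge0 x : 0 <= eucl_norm x.
Proof. exact: sqrtr_ge0. Qed.

Lemma eucl_norm_sqr x : eucl_norm x ^+ 2 = \sum_i x ord0 i ^+ 2.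
Proof. by rewrite sqr_sqrtr//; apply: sumr_ge0 => i _; rewrite sqr_ge0. Qed.

Lemma sqdE p x : sqd p x = eucl_norm (x - p) ^+ 2.
Proof. by rewrite eucl_norm_sqr; apply: eq_bigr => i _; rewrite !mxE. Qed.

Lemma sqd_le p x r : 0 <= r -> (sqd p x <= r ^+ 2) = (eucl_norm (x - p) <= r).
Proof. by move=> r0; rewrite sqdE ler_pXn2r// nnegrE eucl_norm_ge0. Qed.

Lemma sqd_lt p x r : 0 <= r -> (sqd p x < r ^+ 2) = (eucl_norm (x - p) < r).
Proof. by move=> r0; rewrite sqdE ltr_pXn2r// nnegrE eucl_norm_ge0. Qed.

Lemma eucl_normZ a x : eucl_norm (a *: x) = `|a| * eucl_norm x.
Proof.
rewrite /eucl_norm -sqrtr_sqr -sqrtrM ?sqr_ge0// mulr_sumr; congr Num.sqrt.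
by apply: eq_bigr => i _; rewrite mxE exprMn.
Qed.

Lemma eucl_normN x : eucl_norm (- x) = eucl_norm x.
Proof. by rewrite -scaleN1r eucl_normZ normrN1 mul1r. Qed.

Lemma eucl_norm0 : eucl_norm (0 : 'rV[R]_n) = 0.
Proof. by rewrite -(scale0r (0 : 'rV[R]_n)) eucl_normZ normr0 mul0r. Qed.

Lemma cauchy_schwarz x y :
  (\sum_i x ord0 i * y ord0 i) ^+ 2 <= (\sum_i x ord0 i ^+ 2) * (\sum_i y ord0 i ^+ 2).
Proof.
set A := \sum_i x ord0 i ^+ 2; set B := \sum_i y ord0 i ^+ 2; set P := \sum_i _ * _.
have B0 : 0 <= B by apply: sumr_ge0 => i _; rewrite sqr_ge0.
have [B1|B1] := eqVneq B 0.
  have y0 i : y ord0 i = 0.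
    apply/eqP; rewrite -sqrf_eq0; apply/eqP.
    exact: (psumr_eq0P (fun j _ => sqr_ge0 (y ord0 j)) B1).
  by rewrite /P big1 ?expr0n ?B1 ?mulr0// => i _; rewrite y0 mulr0.
have B2 : 0 < B by rewrite lt_def B1.
have : 0 <= \sum_i (B * x ord0 i - P * y ord0 i) ^+ 2.
  by apply: sumr_ge0 => i _; rewrite sqr_ge0.
have -> : \sum_i (B * x ord0 i - P * y ord0 i) ^+ 2 = B * (A * B - P ^+ 2).
  transitivity (\sum_i (B ^+ 2 * x ord0 i ^+ 2 - 2 * B * P * (x ord0 i * y ord0 i)
      + P ^+ 2 * y ord0 i ^+ 2)).
    by apply: eq_bigr => i _; ring.
  rewrite big_split sumrB -!mulr_sumr /= -/A -/B -/P; ring.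
by rewrite pmulr_rge0// subr_ge0.
Qed.

Lemma eucl_norm_triangle x y : eucl_norm (x + y) <= eucl_norm x + eucl_norm y.
Proof.
rewrite -(@ler_pXn2r _ 2)// ?nnegrE ?addr_ge0 ?eucl_norm_ge0//.
rewrite sqrrD !eucl_norm_sqr.
have -> : \sum_i (x + y) ord0 i ^+ 2 = \sum_i x ord0 i ^+ 2 +
    (\sum_i x ord0 i * y ord0 i) *+ 2 + \sum_i y ord0 i ^+ 2.
  by rewrite -sumrMnl -!big_split; apply: eq_bigr => i _ /=; rewrite mxE sqrrD.
rewrite lerD2r lerD2l lerMn2r orFb; apply: le_trans (ler_norm _) _.
rewrite -sqrtr_sqr /eucl_norm -sqrtrM; last first.
  by apply: sumr_ge0 => i _; rewrite sqr_ge0.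
by rewrite ler_sqrt ?cauchy_schwarz// mulr_ge0//; apply: sumr_ge0 => i _; rewrite sqr_ge0.
Qed.

Lemma eucl_norm_dist x y z : eucl_norm (x - z) <= eucl_norm (x - y) + eucl_norm (y - z).
Proof. by rewrite -(subrKA y); exact: eucl_norm_triangle. Qed.

Lemma eucl_normB x y : eucl_norm (x - y) = eucl_norm (y - x).
Proof. by rewrite -eucl_normN opprB. Qed.

Lemma norm_le_eucl x : `|x| <= eucl_norm x.
Proof.
rewrite -(@ler_pXn2r _ 2)// ?nnegrE ?eucl_norm_ge0// eucl_norm_sqr.
have := norm_sqd 0 x; rewrite subr0 /sqd.
by under eq_bigr do rewrite mxE subr0.
Qed.

Lemma coord_le_eucl x i : `|x ord0 i| <= eucl_norm x.
Proof. exact: le_trans (rV_coord_le x i) (norm_le_eucl x). Qed.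

Lemma eucl_norm_delta i : eucl_norm (delta_mx ord0 i : 'rV[R]_n) = 1.
Proof.
rewrite /eucl_norm (bigD1 i)//= mxE !eqxx/= expr1n big1 ?addr0 ?sqrtr1// => j /negbTE ji.
by rewrite mxE ji andbF expr0n.
Qed.

Lemma closed_superlevel (f : 'rV[R]_n -> R) a : (forall x, {for x, continuous f}) ->
  closed [set x | a <= f x].
Proof.
move=> cf; have -> : [set x | a <= f x] = f @^-1` [set t | a <= t] by [].
by apply: closed_comp => [x _|]; [exact: cf|exact: closed_ge].
Qed.

Lemma nbhs_gt (f : 'rV[R]_n -> R) x a : {for x, continuous f} -> a < f x ->
  nbhs x [set y | a < f y].
Proof.
move=> /(@cont_nearP R 'rV[R]_n) cf ax.
have e0 : 0 < (f x - a) / 2 by rewrite divr_gt0// subr_gt0.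
apply: filterS (cf _ e0) => y /=; rewrite ler_norml => /andP[]; lra.
Qed.

Lemma nbhs_lt (f : 'rV[R]_n -> R) x a : {for x, continuous f} -> f x < a ->
  nbhs x [set y | f y < a].
Proof.
move=> /(@cont_nearP R 'rV[R]_n) cf ax.
have e0 : 0 < (a - f x) / 2 by rewrite divr_gt0// subr_gt0.
apply: filterS (cf _ e0) => y /=; rewrite ler_norml => /andP[]; lra.
Qed.

Definition ecball p r : set 'rV[R]_n := [set x | eucl_norm (x - p) <= r].

Lemma ecball_closed p r : closed (ecball p r).
Proof.
have [r0|r0] := leP 0 r.
  have -> : ecball p r = [set x | - r ^+ 2 <= - sqd p x].
    by apply/seteqP; split => x /=; rewrite /ecball/= lerN2 sqd_le.
  by apply: closed_superlevel => x; apply: (@contN R 'rV[R]_n); exact: cont_sqd.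
have -> : ecball p r = set0; last exact: closed0.
apply/seteqP; split => // x /=; rewrite /ecball/= => /le_lt_trans/(_ r0).
by rewrite ltNge eucl_norm_ge0.
Qed.

Lemma ecball_compact p r : compact (ecball p r).
Proof.
apply: (subclosed_compact (@ecball_closed p r) (@cball_compact R n p r)).
by move=> x /= h; apply: le_trans (norm_le_eucl _) h.
Qed.

Lemma contX (f : 'rV[R]_n -> R) x k : {for x, continuous f} ->
  {for x, continuous (fun y => f y ^+ k)}.
Proof.
move=> cf; elim: k => [|k IH]; first exact: cst_continuous.
have -> : (fun y => f y ^+ k.+1) = (fun y => f y * f y ^+ k).
  by apply/funext => y; rewrite exprS.
exact: (@contM R 'rV[R]_n).
Qed.

Lemma jetX f x G H k : hasjet f x G H ->
  hasjet (fun y => f y ^+ k.+2) x (fun i => k.+2%:R * f x ^+ k.+1 * G i)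
   (fun i => k.+2%:R * f x ^+ k.+1 * H i + k.+2%:R * k.+1%:R / 2 * f x ^+ k * G i ^+ 2).
Proof.
move=> hf; elim: k => [|k IH].
  have -> : (fun y => f y ^+ 2) = (fun y => f y * f y).
    by apply/funext => y; rewrite expr2.
  apply: (jet_ext (jetM hf hf)) => i /=; rewrite ?expr1 ?expr0; first by ring.
  by field.
have -> : (fun y => f y ^+ k.+3) = (fun y => f y * f y ^+ k.+2).
  by apply/funext => y; rewrite exprS.
apply: (jet_ext (jetM hf IH)) => i /=; rewrite !exprS -!natr1.
  by ring.
by field.
Qed.

Lemma ge1_bernoulli (a : R) k : 1 <= a -> a <= a ^+ k.+1.
Proof. by move=> a1; rewrite exprS ler_peMr ?(le_trans ler01 a1)// exprn_ege1. Qed.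

Lemma spread : exists c0 c1 : R, [/\ 0 < c0, 0 < c1 <= 1 &
  forall D w p s A c' c, 0 < s -> 0 < A -> (forall x, D x -> nbhs x D) ->
   lap_between D c' c w -> {within ecball p (4 * s), continuous w} ->
   (forall x, ecball p (4 * s) x -> 0 <= w x) ->
   (forall x, ecball p s x -> A <= w x) ->
   (forall x, eucl_norm (x - p) < 4 * s -> ~ D x -> A <= w x) ->
   c * s ^+ 2 <= c0 * A -> forall x, ecball p (3 * s) x -> c1 * A <= w x].
Proof.
pose k := (16 * n + 4)%N.
pose Z : R := 2 ^+ k.+2.
have Z1 : 1 <= Z by rewrite exprn_ege1// ler1n.
have Z0 : 0 < Z by exact: lt_le_trans Z1.
have iZ1 : Z^-1 <= 1 by rewrite invf_le1.
have iZ0 : 0 < Z^-1 by rewrite invr_gt0.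
exists (Z^-1 / 32), (Z^-1 * (7 / 16)); split; first by lra.
  by apply/andP; split; lra.
move=> D w p s A c' c s0 A0 oD lw cw w0 wA wD cs x xp.
pose K := ((4 * s) ^+ 2)^-1.
have s20 : 0 < s ^+ 2 by rewrite exprn_gt0.
have s160 : 0 < (4 * s) ^+ 2 by rewrite exprn_gt0// mulr_gt0.
have K0 : 0 < K by rewrite invr_gt0.
have Ks : K * s ^+ 2 = 16^-1.
  rewrite /K exprMn; field.
  by rewrite gt_eqF.
pose f y := 2 + (- K) * sqd p y.
pose b y := A * Z^-1 * (f y ^+ k.+2 + (-1)).
have cf y : {for y, continuous f}.
  apply: (@contD R 'rV[R]_n); first exact: cst_continuous.
  by apply: contZ; exact: cont_sqd.
have cb y : {for y, continuous b}.
  apply: contZ; apply: (@contD R 'rV[R]_n); last exact: cst_continuous.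
  exact: contX.
pose D' := D `&` [set y | s ^+ 2 < sqd p y] `&` [set y | sqd p y < (4 * s) ^+ 2].
have f2 y : f y <= 2.
  by rewrite /f gerDl mulNr oppr_le0 mulr_ge0 ?sqd_ge0// ltW.
have bA y : 0 <= f y -> b y <= A.
  move=> fy0; rewrite /b -mulrA -[leRHS]mulr1 ler_wpM2l ?(ltW A0)//.
  rewrite ler_pdivrMl// mulr1; have : f y ^+ k.+2 <= Z by rewrite lerXn2r// nnegrE.
  lra.
have f1 y : sqd p y <= (4 * s) ^+ 2 -> 1 <= f y.
  move=> h; have : K * sqd p y <= K * (4 * s) ^+ 2 by rewrite ler_wpM2l// ltW.
  by rewrite [X in _ <= X]mulVf ?gt_eqF// /f; lra.
suff : b x <= w x.
  apply: le_trans; rewrite /b (_ : Z^-1 * (7 / 16) * A = A * Z^-1 * (7 / 16)); last by ring.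
  rewrite ler_wpM2l ?mulr_ge0 ?(ltW iZ0) ?(ltW A0)//.
  have xs : sqd p x <= (3 * s) ^+ 2 by rewrite sqd_le// mulr_ge0// ltW.
  have : K * sqd p x <= K * (3 * s) ^+ 2 by rewrite ler_wpM2l// ltW.
  have -> : K * (3 * s) ^+ 2 = 9 / 16 by rewrite exprMn mulrCA Ks; field.
  move=> h; have fx : 1 <= f x by rewrite /f; lra.
  by have := ge1_bernoulli k.+1 fx; rewrite {1}/f; lra.
apply: (@comparison R n (ecball p (4 * s)) D' w b c' c (A * Z^-1 * K / 2)) => //.
- exact: ecball_compact.
- move=> y [[Dy y1] y2]; apply: filterI; last by apply: nbhs_lt => //; exact: cont_sqd.
  apply: filterI; first exact: oD.
  by apply: nbhs_gt => //; exact: cont_sqd.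
- by move=> y [_ /ltW]; rewrite sqd_le// mulr_ge0// ltW.
- by apply: lap_between_sub lw => y [[]].
- by rewrite divr_gt0// !mulr_gt0.
- move=> y [[_ y1] y2].
  have jf : hasjet f y (fun i => (- K) * (2 * (y ord0 i - p ord0 i))) (fun=> - K).
    have := jetD (jet_cst 2 y) (jetM (jet_cst (- K) y) (jet_sqd p y)).
    by move=> /jet_ext; apply => i /=; ring.
  have := jetM (jet_cst (A * Z^-1) y) (jetD (jetX k jf) (jet_cst (-1) y)).
  move=> /jet_ext - /(_ _ (fun i => A / Z * (k.+2%:R * f y ^+ k.+1 * - K) +
      A / Z * (k.+2%:R * k.+1%:R / 2 * f y ^+ k * (4 * K ^+ 2)) * (y ord0 i - p ord0 i) ^+ 2)
      (frefl _)) je.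
  have {je} := je _; rewrite -/b => je.
  have {je}/jet_haslap hl := je (fun i => ltac:(rewrite /=; ring)).
  eexists; last exact: hl.
  rewrite big_split/= sumr_const card_ord -mulr_sumr -/(sqd p y).
  have fy1 : 1 <= f y by apply: f1; exact: ltW.
  set F := f y ^+ k.
  have F1 : 1 <= F by rewrite exprn_ege1.
  have -> : f y ^+ k.+1 = f y * F by rewrite exprS.
  have y1' : 16^-1 <= K * sqd p y by rewrite -Ks ler_wpM2l// ltW.
  set S := K * sqd p y in y1'.
  rewrite [leRHS](_ : _ = A / Z * K * (k.+2%:R * F * (4 * k.+1%:R * S - 2 * n%:R * f y)));
    last by rewrite -[X in _ * (X + _)]mulr_natl /S; field; rewrite gt_eqF.
  have AZK : 0 < A / Z * K by rewrite !mulr_gt0.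
  have c2 : c <= A / Z * K / 2.
    rewrite -(ler_pM2r s20); apply: le_trans cs _.
    have -> : A / Z * K / 2 * s ^+ 2 = A / Z * (K * s ^+ 2) / 2 by ring.
    by rewrite Ks le_eqVlt; apply/orP; left; apply/eqP; field; rewrite gt_eqF.
  have h1 : 1 <= 4 * k.+1%:R * S - 2 * n%:R * f y.
    have k1 : k.+1%:R = 16 * n%:R + 5 :> R
      by rewrite -natr1 /k natrD natrM; ring.
    have n0 : 0 <= n%:R :> R by [].
    have : n%:R * f y <= n%:R * 2 :> R by rewrite ler_wpM2l.
    have : k.+1%:R * 16^-1 <= k.+1%:R * S by rewrite ler_wpM2l.
    by rewrite k1; lra.
  have h2 : 1 <= k.+2%:R * F * (4 * k.+1%:R * S - 2 * n%:R * f y).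
    rewrite -[X in X <= _]mulr1; apply: ler_pM => //.
    by rewrite -[X in X <= _]mulr1; apply: ler_pM => //; rewrite ler1n.
  have : A / Z * K * 1 <= A / Z * K * (k.+2%:R * F * (4 * k.+1%:R * S - 2 * n%:R * f y)).
    by rewrite ler_wpM2l// ltW.
  lra.
- move=> y yK nD.
  have s4 : 0 <= 4 * s by rewrite mulr_ge0// ltW.
  have y2 : sqd p y <= (4 * s) ^+ 2 by rewrite sqd_le.
  have fy1 := f1 y y2.
  have fy0 : 0 <= f y by lra.
  have [y3|y3] := ltP (sqd p y) ((4 * s) ^+ 2); last first.
    have fy : f y = 1.
      have -> : f y = 2 - K * (4 * s) ^+ 2 by rewrite /f mulNr (le_anti (introT andP (conj y2 y3))).
      by rewrite mulVf ?gt_eqF//; ring.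
    by rewrite /b fy expr1n subrr mulr0; exact: w0.
  apply: le_trans (bA y fy0) _.
  have [Dy|Dy] := pselect (D y); last by apply: wD => //; rewrite -sqd_lt.
  have [y4|y4] := ltP (s ^+ 2) (sqd p y).
    by exfalso; apply: nD.
  by apply: wA; rewrite /ecball/= -sqd_le// ltW.
- move: xp; rewrite /ecball/= => /le_trans; apply; rewrite ler_wpM2r ?(ltW s0)//.
  by rewrite ler_nat.
Qed.

End euclid.

(** * The cone barrier *)

Section cone.
Variables (R : realType) (n : nat).
Implicit Types (x y p : 'rV[R]_n.+1) (D : set 'rV[R]_n.+1).

Lemma xprimeD x y : xprime (x + y) = xprime x + xprime y.
Proof. by apply/rowP => i; rewrite !mxE. Qed.

Lemma xprimeB x y : xprime (x - y) = xprime x - xprime y.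
Proof. by apply/rowP => i; rewrite !mxE. Qed.

Lemma xprimeZ (a : R) x : xprime (a *: x) = a *: xprime x.
Proof. by apply/rowP => i; rewrite !mxE. Qed.

Lemma xlastD x y : xlast (x + y) = xlast x + xlast y.
Proof. by rewrite /xlast !mxE. Qed.

Lemma xlastB x y : xlast (x - y) = xlast x - xlast y.
Proof. by rewrite /xlast !mxE. Qed.

Lemma xlastZ (a : R) x : xlast (a *: x) = a * xlast x.
Proof. by rewrite /xlast !mxE. Qed.

Lemma xprime_e : xprime (e_last R n) = 0.
Proof.
by apply/rowP => i; rewrite !mxE eqxx /= eq_sym (negbTE (neq_lift _ _)).
Qed.

Lemma xlast_e : xlast (e_last R n) = 1.
Proof. by rewrite /xlast mxE !eqxx. Qed.

Lemma xprime_shift x (t : R) : xprime (x + t *: e_last R n) = xprime x.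
Proof. by rewrite xprimeD xprimeZ xprime_e scaler0 addr0. Qed.

Lemma xlast_shift x (t : R) : xlast (x + t *: e_last R n) = xlast x + t.
Proof. by rewrite xlastD xlastZ xlast_e mulr1. Qed.

Lemma eucl_norm_split x :
  eucl_norm x ^+ 2 = eucl_norm (xprime x) ^+ 2 + xlast x ^+ 2.
Proof.
rewrite !eucl_norm_sqr big_ord_recr/=; congr (_ + _).
apply: eq_bigr => i _; rewrite !mxE; congr (x _ _ ^+ 2); apply/val_inj => /=.
by rewrite /bump leqNgt ltn_ord.
Qed.

Lemma eucl_norm_prime x : eucl_norm (xprime x) <= eucl_norm x.
Proof.
rewrite -(@ler_pXn2r _ 2)// ?nnegrE ?eucl_norm_ge0// eucl_norm_split.
by rewrite lerDl sqr_ge0.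
Qed.

Lemma xlast_le_eucl x : `|xlast x| <= eucl_norm x.
Proof. exact: coord_le_eucl. Qed.

Lemma eucl_norm_e : eucl_norm (e_last R n) = 1.
Proof. exact: eucl_norm_delta. Qed.

Lemma eucl_norm_te (t : R) : eucl_norm (t *: e_last R n) = `|t|.
Proof. by rewrite eucl_normZ eucl_norm_e mulr1. Qed.

Lemma eucl_norm_shift x (t : R) : eucl_norm (x + t *: e_last R n - x) = `|t|.
Proof. by rewrite addrAC subrr add0r eucl_norm_te. Qed.

Lemma cont_xlastB p x : {for x, continuous (fun y => xlast y - xlast p)}.
Proof. exact: cont_coordB. Qed.

Definition quad (m : R) p x : R :=
  (1 + m ^+ 2) * (xlast x - xlast p) ^+ 2 + (- m ^+ 2) * sqd p x.

Lemma quadE m p x :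
  quad m p x = (xlast x - xlast p) ^+ 2 - m ^+ 2 * eucl_norm (xprime x - xprime p) ^+ 2.
Proof. by rewrite /quad sqdE eucl_norm_split xlastB xprimeB; ring. Qed.

Lemma quad_le m p x : quad m p x <= sqd p x.
Proof.
rewrite quadE sqdE eucl_norm_split xlastB xprimeB.
have := sqr_ge0 (eucl_norm (xprime x - xprime p)).
have : 0 <= m ^+ 2 * eucl_norm (xprime x - xprime p) ^+ 2 by rewrite mulr_ge0 ?sqr_ge0.
lra.
Qed.

Lemma cont_quad m p x : {for x, continuous (quad m p)}.
Proof.
apply: (@contD R 'rV[R]_n.+1); last by apply: contZ; exact: cont_sqd.
apply: contZ; apply: contX; exact: cont_xlastB.
Qed.

Lemma jet_quad m p x : hasjet (quad m p) x
  (fun i => (1 + m ^+ 2) * (2 * (xlast x - xlast p) * (ord_max == i)%:R)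
     + (- m ^+ 2) * (2 * (x ord0 i - p ord0 i)))
  (fun i => (1 + m ^+ 2) * (ord_max == i)%:R + - m ^+ 2).
Proof.
have j1 := jet_coord ord_max (xlast p) x.
have j2 := jetM (jet_cst (1 + m ^+ 2) x) (jetX 0 j1).
have j3 := jetM (jet_cst (- m ^+ 2) x) (jet_sqd p x).
apply: (jet_ext (jetD j2 j3)) => i; rewrite /= ?expr1 ?expr0 -/(xlast x).
  by ring.
by case: (ord_max == i); rewrite ?expr1n ?expr0n /=; field.
Qed.

Lemma sum_delta (a : R) : \sum_(i < n.+1) (a * (ord_max == i)%:R) = a.
Proof.
rewrite (bigD1 ord_max)//= eqxx mulr1 big1 ?addr0// => i.
by rewrite eq_sym => /negbTE ->; rewrite mulr0.
Qed.

Lemma haslap_quad m p x : haslap (quad m p) x (2 * (1 - n%:R * m ^+ 2)).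
Proof.
have := jet_haslap (jet_quad m p x).
rewrite big_split/= sum_delta sumr_const card_ord -[X in _ + X]mulr_natl -[n.+1%:R]natr1.
by rewrite (_ : 1 + m ^+ 2 + (n%:R + 1) * - m ^+ 2 = 1 - n%:R * m ^+ 2)//; ring.
Qed.

Lemma haslap_cone_barrier (m eta K : R) p x :
  haslap (fun y => quad m p y * ((1 + eta) + (- (eta * K)) * sqd p y)) x
   (2 * (((1 + eta) - eta * K * sqd p x) * (1 - n%:R * m ^+ 2)
       - eta * K * (n.+1%:R + 4) * quad m p x)).
Proof.
have j1 := jetD (jet_cst (1 + eta) x) (jetM (jet_cst (- (eta * K)) x) (jet_sqd p x)).
have j2 := jetM (jet_quad m p x) j1.
have := jet_haslap j2.
rewrite (eq_bigr (fun i => quad m p x * - (eta * K) +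
      ((1 + eta) + (- (eta * K)) * sqd p x) *
      ((1 + m ^+ 2) * (ord_max == i)%:R + - m ^+ 2) +
      - (4 * eta * K) * ((1 + m ^+ 2) * (xlast x - xlast p) ^+ 2) * (ord_max == i)%:R +
      4 * eta * K * m ^+ 2 * (x ord0 i - p ord0 i) ^+ 2)); last first.
  move=> i _ /=.
  have [<-|_] := eqVneq ord_max i; rewrite /= ?mulr1 ?mulr0 -?/(xlast x) -?/(xlast p); ring.
set l := 2 * _; set l' := 2 * _; suff -> : l = l' by [].
rewrite /l /l' !big_split/= !sumr_const card_ord sum_delta.
rewrite -!mulr_sumr -/(sqd p x).
have -> : \sum_(i < n.+1) ((1 + m ^+ 2) * (ord_max == i)%:R + - m ^+ 2) = 1 - n%:R * m ^+ 2.
  rewrite big_split/= sum_delta sumr_const card_ord -[X in _ + X]mulr_natl -[n.+1%:R]natr1; ring.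
have -> : (1 + m ^+ 2) * (xlast x - xlast p) ^+ 2 = quad m p x + m ^+ 2 * sqd p x.
  by rewrite /quad; ring.
rewrite -[X in X + _ + _ + _]mulr_natl; ring.
Qed.

Lemma closed_setI3 (f1 f2 : 'rV[R]_n.+1 -> R) p r :
  (forall x, {for x, continuous f1}) -> (forall x, {for x, continuous f2}) ->
  compact [set x | [/\ ecball p r x, 0 <= f1 x & 0 <= f2 x]].
Proof.
move=> c1 c2.
have -> : [set x | [/\ ecball p r x, 0 <= f1 x & 0 <= f2 x]] =
   ecball p r `&` ([set x | 0 <= f1 x] `&` [set x | 0 <= f2 x]).
  by apply/seteqP; split => x /=; [case|case=> ? []].
apply: (subclosed_compact _ (@ecball_compact R _ p r)); last by move=> x [].
apply: closedI; first exact: ecball_closed.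
by apply: closedI; exact: closed_superlevel.
Qed.

Lemma cone_growth (m : R) : n%:R * m ^+ 2 < 1 -> exists eta e0 : R,
 [/\ 0 < eta, 0 < e0 & forall D w p r c' c, 0 < r ->
  (forall x, D x -> nbhs x D) -> lap_between D c' c w ->
  {within ecball p r, continuous w} -> (forall x, ecball p r x -> 0 <= w x) ->
  (forall x, eucl_norm (x - p) < r -> 0 < xlast x - xlast p -> 0 < quad m p x -> D x) ->
  (forall x, eucl_norm (x - p) = r -> 0 <= xlast x - xlast p -> 0 <= quad m p x ->
     1 <= w x) ->
  c * r ^+ 2 <= e0 ->
  forall k t, 0 <= t <= r / 2 ^+ k ->
    (1 + eta) ^+ k * (t / r) ^+ 2 <= w (p + t *: e_last R n)].
Proof.
move=> nm; pose d := 1 - n%:R * m ^+ 2.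
have d0 : 0 < d by rewrite subr_gt0.
have n5 : 0 < n.+1%:R + 4 :> R by rewrite ltr_wpDl.
pose eta := d / (2 * (n.+1%:R + 4)).
have eta0 : 0 < eta by rewrite divr_gt0// mulr_gt0.
have etad : eta * (n.+1%:R + 4) = d / 2 by rewrite /eta; field; rewrite gt_eqF.
exists (3 / 4 * eta), (d / 2); split; [by rewrite mulr_gt0| |]; first by rewrite divr_gt0.
move=> D w p r c' c r0 oD lw cw w0 coneD w1 cr.
pose h := 3 / 4 * eta.
have h0 : 0 < h by rewrite mulr_gt0.
pose rk k := r / 2 ^+ k.
have rk0 k : 0 < rk k by rewrite divr_gt0// exprn_gt0.
have rkr k : rk k <= r.
  by rewrite /rk ler_pdivrMr ?exprn_gt0// ler_peMr ?(ltW r0)// exprn_ege1// ler1n.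
pose G y := 0 <= xlast y - xlast p /\ 0 <= quad m p y.
pose b k y := (1 + h) ^+ k / r ^+ 2 *
  (quad m p y * ((1 + eta) + (- (eta * (rk k ^+ 2)^-1)) * sqd p y)).
have H0 k : 0 < (1 + h) ^+ k / r ^+ 2.
  by rewrite divr_gt0 ?exprn_gt0// ltr_wpDl// ltW.
have step k : (forall x, eucl_norm (x - p) = rk k -> G x ->
      (1 + h) ^+ k * (quad m p x / r ^+ 2) <= w x) ->
    forall x, ecball p (rk k) x -> G x -> b k x <= w x.
  move=> hk x xk Gx.
  pose K := [set x | [/\ ecball p (rk k) x, 0 <= xlast x - xlast p & 0 <= quad m p x]].
  pose D' := [set x | sqd p x < rk k ^+ 2] `&`
    ([set x | 0 < xlast x - xlast p] `&` [set x | 0 < quad m p x]).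
  apply: (@comparison R n.+1 K D' w (b k) c' c (d / 2 / r ^+ 2)).
  - by apply: closed_setI3 => y; [exact: cont_xlastB|exact: cont_quad].
  - move=> y [y1 [y2 y3]]; apply: filterI; first by apply: nbhs_lt => //; exact: cont_sqd.
    apply: filterI; apply: nbhs_gt => //; [exact: cont_xlastB|exact: cont_quad].
  - move=> y [/ltW y1 [/ltW y2 /ltW y3]]; split => //.
    by rewrite /ecball/= -sqd_le// ltW.
  - apply: continuous_subspaceW cw => y [y1 _ _].
    exact: le_trans y1 (rkr k).
  - move=> y; apply: contZ; apply: (@contM R 'rV[R]_n.+1); first exact: cont_quad.
    apply: (@contD R 'rV[R]_n.+1); first exact: cst_continuous.
    by apply: contZ; exact: cont_sqd.
  - apply: lap_between_sub lw => y [y1 [y2 y3]]; apply: coneD => //.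
    by rewrite (lt_le_trans _ (rkr k))// -sqd_lt// ltW.
  - by rewrite !divr_gt0// exprn_gt0.
  - move=> y [y1 [y2 y3]]; eexists; last first.
      by apply: haslapZ; exact: haslap_cone_barrier.
    have rk2 : 0 < rk k ^+ 2 by rewrite exprn_gt0.
    set Q := (rk k ^+ 2)^-1.
    have Q0 : 0 < Q by rewrite invr_gt0.
    have Qs : Q * sqd p y <= 1 by rewrite ler_pdivrMl// mulr1 ltW.
    have Qq : Q * quad m p y <= 1.
      by apply: le_trans Qs; rewrite ler_wpM2l ?(ltW Q0)// quad_le.
    have e1 : eta * (Q * sqd p y) <= eta * 1 by rewrite ler_wpM2l// ltW.
    have e2 : eta * (n.+1%:R + 4) * (Q * quad m p y) <= eta * (n.+1%:R + 4) * 1.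
      by rewrite ler_wpM2l// ltW// mulr_gt0.
    have e3 : d <= (1 + eta - eta * Q * sqd p y) * d.
      by rewrite ler_peMl ?(ltW d0)//; lra.
    have r20 : 0 < r ^+ 2 by rewrite exprn_gt0.
    have hr : (r ^+ 2)^-1 <= (1 + h) ^+ k / r ^+ 2.
      by rewrite ler_peMl ?invr_ge0 ?(ltW r20)// exprn_ege1// lerDl ltW.
    have cr' : c <= d / 2 / r ^+ 2 by rewrite ler_pdivlMr.
    apply: (@le_trans _ _ ((r ^+ 2)^-1 * d)); first by lra.
    apply: ler_pM => //; rewrite ?invr_ge0 ?(ltW r20) ?(ltW d0)//.
    by rewrite -/d; lra.
  - move=> y [y1 y2 y3] nD.
    have y1' : sqd p y <= rk k ^+ 2 by rewrite sqd_le// ltW.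
    have [q0|q0] := ltP 0 (quad m p y); last first.
      rewrite /b; have -> : quad m p y = 0 by apply/le_anti; rewrite q0 y3.
      by rewrite mul0r mulr0 w0// /ecball/=; exact: le_trans y1 (rkr k).
    have l0 : 0 < xlast y - xlast p.
      rewrite lt_def y2 andbT; apply/eqP => l0; move: q0.
      by rewrite quadE l0 expr0n/= sub0r oppr_gt0 ltNge mulr_ge0 ?sqr_ge0.
    have [s1|s1] := ltP (sqd p y) (rk k ^+ 2); first by exfalso; apply: nD.
    have sE : sqd p y = rk k ^+ 2 by apply/le_anti; rewrite s1 y1'.
    have yE : eucl_norm (y - p) = rk k.
      apply/eqP; rewrite -(@eqrXn2 _ 2)// ?eucl_norm_ge0 ?(ltW (rk0 k))// -sqdE.
      exact/eqP.
    apply: le_trans (hk y yE (conj y2 y3)).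
    rewrite le_eqVlt; apply/orP; left; apply/eqP.
    rewrite /b sE -mulrA; congr (_ * _).
    by rewrite mulNr -mulrA mulVf ?gt_eqF ?exprn_gt0//; ring.
  - by split => //; case: Gx.
have claim k : forall x, eucl_norm (x - p) = rk k -> G x ->
      (1 + h) ^+ k * (quad m p x / r ^+ 2) <= w x.
  elim: k => [|k IH] x xk [g1 g2].
    rewrite expr0 mul1r; apply: (@le_trans _ _ 1); last first.
      by apply: w1 => //; rewrite xk /rk expr0 divr1.
    rewrite ler_pdivrMr ?exprn_gt0// mul1r; apply: le_trans (quad_le _ _ _) _.
    by rewrite sqdE xk /rk expr0 divr1.
  have xk' : ecball p (rk k) x.
    rewrite /ecball/= xk /rk ler_pM2l// lef_pV2 ?posrE ?exprn_gt0// exprS.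
    by rewrite ler_peMl ?exprn_ge0// ler1n.
  apply: le_trans (step k IH x xk' (conj g1 g2)).
  have Q4 : (rk k ^+ 2)^-1 * sqd p x = 4^-1.
    rewrite sqdE xk (_ : rk k.+1 = rk k / 2).
      by field; rewrite gt_eqF.
    by rewrite /rk exprS; field; rewrite expf_neq0.
  rewrite /b (_ : - (eta / rk k ^+ 2) * sqd p x = - (eta / 4)); last first.
    by rewrite mulNr -mulrA Q4.
  rewrite exprS le_eqVlt; apply/orP; left; apply/eqP.
  rewrite (_ : 1 + eta + - (eta / 4) = 1 + h); last by rewrite /h; field.
  by field; rewrite gt_eqF.
move=> k t /andP[t0 tk].
have xp : eucl_norm (p + t *: e_last R n - p) = t by rewrite eucl_norm_shift ger0_norm.
have qt : quad m p (p + t *: e_last R n) = t ^+ 2.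
  rewrite quadE xlast_shift xprime_shift subrr eucl_norm0 expr0n/= mulr0 subr0.
  by congr (_ ^+ 2); ring.
apply: le_trans (step k (claim k) _ _ _); last 2 first.
- by rewrite /ecball/= xp.
- by rewrite /G qt sqr_ge0 xlast_shift; split => //; rewrite addrAC subrr add0r.
have rk2 : 0 < rk k ^+ 2 by rewrite exprn_gt0.
have Qt : (rk k ^+ 2)^-1 * t ^+ 2 <= 1.
  by rewrite ler_pdivrMl// mulr1 lerXn2r// nnegrE// ltW.
rewrite /b qt sqdE xp expr_div_n mulrA [leLHS]mulrAC ler_pM2l//.
rewrite ler_peMr ?sqr_ge0//.
have : eta * ((rk k ^+ 2)^-1 * t ^+ 2) <= eta * 1 by rewrite ler_wpM2l// ltW.
by lra.
Qed.

End cone.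

(** * Interior estimates *)

Section lipschitz.
Variables (R : realType) (n : nat).
Local Notation "'e_ i" := (delta_mx ord0 i) (at level 8, i at level 2, format "''e_' i").
Implicit Types (x y p : 'rV[R]_n) (D : set 'rV[R]_n) (i : 'I_n).

Definition refl i (a : R) x : 'rV[R]_n := x + (2 * (a - x ord0 i)) *: 'e_i.

Lemma refl_coord i a x j :
  refl i a x ord0 j = if j == i then 2 * a - x ord0 i else x ord0 j.
Proof.
rewrite coord_shift; case: eqVneq => [->|_]; last by rewrite mulr0 addr0.
by rewrite mulr1; ring.
Qed.

Lemma norm_refl i a x y : `|refl i a x - refl i a y| <= `|x - y|.
Proof.
apply/rV_norm_le => // j; apply: le_trans (rV_coord_le (x - y) j); rewrite !mxE -/(_ ord0 j).
have := refl_coord i a x j; have := refl_coord i a y j; rewrite !mxE => -> ->.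
case: eqVneq => // ->.
by rewrite (_ : _ - _ = - (x ord0 i - y ord0 i)) ?normrN//; ring.
Qed.

Lemma refl_shift i a x (t : R) j :
  refl i a (x + t *: 'e_j) = refl i a x + (if j == i then - t else t) *: 'e_j.
Proof.
apply/rowP => k; rewrite refl_coord [in RHS]coord_shift refl_coord !coord_shift.
have [ki|ki] := eqVneq k i; last by case: (eqVneq j i) => // ->; rewrite (negbTE ki) !mulr0.
rewrite ki; have [_|ji] := eqVneq j i; rewrite /= ?mulr1 ?mulr0; ring.
Qed.

Lemma lapdiff_refl i a U x (t : R) :
  lapdiff t (fun y => U (refl i a y)) x = lapdiff t U (refl i a x).
Proof.
apply: eq_bigr => j _; rewrite -!scaleNr !refl_shift.
by case: eqVneq => // _; rewrite opprK; congr (_ + _); rewrite addrC.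
Qed.

Lemma cont_refl (U : 'rV[R]_n -> R) i a x : {for refl i a x, continuous U} ->
  {for x, continuous (fun y => U (refl i a y))}.
Proof.
move=> /cont_cball cU; apply/cont_cball => e e0.
have [r r0 hr] := cU e e0; exists r => // z zx; apply: hr.
exact: le_trans (norm_refl _ _ _ _) zx.
Qed.

Lemma lap_between_refl D u c1 c2 i a : lap_between D c1 c2 u ->
  lap_between (refl i a @^-1` D) c1 c2 (fun y => u (refl i a y)).
Proof.
move=> lu x /= Dx; have [s s0 h] := lu _ Dx; exists s => // eta /h[U hU].
exists (fun y => U (refl i a y)) => y yx.
have [|h1 h2 [l lb h3]] := hU (refl i a y).
  exact: le_trans (norm_refl _ _ _ _) yx.
split => //; first exact: cont_refl.
exists l => // e e0; have [t0 t00 ht] := h3 e e0; exists t0 => // t /ht.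
by rewrite lapdiff_refl.
Qed.

Lemma sqd_refl i p x : sqd p (refl i (p ord0 i) x) = sqd p x.
Proof.
apply: eq_bigr => j _; rewrite refl_coord; case: eqVneq => // ->; ring.
Qed.

Lemma haslap_lip_barrier i (a1 a2 a3 : R) p x :
  haslap (fun y => a1 * sqd p y + (a2 * (y ord0 i - p ord0 i)
     + a3 * (y ord0 i - p ord0 i) ^+ 2)) x (2 * (n%:R * a1 + a3)).
Proof.
have j1 := jetM (jet_cst a1 x) (jet_sqd p x).
have j0 := jet_coord i (p ord0 i) x.
have j2 := jetM (jet_cst a2 x) j0.
have j3 := jetM (jet_cst a3 x) (jetX 0 j0).
have := jet_haslap (jetD j1 (jetD j2 j3)).
set l := 2 * _; set l' := 2 * _; suff -> : l = l' by [].
rewrite /l /l'; congr (_ * _).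
rewrite (eq_bigr (fun j => a1 + a3 * (i == j)%:R)).
  rewrite big_split/= sumr_const card_ord mulr_natl; congr (_ + _).
  rewrite (bigD1 i)//= eqxx mulr1 big1 ?addr0// => j.
  by rewrite eq_sym => /negbTE ->; rewrite mulr0.
move=> j _ /=; rewrite expr1 expr0; by case: eqVneq => _ /=; field.
Qed.

Lemma lip_coord_half D u p r S L i : 0 < r -> 0 < S -> 0 <= L ->
  (forall x, D x -> nbhs x D) -> (forall x, D x -> {for x, continuous u}) ->
  ecball p r `<=` D -> lap_between D (- L) L u ->
  (forall x, ecball p r x -> `|u x| <= S) ->
  forall t, 0 <= t <= r ->
  u (p + t *: 'e_i) - u (p - t *: 'e_i) <= (2 * n%:R + 5) * (t / r) * (S + L * r ^+ 2).
Proof.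
move=> r0 S0 L0 oD cu pD lu uS t /andP[t0 tr].
have r20 : 0 < r ^+ 2 by rewrite exprn_gt0.
pose a := p ord0 i.
pose w y := - u y + u (refl i a y).
pose A := (2 * S * n%:R + S) / r ^+ 2 + L.
pose b y := - (2 * S / r ^+ 2) * sqd p y + (- (r * A) * (y ord0 i - p ord0 i)
     + A * (y ord0 i - p ord0 i) ^+ 2).
have A0 : 0 <= A.
  by rewrite addr_ge0// divr_ge0 ?sqr_ge0// addr_ge0 ?(ltW S0)// !mulr_ge0// ltW.
have reflball x : ecball p r x -> ecball p r (refl i a x).
  by rewrite /ecball/= -!sqd_le ?(ltW r0)// sqd_refl.
have cw x : ecball p r x -> {for x, continuous w}.
  move=> xp; apply: (@contD R 'rV[R]_n).
    by apply: (@contN R 'rV[R]_n); apply: cu; exact: pD.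
  by apply: cont_refl; apply: cu; apply: pD; exact: reflball.
have cs (f : 'rV[R]_n -> R) : (forall x, {for x, continuous f}) ->
    {for p, continuous f} by [].
pose K := [set x | ecball p r x /\ 0 <= x ord0 i - a].
pose D' := [set x | sqd p x < r ^+ 2] `&` [set x | 0 < x ord0 i - a].
have D'K : D' `<=` K.
  by move=> y [y1 /ltW y2]; split => //; rewrite /ecball/= -sqd_le ltW.
have lw : lap_between D' (- (L + L)) (L + L) w.
  have l1 : lap_between D' (- L) (- - L) (fun y => - u y).
    apply: lap_betweenN; apply: lap_between_sub lu.
    by move=> y /D'K[/pD].
  have l2 : lap_between D' (- L) L (fun y => u (refl i a y)).
    apply: (@lap_between_sub _ _ (refl i a @^-1` D)); last exact: lap_between_refl.
    by move=> y /D'K[/reflball/pD].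
  by have := lap_betweenD l1 l2; rewrite opprK opprD.
have tE : eucl_norm (p + t *: 'e_i - p) = t.
  by rewrite addrAC subrr add0r eucl_normZ eucl_norm_delta mulr1 ger0_norm.
have coordt : (p + t *: 'e_i) ord0 i - a = t.
  by rewrite coord_shift eqxx mulr1 /a; ring.
suff : b (p + t *: 'e_i) <= w (p + t *: 'e_i).
  rewrite /w (_ : refl i a (p + t *: 'e_i) = p - t *: 'e_i); last first.
    by rewrite /refl coord_shift eqxx mulr1 -addrA -scalerDl /a -scaleNr; congr (_ + _ *: _); ring.
  rewrite /b sqdE tE coordt => h.
  have : u (p + t *: 'e_i) - u (p - t *: 'e_i) <=
     2 * S / r ^+ 2 * t ^+ 2 + r * A * t - A * t ^+ 2 by lra.
  move=> /le_trans; apply.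
  have At : 0 <= A * t ^+ 2 by rewrite mulr_ge0// sqr_ge0.
  apply: (@le_trans _ _ (2 * S / r ^+ 2 * t ^+ 2 + r * A * t)); first by lra.
  have -> : r * A * t = (t / r) * ((2 * n%:R + 1) * S + L * r ^+ 2).
    by rewrite /A; field; rewrite gt_eqF.
  have -> : 2 * S / r ^+ 2 * t ^+ 2 = (t / r) * (2 * S * (t / r)).
    by field; rewrite gt_eqF.
  have q0 : 0 <= t / r by rewrite divr_ge0// ltW.
  have q1 : t / r <= 1 by rewrite ler_pdivrMr// mul1r.
  rewrite -mulrDr.
  rewrite [leRHS](_ : _ = t / r * ((2 * n%:R + 5) * (S + L * r ^+ 2))); last by ring.
  rewrite ler_wpM2l//.
  have n0 : 0 <= n%:R :> R by [].
  have Lr : 0 <= L * r ^+ 2 by rewrite mulr_ge0// sqr_ge0.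
  have : 0 <= n%:R * (L * r ^+ 2) by rewrite mulr_ge0.
  have : S * (t / r) <= S * 1 by rewrite ler_wpM2l// ltW.
  have : 0 <= n%:R * S by rewrite mulr_ge0// ltW.
  lra.
have cci x : {for x, continuous (fun y : 'rV[R]_n => y ord0 i - a)} by exact: cont_coordB.
apply: (@comparison R n K D' w b (- (L + L)) (L + L) (2 * S / r ^+ 2)) => //.
- have -> : K = ecball p r `&` [set x | 0 <= x ord0 i - a] by [].
  apply: (subclosed_compact _ (@ecball_compact R _ p r)); last by move=> x [].
  by apply: closedI; [exact: ecball_closed|exact: closed_superlevel].
- move=> y [y1 y2]; apply: filterI; first by apply: nbhs_lt => //; exact: cont_sqd.
  exact: nbhs_gt.
- apply: continuous_in_subspaceT => y /set_mem[y1 _]; exact: cw.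
- move=> x; apply: (@contD R 'rV[R]_n); first by apply: contZ; exact: cont_sqd.
  apply: (@contD R 'rV[R]_n); first by apply: contZ; exact: cont_coordB.
  by apply: contZ; apply: contX; exact: cont_coordB.
- by rewrite divr_gt0// mulr_gt0.
- move=> y [y1 y2]; eexists; last exact: haslap_lip_barrier.
  rewrite le_eqVlt; apply/orP; left; apply/eqP.
  by rewrite /A; field; rewrite gt_eqF.
- move=> y [y1 y2] nD.
  have hS : - (2 * S) <= w y.
    have := uS y y1; have := uS _ (reflball _ y1); rewrite !ler_norml /w; lra.
  have [y3|y3] := ltP 0 (y ord0 i - a).
    have y4 : r ^+ 2 <= sqd p y.
      by rewrite leNgt; apply/negP => y4; apply: nD.
    have y5 : y ord0 i - a <= r.
      apply: le_trans (ler_norm _) _; rewrite /a.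
      have := coord_le_eucl (y - p) i; rewrite !mxE => /le_trans; exact.
    apply: le_trans hS; rewrite /b -/a.
    have : 2 * S / r ^+ 2 * r ^+ 2 <= 2 * S / r ^+ 2 * sqd p y.
      by rewrite ler_wpM2l// divr_ge0// ?mulr_ge0// ltW.
    rewrite divfK ?gt_eqF// => h1.
    have : 0 <= A * ((y ord0 i - a) * (r - (y ord0 i - a))).
      by rewrite mulr_ge0// mulr_ge0// ?subr_ge0// ltW.
    move: (y ord0 i - a) => T; rewrite expr2; lra.
  have y0 : y ord0 i - a = 0 by apply/le_anti; rewrite y3 y2.
  have -> : w y = 0.
    have ya : a - y ord0 i = 0 by lra.
    by rewrite /w /refl ya mulr0 scale0r addr0 addNr.
  rewrite /b -/a y0 expr0n/= !mulr0 !addr0 mulNr oppr_le0 mulr_ge0 ?sqd_ge0//.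
  by rewrite divr_ge0// ?mulr_ge0// ltW.
- by split; [rewrite /ecball/= tE|rewrite coordt].
Qed.

Lemma lip_coord D u p r S L i : 0 < r -> 0 < S -> 0 <= L ->
  (forall x, D x -> nbhs x D) -> (forall x, D x -> {for x, continuous u}) ->
  ecball p r `<=` D -> lap_between D (- L) L u ->
  (forall x, ecball p r x -> `|u x| <= S) ->
  forall t, `|t| <= r ->
  `|u (p + t *: 'e_i) - u (p - t *: 'e_i)| <= (2 * n%:R + 5) * (`|t| / r) * (S + L * r ^+ 2).
Proof.
move=> r0 S0 L0 oD cu pD lu uS.
have H (t : R) : 0 <= t <= r ->
    `|u (p + t *: 'e_i) - u (p - t *: 'e_i)| <= (2 * n%:R + 5) * (t / r) * (S + L * r ^+ 2).
  move=> tr; rewrite ler_norml; apply/andP; split; last first.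
    exact: (lip_coord_half i r0 S0 L0 oD cu pD lu uS tr).
  have cN x : D x -> {for x, continuous (fun y => - u y)}.
    by move=> Dx; apply: (@contN R 'rV[R]_n); exact: cu.
  have lN : lap_between D (- L) L (fun y => - u y).
    by have := lap_betweenN lu; rewrite opprK.
  have uN x : ecball p r x -> `|- u x| <= S by rewrite normrN; exact: uS.
  have := lip_coord_half i r0 S0 L0 oD cN pD lN uN tr; lra.
move=> t tr; have [t0|t0] := leP 0 t.
  by have := H t; rewrite t0 -{1}(ger0_norm t0) tr (ger0_norm t0) => /(_ isT).
have := H (- t); rewrite oppr_ge0 (ltW t0) -{1}(ltr0_norm t0) tr => /(_ isT).
by rewrite (ltr0_norm t0) scaleNr opprK distrC.
Qed.

Lemma lipschitz_interior : exists C : R, 0 < C /\ forall D u p r S L,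
  0 < r -> 0 < S -> 0 <= L ->
  (forall x, D x -> nbhs x D) -> (forall x, D x -> {for x, continuous u}) ->
  ecball p r `<=` D -> lap_between D (- L) L u ->
  (forall x, ecball p r x -> `|u x| <= S) ->
  forall x, eucl_norm (x - p) <= r / 2 ->
  `|u x - u p| <= C * (eucl_norm (x - p) / r) * (S + L * r ^+ 2).
Proof.
pose C0 := 2 * n%:R + 5 : R.
have n0 : 0 <= n%:R :> R by [].
have C00 : 0 < C0 by rewrite /C0; lra.
exists (n%:R * C0 + 1); split; first by have := mulr_ge0 n0 (ltW C00); lra.
move=> D u p r S L r0 S0 L0 oD cu pD lu uS x xp.
pose d := eucl_norm (x - p).
have d0 : 0 <= d by exact: eucl_norm_ge0.
pose y (k : nat) : 'rV[R]_n := \row_j (if (j < k)%N then x ord0 j else p ord0 j).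
have y0 : y 0%N = p by apply/rowP => j; rewrite mxE.
have yn : y n = x by apply/rowP => j; rewrite mxE ltn_ord.
pose B := C0 * (d / r) * (S + L * r ^+ 2).
have Lr0 : 0 <= L * r ^+ 2 by rewrite mulr_ge0// sqr_ge0.
have B0 : 0 <= B.
  by rewrite !mulr_ge0 ?invr_ge0// ?(ltW C00) ?(ltW r0)//; lra.
have step (k : 'I_n) : `|u (y k.+1) - u (y k)| <= B.
  pose t := (x ord0 k - p ord0 k) / 2.
  pose c := y k + t *: 'e_k.
  have tk : `|t| <= d / 2.
    rewrite normrM [X in _ * X]ger0_norm ?invr_ge0// ler_wpM2r//.
    by have := coord_le_eucl (x - p) k; rewrite !mxE.
  have cp : eucl_norm (c - p) <= d.
    rewrite -(@ler_pXn2r _ 2)// ?nnegrE ?eucl_norm_ge0//.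
    rewrite /d !eucl_norm_sqr; apply: ler_sum => j _.
    have := coord_shift (y k) k t j; rewrite -/c => cE.
    rewrite [(c - p) _ _]mxE cE [(- p) _ _]mxE [(x - p) _ _]mxE [(- p) _ _]mxE [y k _ _]mxE.
    have [->|jk] := eqVneq j k.
      rewrite ltnn mulr1 /t.
      rewrite (_ : _ - _ = (x ord0 k - p ord0 k) / 2); last by ring.
      by rewrite expr_div_n ler_pdivrMr// ler_peMr ?sqr_ge0//; lra.
    rewrite mulr0 addr0; case: ifP => // _.
    by rewrite subrr expr0n/= sqr_ge0.
  have ck : y k = c - t *: 'e_k by rewrite /c addrK.
  have ck1 : y k.+1 = c + t *: 'e_k.
    apply/rowP => j; rewrite /c -addrA -scalerDl coord_shift !mxE ltnS leq_eqVlt.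
    have [jk|jk] := eqVneq j k; last by rewrite mulr0 addr0 (inj_eq val_inj) (negbTE jk).
    by rewrite jk eqxx ltnn /= mulr1 /t; field.
  have r20 : 0 < r / 2 by rewrite divr_gt0.
  have sub z : ecball c (r / 2) z -> ecball p r z.
    rewrite /ecball/= => h; apply: le_trans (eucl_norm_dist z c p) _.
    by rewrite (splitr r) lerD// (le_trans cp).
  rewrite ck ck1.
  have tr : `|t| <= r / 2 by apply: le_trans tk _; have := xp; rewrite -/d; lra.
  have := lip_coord k r20 S0 L0 oD cu (fun z h => pD z (sub z h)) lu
     (fun z h => uS z (sub z h)) tr.
  move=> /le_trans; apply; rewrite /B -/C0.
  have q0 : 0 <= `|t| / (r / 2) by rewrite divr_ge0// ltW.
  apply: ler_pM.
  - by rewrite mulr_ge0// ltW.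
  - by rewrite addr_ge0 ?(ltW S0)// mulr_ge0// sqr_ge0.
  - rewrite ler_wpM2l ?(ltW C00)// ler_pdivrMr//.
    have -> : d / r * (r / 2) = d / 2 by field; rewrite gt_eqF.
    by [].
  - rewrite lerD2l ler_wpM2l// lerXn2r// ?nnegrE ?(ltW r20) ?(ltW r0)//.
    by rewrite ler_pdivrMr// ler_peMr ?(ltW r0)// ler1n.
have sum k : (k <= n)%N -> `|u (y k) - u p| <= k%:R * B.
  elim: k => [|k IH] kn; first by rewrite y0 subrr normr0 mul0r.
  rewrite -(subrKA (u (y k))); apply: le_trans (ler_normD _ _) _.
  have := step (Ordinal kn); rewrite /= => h1; have h2 := IH (ltnW kn).
  by rewrite -natr1; lra.
have := sum n (leqnn n); rewrite yn => /le_trans; apply.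
rewrite /B -/d.
have -> : n%:R * (C0 * (d / r) * (S + L * r ^+ 2)) =
   (n%:R * C0) * ((d / r) * (S + L * r ^+ 2)) by ring.
rewrite [leRHS](_ : _ = (n%:R * C0 + 1) * ((d / r) * (S + L * r ^+ 2))); last by ring.
rewrite ler_wpM2r//; last by lra.
rewrite mulr_ge0//; last by lra.
by rewrite divr_ge0// ltW.
Qed.

End lipschitz.

Lemma leXn2 (R : realType) k (a b : R) : 0 <= a -> a <= b -> a ^+ k <= b ^+ k.
Proof. by move=> a0 ab; rewrite lerXn2r// nnegrE//; exact: le_trans ab. Qed.

Section interior.
Variables (R : realType) (n : nat).
Implicit Types (x y z p : 'rV[R]_n) (D : set 'rV[R]_n) (w : 'rV[R]_n -> R).

Definition spread_const (c0 c1 : R) := forall D w p s A c' c, 0 < s -> 0 < A ->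
   (forall x, D x -> nbhs x D) ->
   lap_between D c' c w -> (forall x, ecball p (4 * s) x -> {for x, continuous w}) ->
   (forall x, ecball p (4 * s) x -> 0 <= w x) ->
   (forall x, ecball p s x -> A <= w x) ->
   (forall x, eucl_norm (x - p) < 4 * s -> ~ D x -> A <= w x) ->
   c * s ^+ 2 <= c0 * A -> forall x, ecball p (3 * s) x -> c1 * A <= w x.

Lemma spread_const_exists : exists c0 c1 : R,
  [/\ 0 < c0, 0 < c1 <= 1 / 2 & spread_const c0 c1].
Proof.
have [c0 [c1 [c00 /andP[c10 c11] H]]] := spread R n.
exists c0, (c1 / 2); split => //.
  by apply/andP; split; lra.
move=> D w p s A c' c s0 A0 oD lw cw w0 wA wD cs x xp.
have cw' : {within ecball p (4 * s), continuous w}.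
  by apply: continuous_in_subspaceT => y /set_mem; exact: cw.
have := H D w p s A c' c s0 A0 oD lw cw' w0 wA wD cs x xp.
by have := mulr_gt0 c10 A0; lra.
Qed.

Lemma ecball_sub p q r s : eucl_norm (q - p) + s <= r -> ecball q s `<=` ecball p r.
Proof.
move=> h x; rewrite /ecball/= => xq; apply: le_trans (eucl_norm_dist x q p) _; lra.
Qed.

Lemma ecballxx p r : 0 <= r -> ecball p r p.
Proof. by move=> r0; rewrite /ecball/= subrr eucl_norm0. Qed.

Lemma cont_eucl_dist p x : {for x, continuous (fun y : 'rV[R]_n => eucl_norm (y - p))}.
Proof.
have -> : (fun y : 'rV[R]_n => eucl_norm (y - p)) = (fun y => Num.sqrt (sqd p y)).
  by apply/funext => y; rewrite sqdE sqrtr_sqr ger0_norm// eucl_norm_ge0.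
apply: (@continuous_comp 'rV[R]_n _ _ (sqd p) Num.sqrt); first exact: cont_sqd.
exact: sqrt_continuous.
Qed.

(* Maximizing [(rho - |y - p|)^M w(y)] makes [w] comparable to its value at the maximum point
   on a ball whose radius is comparable to the distance to the sphere. *)
Lemma weighted_max (M : nat) w p (rho Q : R) : (0 < M)%N -> 0 < rho -> 0 <= Q ->
  (forall y, ecball p rho y -> {for y, continuous w}) ->
  (forall y, ecball p rho y -> 0 <= w y) ->
  (forall y s, 0 < s -> eucl_norm (y - p) + 2 * s = rho -> 0 < w y ->
     (forall z, ecball y s z -> w z <= 2 ^+ M * w y) ->
     s ^+ M * w y <= Q * rho ^+ M) ->
  forall y, ecball p (rho / 2) y -> w y <= 4 ^+ M * Q.
Proof.
move=> M0 rho0 Q0 cw w0 H y yp.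
pose F z := (rho + (-1) * eucl_norm (z - p)) ^+ M * w z.
have cF : {within ecball p rho, continuous F}.
  apply: continuous_in_subspaceT => z /set_mem zp.
  apply: (@contM R 'rV[R]_n); last exact: cw.
  apply: contX; apply: (@contD R 'rV[R]_n); first exact: cst_continuous.
  by apply: contZ; exact: cont_eucl_dist.
have sub : ecball p (rho / 2) `<=` ecball p rho.
  by apply: ecball_sub; rewrite subrr eucl_norm0; lra.
have ne : ecball p rho !=set0 by exists p; apply: ecballxx; exact: ltW.
have [x /set_mem xp hx] := EVT_max_rV ne (@ecball_compact R n p rho) cF.
have Fy : (rho / 2) ^+ M * w y <= F y.
  rewrite /F ler_wpM2r ?w0//; first exact: sub.
  have := yp; rewrite /ecball/= => yp'.
  by rewrite lerXn2r// ?nnegrE; lra.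
have Fyx : F y <= F x by apply: hx; apply: mem_set; exact: sub.
have r2 : 0 < (rho / 2) ^+ M by rewrite exprn_gt0// divr_gt0.
have [Fx0|Fx0] := leP (F x) 0.
  have : (rho / 2) ^+ M * w y <= 0 by lra.
  rewrite pmulr_rle0// => h; apply: le_trans h _.
  by rewrite mulr_ge0// exprn_ge0.
have wx0 : 0 < w x.
  rewrite lt_def w0// andbT; apply/eqP => wx; move: Fx0.
  by rewrite /F wx mulr0 ltxx.
have dx : eucl_norm (x - p) <= rho by [].
have s0 : 0 < (rho - eucl_norm (x - p)) / 2.
  rewrite divr_gt0// subr_gt0 lt_neqAle dx andbT; apply/eqP => E.
  by move: Fx0; rewrite /F E mulN1r subrr expr0n gtn_eqF//= mul0r ltxx.
set s := (rho - eucl_norm (x - p)) / 2 in s0.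
have sE : eucl_norm (x - p) + 2 * s = rho by rewrite /s; lra.
have hs : s ^+ M * w x <= Q * rho ^+ M.
  apply: H => // z zx.
  have zp : eucl_norm (z - p) <= rho - s.
    by apply: le_trans (eucl_norm_dist z x p) _; move: zx; rewrite /ecball/=; lra.
  have zp' : ecball p rho z by rewrite /ecball/=; lra.
  have := hx z (mem_set zp'); rewrite /F.
  have -> : rho + -1 * eucl_norm (x - p) = 2 * s by lra.
  rewrite exprMn => h.
  have sM : 0 < s ^+ M by rewrite exprn_gt0.
  rewrite -(ler_pM2l sM) [leRHS](_ : _ = 2 ^+ M * s ^+ M * w x); last by ring.
  apply: le_trans h.
  by rewrite ler_wpM2r ?w0// lerXn2r// ?nnegrE; lra.
rewrite -(ler_pM2l r2); apply: le_trans Fy _; apply: le_trans Fyx _.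
have -> : F x = 2 ^+ M * (s ^+ M * w x).
  by rewrite /F mulrA -exprMn; congr (_ ^+ _ * _); lra.
have -> : (rho / 2) ^+ M * (4 ^+ M * Q) = 2 ^+ M * (Q * rho ^+ M).
  rewrite mulrA -exprMn [X in X ^+ M](_ : _ = 2 * rho); last by field.
  by rewrite exprMn; ring.
by rewrite ler_wpM2l// exprn_ge0.
Qed.

Lemma pow_small (q c : R) : 0 < q < 1 -> 0 < c -> exists M, (0 < M)%N /\ q ^+ M <= c.
Proof.
move=> /andP[q0 q1] c0; pose x := q^-1 - 1.
have x0 : 0 < x by rewrite subr_gt0 invf_gt1.
pose M := (Num.bound (c^-1 / x)).+1; exists M; split => //.
have h : c^-1 / x < M%:R.
  apply: lt_le_trans (archi_boundP _) _; first by rewrite divr_ge0 ?invr_ge0 ?(ltW c0) ?(ltW x0).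
  by rewrite ler_nat.
have bern k : 1 + k%:R * x <= (1 + x) ^+ k.
  elim: k => [|k IH]; first by rewrite mul0r addr0 expr0.
  rewrite exprS; apply: (@le_trans _ _ ((1 + x) * (1 + k%:R * x))); last first.
    by rewrite ler_wpM2l// addr_ge0// ltW.
  have : 0 <= k%:R * x * x by rewrite !mulr_ge0// ltW.
  by rewrite -natr1; lra.
have qx : 1 + x = q^-1 by rewrite /x; lra.
have := bern M; rewrite qx exprVn => h2.
move: h; rewrite ltr_pdivrMr// => h.
rewrite -lef_pV2 ?posrE ?exprn_gt0//; lra.
Qed.

Lemma geom_find (q a b : R) : 1 < q -> 0 < a < b ->
  exists k, q ^+ k * a < b <= q ^+ k.+1 * a.
Proof.
move=> q1 /andP[a0 ab].
have q0 : 0 < q by lra.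
have b0 : 0 < b by exact: lt_trans ab.
have q01 : 0 < q^-1 < 1 by rewrite invr_gt0 q0 invf_lt1.
have [M [M0 hM]] := pow_small q01 (divr_gt0 a0 b0).
have ex : exists k, b <= q ^+ k * a.
  exists M; have qM : 0 < q ^+ M by rewrite exprn_gt0.
  have : q ^+ M * q^-1 ^+ M <= q ^+ M * (a / b) by rewrite ler_wpM2l// ltW.
  by rewrite -exprMn divff ?gt_eqF// expr1n mulrA ler_pdivlMr// mul1r.
case: (ex_minnP ex) => -[|k] hk hmin.
  by move: hk; rewrite expr0 mul1r leNgt ab.
exists k; rewrite hk andbT ltNge; apply/negP => /hmin.
by rewrite ltnn.
Qed.

Lemma interior_half (T : R) : 1 <= T ->
  exists eta : R, 0 < eta <= 1 / 4 /\ forall D w p (r L : R), 0 < r -> 0 <= L ->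
  (forall x, D x -> nbhs x D) -> (forall x, D x -> {for x, continuous w}) ->
  ecball p r `<=` D -> lap_between D (- L) L w ->
  (forall x, ecball p r x -> `|w x| <= T * w p) -> 0 < w p -> L * r ^+ 2 <= w p ->
  forall x, ecball p (eta * r) x -> w p / 2 <= w x.
Proof.
move=> T1; have [Cl [Cl0 HL]] := lipschitz_interior R n.
have ClT : 0 < 2 * Cl * (T + 1) by rewrite !mulr_gt0//; lra.
pose eta := Num.min (1 / 4) (2 * Cl * (T + 1))^-1.
have eta0 : 0 < eta by rewrite lt_min invr_gt0 ClT andbT; lra.
have eta4 : eta <= 1 / 4 by rewrite /eta ge_min lexx.
have etaC : Cl * eta * (T + 1) <= 1 / 2.
  have : (2 * Cl * (T + 1)) * eta <= (2 * Cl * (T + 1)) * (2 * Cl * (T + 1))^-1.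
    by rewrite ler_wpM2l ?(ltW ClT)// /eta ge_min lexx orbT.
  by rewrite divff ?gt_eqF//; lra.
exists eta; split; first by rewrite eta0.
clearbody eta; move=> D w p r L r0 L0 oD cw pD lw wT wp rw x xp.
have Tw : 0 < T * w p by rewrite mulr_gt0//; lra.
have er : eta * r <= r / 2.
  have : eta * r <= 1 / 4 * r by rewrite ler_wpM2r// ltW.
  by lra.
have := HL D w p r (T * w p) L r0 Tw L0 oD cw pD lw wT x (le_trans xp er).
have h1 : eucl_norm (x - p) / r <= eta by rewrite ler_pdivrMr.
have : Cl * (eucl_norm (x - p) / r) * (T * w p + L * r ^+ 2) <= Cl * eta * ((T + 1) * w p).
  apply: ler_pM.
  - by rewrite mulr_ge0 ?(ltW Cl0)// divr_ge0 ?eucl_norm_ge0 ?(ltW r0).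
  - by rewrite addr_ge0 ?(ltW Tw)// mulr_ge0// sqr_ge0.
  - by rewrite ler_wpM2l// ltW.
  - by rewrite mulrDl mul1r lerD2l.
have : Cl * eta * (T + 1) * w p <= 1 / 2 * w p by rewrite ler_wpM2r// ltW.
by rewrite ler_norml => h3 h4 /andP[]; lra.
Qed.

Lemma spread_iter c0 c1 : spread_const c0 c1 -> 0 < c0 -> 0 < c1 <= 1 / 2 ->
  forall D w y (t L A : R) k, 0 < t -> 0 < A -> 0 <= L ->
  (forall x, D x -> nbhs x D) -> (forall x, D x -> {for x, continuous w}) ->
  lap_between D (- L) L w -> ecball y (4 * (3 ^+ k * t)) `<=` D ->
  (forall x, ecball y (4 * (3 ^+ k * t)) x -> 0 <= w x) ->
  (forall x, ecball y t x -> A <= w x) -> L * (3 ^+ k * t) ^+ 2 <= c0 * (c1 ^+ k * A) ->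
  forall x, ecball y (3 ^+ k.+1 * t) x -> c1 ^+ k.+1 * A <= w x.
Proof.
move=> HS c00 /andP[c10 c11] D w y t L A k t0 A0 L0 oD cw lw.
elim: k => [|k IH] yD w0 wA cL x; rewrite exprS -mulrA => yx; rewrite exprS -mulrA.
  rewrite !expr0 !mul1r in yD w0 cL yx *.
  apply: (HS D w y t A (- L) L t0 A0 oD lw) => //.
  - by move=> z /yD; exact: cw.
  - by move=> z yz nD; exfalso; apply/nD/yD; exact: ltW.
have tk0 : 0 < 3 ^+ k * t by rewrite mulr_gt0// exprn_gt0.
have tS : 3 ^+ k.+1 * t = 3 * (3 ^+ k * t) by rewrite exprS mulrA.
have tS0 : 0 < 3 ^+ k.+1 * t by rewrite tS mulr_gt0.
have tle : 3 ^+ k * t <= 3 ^+ k.+1 * t by rewrite tS; lra.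
have ck0 : 0 < c1 ^+ k * A by rewrite mulr_gt0// exprn_gt0.
have cS : c1 ^+ k.+1 * A = c1 * (c1 ^+ k * A) by rewrite exprS mulrA.
have sub : ecball y (4 * (3 ^+ k * t)) `<=` ecball y (4 * (3 ^+ k.+1 * t)).
  by move=> z /le_trans; apply; rewrite ler_pM2l.
have IH' : forall z, ecball y (3 ^+ k.+1 * t) z -> c1 ^+ k.+1 * A <= w z.
  apply: IH => //; first by move=> z /sub/yD.
    by move=> z /sub/w0.
  apply: (@le_trans _ _ (L * (3 ^+ k.+1 * t) ^+ 2)).
    by rewrite ler_wpM2l//; exact: leXn2 (ltW tk0) tle.
  apply: le_trans cL _; rewrite ler_wpM2l ?(ltW c00)// cS.
  by rewrite ler_piMl ?(ltW ck0)//; lra.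
have cS0 : 0 < c1 ^+ k.+1 * A by rewrite cS mulr_gt0.
apply: (HS D w y _ _ (- L) L tS0 cS0 oD lw _ w0 IH') => //.
- by move=> z /yD; exact: cw.
- by move=> z yz nD; exfalso; apply/nD/yD; exact: ltW.
Qed.

Lemma interior_upper c0 c1 : spread_const c0 c1 -> 0 < c0 -> 0 < c1 <= 1 / 2 ->
  exists C : R, 0 < C /\ forall D w p r L, 0 < r -> 0 <= L ->
  (forall x, D x -> nbhs x D) -> (forall x, D x -> {for x, continuous w}) ->
  ecball p r `<=` D -> lap_between D (- L) L w ->
  (forall x, ecball p r x -> 0 <= w x) ->
  forall y, ecball p (r / 16) y -> w y <= C * (w p + L * r ^+ 2).
Proof.
move=> HS c00 /andP[c10 c11].
have [M [M0 hM]] := @pow_small (3^-1) c1 (ltac:(lra)) c10.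
have M2 : 1 <= 2 ^+ M :> R by rewrite exprn_ege1// ler1n.
have [eta [/andP[eta0 eta4] HL]] := interior_half M2.
pose B := 2 / (c1 * eta ^+ M).
have B0 : 0 < B by rewrite divr_gt0// mulr_gt0// exprn_gt0.
pose C' := 1 + B + B / c0.
have Bc0 : 0 < B / c0 by rewrite divr_gt0.
exists (4 ^+ M * C'); split; first by rewrite mulr_gt0 ?exprn_gt0// /C'; lra.
move=> D w p r L r0 L0 oD cw pD lw w0 y yp.
have Lr : 0 <= L * r ^+ 2 by rewrite mulr_ge0// sqr_ge0.
have wp : 0 <= w p by apply: w0; apply: ecballxx; exact: ltW.
pose rho := r / 8.
have rho0 : 0 < rho by rewrite divr_gt0.
have rr : rho <= r by rewrite /rho; lra.
have subr : ecball p rho `<=` ecball p r.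
  by apply: ecball_sub; rewrite subrr eucl_norm0 add0r.
rewrite -mulrA; apply: (@weighted_max M w p rho) => //.
- by rewrite mulr_ge0// ?addr_ge0// /C'; lra.
- by move=> x /subr/pD; exact: cw.
- by move=> x /subr; exact: w0.
- move=> {yp} {}y s s0 sE wy hS.
  have yr : eucl_norm (y - p) = rho - 2 * s by lra.
  have y0 := eucl_norm_ge0 (y - p).
  have srho : s <= rho by lra.
  have sM : s ^+ M <= rho ^+ M by rewrite lerXn2r// nnegrE ltW.
  have rM0 : 0 < rho ^+ M by rewrite exprn_gt0.
  have ysub t : t <= 7 / 8 * r -> ecball y t `<=` ecball p r.
    by move=> tr; apply: ecball_sub; rewrite yr /rho; lra.
  have key : s ^+ M * w y <= rho ^+ M * (L * s ^+ 2 + B * w p + B / c0 * (L * r ^+ 2)).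
    have [Ls|Ls] := ltP (w y) (L * s ^+ 2).
      apply: ler_pM; rewrite ?exprn_ge0 ?(ltW s0) ?(ltW wy)//.
      have : 0 <= B * w p by rewrite mulr_ge0// ltW.
      have : 0 <= B / c0 * (L * r ^+ 2) by rewrite mulr_ge0// ltW.
      lra.
    have yD : ecball y s `<=` D.
      by move=> z /(ysub s) h; apply: pD; apply: h; move: srho; rewrite /rho; lra.
    have S0 : 0 < 2 ^+ M * w y by rewrite mulr_gt0//; lra.
    have wS z : ecball y s z -> `|w z| <= 2 ^+ M * w y.
      move=> zy; rewrite ger0_norm; first exact: hS.
      by apply: w0; apply: (ysub s) zy; move: srho; rewrite /rho; lra.
    have half := HL D w y s L s0 L0 oD cw yD lw wS wy Ls.
    have es0 : 0 < eta * s < rho.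
      rewrite mulr_gt0//=; have : eta * s <= (1 / 4) * s by rewrite ler_wpM2r// ltW.
      lra.
    have [k /andP[k1 k2]] := geom_find (ltac:(lra) : 1 < 3 :> R) es0.
    pose X := c1 ^+ k.+1 * (w y / 2).
    have X0 : 0 < X by rewrite mulr_gt0 ?exprn_gt0// divr_gt0.
    have hX : s ^+ M * w y <= rho ^+ M * (B * X).
      have h1 : (eta * s) ^+ M <= rho ^+ M * c1 ^+ k.
        apply: (@le_trans _ _ ((rho * 3^-1 ^+ k) ^+ M)).
          have e1 : 0 <= eta * s by rewrite mulr_ge0 ?(ltW eta0) ?(ltW s0).
          have e2 : 0 <= rho * 3^-1 ^+ k by rewrite mulr_ge0 ?(ltW rho0)// exprn_ge0// invr_ge0.
          rewrite lerXn2r//.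
          by rewrite exprVn ler_pdivlMr ?exprn_gt0// mulrC ltW.
        rewrite exprMn ler_wpM2l ?(ltW rM0)// -exprM mulnC exprM lerXn2r//.
        - by rewrite nnegrE exprn_ge0.
        - by rewrite nnegrE ltW.
      have e2 : 0 < c1 * eta ^+ M by rewrite mulr_gt0// exprn_gt0.
      have -> : rho ^+ M * (B * X) = (rho ^+ M * c1 ^+ k) * (w y / eta ^+ M).
        rewrite /B /X exprS; field.
        by rewrite !gt_eqF ?exprn_gt0.
      have -> : s ^+ M * w y = (eta * s) ^+ M * (w y / eta ^+ M).
        by rewrite exprMn; field; rewrite gt_eqF ?exprn_gt0.
      by rewrite ler_wpM2r// divr_ge0 ?exprn_ge0 ?(ltW wy) ?(ltW eta0).
    apply: le_trans hX _; rewrite ler_wpM2l ?(ltW rM0)//.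
    have Ls0 : 0 <= L * s ^+ 2 by rewrite mulr_ge0// sqr_ge0.
    have Bw : 0 <= B * w p by rewrite mulr_ge0// ltW.
    have BL : 0 <= B / c0 * (L * r ^+ 2) by rewrite mulr_ge0// ltW.
    have [LX|LX] := ltP (c0 * X) (L * r ^+ 2).
      have : B / c0 * (c0 * X) <= B / c0 * (L * r ^+ 2) by rewrite ler_wpM2l ?ltW.
      by rewrite mulrA divfK ?gt_eqF//; lra.
    suff : X <= w p.
      by move=> h; have : B * X <= B * w p by [rewrite ler_wpM2l// ltW]; lra.
    have es00 : 0 < eta * s by case/andP: es0.
    have hk : 4 * (3 ^+ k * (eta * s)) <= 7 / 8 * r by clear - n k1 r0; rewrite /rho in k1; lra.
    have tk0 : 0 <= 3 ^+ k * (eta * s) by rewrite mulr_ge0 ?exprn_ge0// ltW.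
    have wy2 : 0 < w y / 2 by rewrite divr_gt0.
    have c101 : 0 < c1 <= 1 / 2 by rewrite c10.
    apply: (spread_iter HS c00 c101 es00 wy2 L0 oD cw lw _ _ half).
    - by move=> x /(ysub _ hk)/pD.
    - by move=> x /(ysub _ hk); exact: w0.
    - apply: (@le_trans _ _ (L * r ^+ 2)).
        by rewrite ler_wpM2l//; apply: leXn2 => //; exact: le_trans (ltW k1) rr.
      apply: le_trans LX _; rewrite ler_wpM2l ?(ltW c00)// /X.
      rewrite ler_wpM2r ?(ltW wy2)//; apply: ler_wiXn2l; rewrite ?(ltW c10)//.
      by apply: le_trans c11 _; clear - n r0; lra.
    - rewrite /ecball/= eucl_normB yr; apply: le_trans k2.
      by rewrite lerBlDr lerDl mulr_ge0// ltW.
  apply: le_trans key _; rewrite mulrC ler_wpM2r ?(ltW rM0)//.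
  have Lsr : L * s ^+ 2 <= L * r ^+ 2.
    by rewrite ler_wpM2l// lerXn2r// ?nnegrE ?(ltW s0) ?(ltW r0)//; lra.
  rewrite /C'.
  have : 0 <= B / c0 * w p by rewrite mulr_ge0// ltW.
  have : 0 <= B * (L * r ^+ 2) by rewrite mulr_ge0// ltW.
  lra.
- by move: yp; rewrite /ecball/= /rho; lra.
Qed.

Lemma interior_harnack c0 c1 : spread_const c0 c1 -> 0 < c0 -> 0 < c1 <= 1 / 2 ->
  exists c : R, 0 < c <= 1 / 16 /\ forall D w p r L, 0 < r -> 0 <= L ->
  (forall x, D x -> nbhs x D) -> (forall x, D x -> {for x, continuous w}) ->
  ecball p r `<=` D -> lap_between D (- L) L w ->
  (forall x, ecball p r x -> 0 <= w x) -> 0 < w p -> L * r ^+ 2 <= w p ->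
  forall y, ecball p (c * r) y -> w p / 2 <= w y.
Proof.
move=> HS c00 c1P; have [C [C0 H]] := interior_upper HS c00 c1P.
have [CL [CL0 HL]] := lipschitz_interior R n.
pose c := (32 * (CL + 1) * (2 * C + 1))^-1.
have den : 32 <= 32 * (CL + 1) * (2 * C + 1).
  have := mulr_gt0 CL0 C0; lra.
have c_0 : 0 < c by rewrite invr_gt0; lra.
have c32 : c <= 1 / 32 by rewrite mul1r lef_pV2// posrE; lra.
exists c; split; first by apply/andP; split; lra.
move=> D w p r L r0 L0 oD cw pD lw w0 wp Lr y yp.
pose s := r / 16.
have s0 : 0 < s by rewrite divr_gt0.
have sub : ecball p s `<=` ecball p r.
  by apply: ecball_sub; rewrite subrr eucl_norm0 /s; lra.
have S0 : 0 < 2 * C * w p by rewrite !mulr_gt0.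
have wS x : ecball p s x -> `|w x| <= 2 * C * w p.
  move=> xp; rewrite ger0_norm; last by apply: w0; exact: sub.
  apply: le_trans (H D w p r L r0 L0 oD cw pD lw w0 x xp) _.
  by have : C * (L * r ^+ 2) <= C * w p by [rewrite ler_wpM2l// ltW]; lra.
have yp' : eucl_norm (y - p) <= s / 2.
  apply: le_trans yp _; have : c * r <= 1 / 32 * r by rewrite ler_wpM2r// ltW.
  by rewrite /s; lra.
have := HL D w p s _ L s0 S0 L0 oD cw (fun x h => pD x (sub x h)) lw wS y yp'.
have q : eucl_norm (y - p) / s <= 16 * c.
  by rewrite ler_pdivrMr// /s; move: yp; rewrite /ecball/=; lra.
have h1 : CL * (eucl_norm (y - p) / s) * (2 * C * w p + L * s ^+ 2) <=
    CL * (16 * c) * ((2 * C + 1) * w p).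
  apply: ler_pM.
  - by rewrite mulr_ge0 ?(ltW CL0)// divr_ge0 ?eucl_norm_ge0// ltW.
  - by rewrite addr_ge0 ?(ltW S0)// mulr_ge0// sqr_ge0.
  - by rewrite ler_wpM2l// ltW.
  - rewrite [leRHS](_ : _ = 2 * C * w p + w p); last by ring.
    rewrite lerD2l; apply: le_trans Lr.
    by rewrite ler_wpM2l// lerXn2r// ?nnegrE ?(ltW s0) ?(ltW r0)// /s; lra.
have h2 : CL * (16 * c) * ((2 * C + 1) * w p) <= 1 / 2 * w p.
  rewrite mulrA ler_wpM2r ?(ltW wp)//.
  have -> : CL * (16 * c) * (2 * C + 1) = (CL * 16 * (2 * C + 1)) * c by ring.
  rewrite ler_pdivrMr; last by lra.
  by have := mulr_gt0 CL0 C0; lra.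
rewrite ler_norml => /andP[h3 _]; lra.
Qed.

End interior.

(** * Chains and decay in the domain above a graph *)

Section graph_domain.
Variables (R : realType) (n : nat) (L : R).
Hypotheses (L0 : 0 <= L) (L1 : L <= 1).
Implicit Types (g : 'rV[R]_n -> R) (x y z p : 'rV[R]_n.+1) (w : 'rV[R]_n.+1 -> R)
  (s A S r t c d : R) (j k : nat).
Local Notation en := (e_last R n).

Definition height g x := xlast x - g (xprime x).

Lemma height_shift g x t : height g (x + t *: en) = height g x + t.
Proof. by rewrite /height xlast_shift xprime_shift; ring. Qed.

Lemma height_lip g x y : lipschitz_graph L g ->
  `|height g x - height g y| <= 2 * eucl_norm (x - y).
Proof.
move=> [hg _]; rewrite /height.
have h1 : `|g (xprime x) - g (xprime y)| <= eucl_norm (x - y).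
  apply: le_trans (hg _ _) _; rewrite -xprimeB.
  apply: le_trans (_ : 1 * eucl_norm (xprime (x - y)) <= _).
    by rewrite ler_wpM2r// eucl_norm_ge0.
  by rewrite mul1r eucl_norm_prime.
have h2 := xlast_le_eucl (x - y); rewrite xlastB in h2.
rewrite (_ : _ - _ = (xlast x - xlast y) - (g (xprime x) - g (xprime y))); last by ring.
apply: le_trans (ler_normB _ _) _; lra.
Qed.

Lemma height_ge g x y : lipschitz_graph L g ->
  height g y - 2 * eucl_norm (x - y) <= height g x.
Proof. by move=> hg; have := height_lip x y hg; rewrite ler_norml => /andP[]; lra. Qed.

Lemma height_le g x y : lipschitz_graph L g ->
  height g x <= height g y + 2 * eucl_norm (x - y).
Proof. by move=> hg; have := height_lip x y hg; rewrite ler_norml => /andP[]; lra. Qed.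

Lemma OmegaP g r x : Omega g r x <-> eucl_norm x < r /\ 0 < height g x.
Proof. by rewrite /Omega/= /eucl_ball/= /height subr_gt0. Qed.

Lemma Omega_open g r x : lipschitz_graph L g -> Omega g r x -> nbhs x (Omega g r).
Proof.
move=> hg /OmegaP[xr hx].
pose s := Num.min (r - eucl_norm x) (height g x / 2).
have s0 : 0 < s by rewrite lt_min subr_gt0 xr divr_gt0.
have H : nbhs x [set y | eucl_norm (y - x) < s].
  apply: nbhs_lt; first exact: cont_eucl_dist.
  by rewrite subrr eucl_norm0.
apply: filterS H => y /=; rewrite lt_min => /andP[y1 y2]; apply/OmegaP; split.
  have := eucl_norm_triangle (y - x) x; rewrite subrK; lra.
by have := height_ge y x hg; lra.
Qed.

Definition solves g (c c' : R) w :=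
  [/\ forall x, eucl_norm x < 2 -> {for x, continuous w},
      forall x, eucl_norm x < 2 -> height g x <= 0 -> w x = 0 &
      lap_between (Omega g 2) c c' w].

Lemma solvesD g a1 a2 b1 b2 u w : solves g a1 a2 u -> solves g b1 b2 w ->
  solves g (a1 + b1) (a2 + b2) (fun x => u x + w x).
Proof.
move=> [u1 u2 u3] [w1 w2 w3]; split.
- by move=> x x2; apply: (@contD R 'rV[R]_n.+1); [exact: u1|exact: w1].
- by move=> x x2 hx; rewrite u2// w2// addr0.
- exact: lap_betweenD.
Qed.

Lemma solvesZ g a1 a2 a u : 0 <= a -> solves g a1 a2 u ->
  solves g (a * a1) (a * a2) (fun x => a * u x).
Proof.
move=> a0 [u1 u2 u3]; split.
- by move=> x x2; apply: contZ; exact: u1.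
- by move=> x x2 hx; rewrite u2// mulr0.
- exact: lap_betweenZ.
Qed.

Lemma solvesN g a1 a2 u : solves g a1 a2 u -> solves g (- a2) (- a1) (fun x => - u x).
Proof.
move=> [u1 u2 u3]; split.
- by move=> x x2; apply: (@contN R 'rV[R]_n.+1); exact: u1.
- by move=> x x2 hx; rewrite u2// oppr0.
- exact: lap_betweenN.
Qed.

Lemma solves_le g a1 a2 b1 b2 u : b1 <= a1 -> a2 <= b2 ->
  solves g a1 a2 u -> solves g b1 b2 u.
Proof. by move=> h1 h2 [u1 u2 u3]; split => //; exact: lap_between_le u3. Qed.

Section spreading.
Variables (c0 c1 : R).
Hypotheses (HS : @spread_const R n.+1 c0 c1) (c00 : 0 < c0) (c10 : 0 < c1)
  (c11 : c1 <= 1 / 2).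

Let c1le1 : c1 <= 1. Proof. by have := c11; lra. Qed.

Lemma spread_graph g w c c' p s A : lipschitz_graph L g -> solves g c' c w ->
  0 < s -> 0 < A -> eucl_norm p + 4 * s < 2 -> 8 * s <= height g p ->
  (forall x, ecball p (4 * s) x -> 0 <= w x) ->
  (forall x, ecball p s x -> A <= w x) -> c * s ^+ 2 <= c0 * A ->
  forall x, ecball p (3 * s) x -> c1 * A <= w x.
Proof.
move=> hg [cw w0 lw] s0 A0 ps hp wge wA cs.
have in2 x : ecball p (4 * s) x -> eucl_norm x < 2.
  by rewrite /ecball/= => h; have := eucl_norm_triangle (x - p) p; rewrite subrK; lra.
apply: (HS s0 A0 (fun x => @Omega_open g 2 x hg) lw) => //.
- by move=> x /in2; exact: cw.
- move=> x xp nD; exfalso; apply: nD; apply/OmegaP; split.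
    by apply: in2; exact: ltW.
  by have := height_ge x p hg; lra.
Qed.

Lemma chain g w c c' (p : nat -> 'rV[R]_n.+1) k s A : lipschitz_graph L g ->
  solves g c' c w -> 0 < s -> 0 < A -> 0 <= c ->
  (forall j, (j <= k)%N -> [/\ eucl_norm (p j) + 4 * s < 2, 8 * s <= height g (p j) &
     forall x, ecball (p j) (4 * s) x -> 0 <= w x]) ->
  (forall j, (j < k)%N -> eucl_norm (p j.+1 - p j) <= 2 * s) ->
  (forall x, ecball (p 0%N) s x -> A <= w x) -> c * s ^+ 2 <= c0 * (c1 ^+ k * A) ->
  forall x, ecball (p k) s x -> c1 ^+ k * A <= w x.
Proof.
move=> hg sw s0 A0 cge0 hp hstep wA.
elim: k hp hstep => [|k IH] hp hstep cs x xp.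
  by rewrite expr0 mul1r; exact: wA.
have [p1 p2 p3] := hp k (leqnSn k).
have cs' : c * s ^+ 2 <= c0 * (c1 ^+ k * A).
  apply: le_trans cs _; rewrite ler_wpM2l ?(ltW c00)// ler_wpM2r ?(ltW A0)//.
  by apply: ler_wiXn2l; rewrite ?(ltW c10) ?leqnSn ?c1le1.
have hk y : ecball (p k) s y -> c1 ^+ k * A <= w y.
  apply: IH => //; first by move=> j jk; apply: hp; exact: leqW.
  by move=> j jk; apply: hstep; exact: leqW.
rewrite exprS -mulrA; apply: (spread_graph hg sw s0 _ p1 p2 p3 hk cs').
  by rewrite mulr_gt0 ?exprn_gt0.
apply: ecball_sub xp; have := hstep k (ltnSn k); lra.
Qed.

Lemma segment g w c c' p q k s A : lipschitz_graph L g ->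
  solves g c' c w -> 0 < s -> 0 < A -> 0 <= c ->
  (forall t, 0 <= t <= 1 -> [/\ eucl_norm (p + t *: (q - p)) + 4 * s < 2,
     8 * s <= height g (p + t *: (q - p)) &
     forall x, ecball (p + t *: (q - p)) (4 * s) x -> 0 <= w x]) ->
  eucl_norm (q - p) <= k%:R * (2 * s) ->
  (forall x, ecball p s x -> A <= w x) -> c * s ^+ 2 <= c0 * (c1 ^+ k.+1 * A) ->
  forall x, ecball q s x -> c1 ^+ k.+1 * A <= w x.
Proof.
move=> hg sw s0 A0 cge0 hp hk wA cs.
have k0 : 0 < k.+1%:R :> R by rewrite ltr0n.
pose P (j : nat) := p + (j%:R / k.+1%:R) *: (q - p).
have Pk : P k.+1 = q by rewrite /P divff ?gt_eqF// scale1r addrC subrK.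
have P0 : P 0%N = p by rewrite /P mul0r scale0r addr0.
rewrite -{1}Pk; apply: (chain hg sw s0 A0 cge0) => //.
- move=> j jk; apply: hp; rewrite divr_ge0//= ler_pdivrMr// mul1r ler_nat.
  exact: jk.
- move=> j jk; have -> : P j.+1 - P j = (k.+1%:R)^-1 *: (q - p).
    by apply/rowP => i; rewrite /P !mxE -[j.+1%:R]natr1; ring.
  rewrite eucl_normZ ger0_norm ?invr_ge0// ler_pdivrMl//; apply: le_trans hk _.
  by rewrite ler_wpM2r ?mulr_ge0 ?(ltW s0)// ler_nat.
- by rewrite P0.
Qed.

Lemma climb g w c' p s A k : lipschitz_graph L g -> solves g c' 0 w ->
  (forall x, eucl_norm x < 2 -> 0 <= w x) ->
  0 < s -> 0 < A -> 8 * s <= height g p ->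
  let sk j := (17 / 16) ^+ j * s in let pk j := p + (8 * (sk j - s)) *: en in
  eucl_norm p + 12 * sk k < 2 ->
  (forall x, ecball p s x -> A <= w x) ->
  forall x, ecball (pk k) (sk k) x -> c1 ^+ k * A <= w x.
Proof.
move=> hg sw w0 s0 A0 hp sk pk; have [cw _ _] := sw.
elim: k => [|k IH] pk2 wA x.
  by rewrite /pk /sk !expr0 !mul1r subrr mulr0 scale0r addr0; exact: wA.
have sS j : sk j.+1 = 17 / 16 * sk j by rewrite /sk exprS mulrA.
have sk0 j : 0 < sk j by rewrite mulr_gt0// exprn_gt0.
have ssk j : s <= sk j.
  by rewrite /sk ler_peMl ?(ltW s0)// exprn_ege1//; lra.
have kk := sk0 k; have kks := ssk k.
have pk2' : eucl_norm p + 12 * sk k < 2 by move: pk2; rewrite sS; lra.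
have npk : eucl_norm (pk k) <= eucl_norm p + 8 * (sk k - s).
  apply: le_trans (eucl_norm_triangle _ _) _.
  by rewrite eucl_norm_te ger0_norm//; lra.
have h1 : eucl_norm (pk k) + 4 * sk k < 2 by lra.
have h2 : 8 * sk k <= height g (pk k) by rewrite height_shift; lra.
have h3 y : ecball (pk k) (4 * sk k) y -> 0 <= w y.
  rewrite /ecball/= => yk; apply: w0.
  by have := eucl_norm_triangle (y - pk k) (pk k); rewrite subrK; lra.
move=> xp; rewrite exprS -mulrA.
apply: (spread_graph hg sw kk _ h1 h2 h3 (IH pk2' wA)).
- by rewrite mulr_gt0 ?exprn_gt0.
- by rewrite mul0r !mulr_ge0 ?exprn_ge0 ?(ltW c00) ?(ltW c10) ?(ltW A0).
- apply: ecball_sub xp; rewrite /pk.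
  have -> : p + (8 * (sk k.+1 - s)) *: en - (p + (8 * (sk k - s)) *: en) =
     (8 * (sk k.+1 - sk k)) *: en.
    by rewrite opprD addrACA subrr add0r -scaleNr -scalerDl; congr (_ *: _); ring.
  rewrite eucl_norm_te sS ger0_norm; lra.
Qed.

(* One application of [spread] to [w + S], centred below the graph where [w = 0]. *)
Lemma decay_step g w c' c y s S : lipschitz_graph L g -> solves g c' c w ->
  0 < s -> 0 < S -> eucl_norm y + 7 * s < 2 -> height g y <= s ->
  (forall x, ecball y (7 * s) x -> - S <= w x) -> c * s ^+ 2 <= c0 * S ->
  - ((1 - c1) * S) <= w y.
Proof.
move=> hg [cw w0 lw] s0 S0 y2 hy wS cs.
pose p := y + (- (3 * s)) *: en.
have yp : eucl_norm (p - y) = 3 * s by rewrite eucl_norm_shift normrN ger0_norm//; lra.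
have hp : height g p <= - (2 * s) by rewrite height_shift; lra.
have suby : ecball p (4 * s) `<=` ecball y (7 * s) by apply: ecball_sub; lra.
have in2 x : ecball p (4 * s) x -> eucl_norm x < 2.
  move=> /suby; rewrite /ecball/= => h.
  by have := eucl_norm_triangle (x - y) y; rewrite subrK; lra.
have lw' : lap_between (Omega g 2) c' c (fun x => w x + S).
  have := lap_betweenD lw (@lap_between_cst R _ (Omega g 2) S).
  by rewrite !addr0.
have := HS s0 S0 (fun x => @Omega_open g 2 x hg) lw' (p := p).
move=> /(_ _ _ _ _ cs y) H; suff : c1 * S <= w y + S by lra.
apply: H.
- move=> x /in2 x2; apply: (@contD R 'rV[R]_n.+1); last exact: cst_continuous.
  exact: cw.
- by move=> x /suby/wS; lra.
- move=> x xp; have x2 : eucl_norm x < 2.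
    by apply: in2; move: xp; rewrite /ecball/=; lra.
  rewrite w0 ?add0r//; have := height_le x p hg; move: xp; rewrite /ecball/=; lra.
- move=> x xp nD; have x2 : eucl_norm x < 2 by apply: in2; exact: ltW.
  rewrite w0 ?add0r// leNgt; apply/negP => hx; apply: nD; exact/OmegaP.
- by rewrite /ecball/= eucl_normB yp.
Qed.

Lemma decay g w c' c y r S j : lipschitz_graph L g -> solves g c' c w -> 0 <= c ->
  0 < r -> 0 < S -> eucl_norm y + r < 2 -> height g y <= 32^-1 ^+ j * r ->
  (forall x, ecball y r x -> - S <= w x) -> c * r ^+ 2 <= c0 * ((1 - c1) ^+ j * S) ->
  - ((1 - c1) ^+ j * S) <= w y.
Proof.
move=> hg sw cge0; have d0 : 0 < 1 - c1 by have := c11; lra.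
have d1 : 1 - c1 <= 1 by have := c10; lra.
elim: j y r S => [|j IH] y r S r0 S0 y2 hy wS cs.
  by rewrite expr0 mul1r; apply: wS; apply: ecballxx; exact: ltW.
have r32 : 0 < r / 32 by rewrite divr_gt0.
have r8 : 0 < r / 8 by rewrite divr_gt0.
have S'0 : 0 < (1 - c1) * S by rewrite mulr_gt0.
have hj : 32^-1 ^+ j.+1 * r = 32^-1 ^+ j * (r / 32) by rewrite exprS; ring.
have hj1 : 32^-1 ^+ j * (r / 32) <= r / 32.
  by rewrite ler_piMl ?(ltW r32)// exprn_ile1//; lra.
have dS : (1 - c1) ^+ j.+1 * S = (1 - c1) ^+ j * ((1 - c1) * S) by rewrite exprSr mulrA.
rewrite dS; apply: (IH y (r / 32)) => //.
- lra.
- by rewrite -hj.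
- move=> x xy; apply: (decay_step hg sw r8 S0).
  + have := eucl_norm_triangle (x - y) y; rewrite subrK; move: xy; rewrite /ecball/=; lra.
  + have := height_le x y hg; move: xy; rewrite /ecball/=; lra.
  + move=> z zx; apply: wS; apply: ecball_sub zx; move: xy; rewrite /ecball/=; lra.
  + apply: (@le_trans _ _ (c * r ^+ 2)).
      by rewrite ler_wpM2l// lerXn2r// ?nnegrE; lra.
    apply: le_trans cs _; rewrite ler_wpM2l ?(ltW c00)// ler_piMl ?(ltW S0)//.
    by rewrite exprn_ile1//; lra.
- apply: (@le_trans _ _ (c * r ^+ 2)).
    by rewrite ler_wpM2l// lerXn2r// ?nnegrE; lra.
  by rewrite -dS.
Qed.

End spreading.
End graph_domain.

(** * Lower bounds near the boundary *)

Section boundary.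
Variables (R : realType) (n : nat).
Implicit Types (g : 'rV[R]_n -> R) (x y z p : 'rV[R]_n.+1) (w : 'rV[R]_n.+1 -> R)
  (s A S r t c d K : R) (j k : nat).
Local Notation en := (e_last R n).

Definition foot g y := y + (- height g y) *: en.

Lemma height_foot g y : height g (foot g y) = 0.
Proof. by rewrite height_shift subrr. Qed.

Lemma footK g y : foot g y + height g y *: en = y.
Proof. by rewrite /foot -addrA -scalerDl addNr scale0r addr0. Qed.

Lemma eucl_norm_foot g y : eucl_norm (foot g y - y) = `|height g y|.
Proof. by rewrite eucl_norm_shift normrN. Qed.

Definition cone_const (m eta e0 : R) := forall D w p r c' c, 0 < r ->
  (forall x, D x -> nbhs x D) -> lap_between D c' c w ->
  {within ecball p r, continuous w} -> (forall x, ecball p r x -> 0 <= w x) ->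
  (forall x, eucl_norm (x - p) < r -> 0 < xlast x - xlast p -> 0 < quad m p x -> D x) ->
  (forall x, eucl_norm (x - p) = r -> 0 <= xlast x - xlast p -> 0 <= quad m p x ->
     1 <= w x) ->
  c * r ^+ 2 <= e0 ->
  forall k t, 0 <= t <= r / 2 ^+ k ->
    (1 + eta) ^+ k * (t / r) ^+ 2 <= w (p + t *: en).

Definition aperture (L m : R) := (m - L) / (1 + m).

Lemma sqr_lt (a b : R) : 0 <= a -> 0 < b -> a ^+ 2 < b ^+ 2 -> a < b.
Proof. by move=> a0 b0; rewrite ltr_pXn2r// nnegrE ltW. Qed.

Lemma sqr_le (a b : R) : 0 <= a -> 0 <= b -> a ^+ 2 <= b ^+ 2 -> a <= b.
Proof. by move=> a0 b0; rewrite ler_pXn2r. Qed.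

Lemma cone_at (L m eta e0 : R) g w c' c p r A K :
  cone_const m eta e0 -> 0 < e0 -> 0 <= L < m -> L <= 1 ->
  lipschitz_graph L g -> solves g c' c w -> 0 <= c -> 0 < r -> 0 < A -> 0 <= K ->
  height g p = 0 -> eucl_norm p + r < 2 ->
  (forall x, ecball p r x -> - A <= w x) ->
  (forall x, ecball p r x -> aperture L m * r <= height g x -> K * A <= w x) ->
  c * r ^+ 2 <= e0 * A -> forall k t, 0 <= t <= r / 2 ^+ k ->
    (K + 1) * A * ((1 + eta) ^+ k * (t / r) ^+ 2) - A <= w (p + t *: en).
Proof.
move=> HC e00 /andP[L0 Lm] L1 hg [cw w0 lw] cge0 r0 A0 K0 hp p2 wA wK cr k t tk.
have m0 : 0 < m by exact: le_lt_trans Lm.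
have KA : 0 < (K + 1) * A by rewrite mulr_gt0//; lra.
pose a := ((K + 1) * A)^-1.
have a0 : 0 < a by rewrite invr_gt0.
pose W x := a * (w x + A).
have in2 x : ecball p r x -> eucl_norm x < 2.
  by rewrite /ecball/= => h; have := eucl_norm_triangle (x - p) p; rewrite subrK; lra.
have hx x : height g x = xlast x - xlast p - (g (xprime x) - g (xprime p)).
  by move: hp; rewrite /height; lra.
have gL x : g (xprime x) - g (xprime p) <= L * eucl_norm (xprime x - xprime p).
  by apply: le_trans (ler_norm _) _; case: hg.
have lW : lap_between (Omega g 2) (a * (c' + 0)) (a * (c + 0)) W.
  by apply: lap_betweenZ; [exact: ltW|apply: lap_betweenD => //; exact: lap_between_cst].
have H := HC (Omega g 2) W p r _ _ r0 (fun x => @Omega_open R n L L1 g 2 x hg) lW.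
rewrite -(ler_pM2l a0).
have -> : a * ((K + 1) * A * ((1 + eta) ^+ k * (t / r) ^+ 2) - A) =
    (1 + eta) ^+ k * (t / r) ^+ 2 - a * A.
  have aE : a * ((K + 1) * A) = 1 by rewrite /a mulVf// gt_eqF.
  by rewrite mulrBr [a * ((K + 1) * A * _)]mulrA aE mul1r.
suff : (1 + eta) ^+ k * (t / r) ^+ 2 <= W (p + t *: en) by rewrite /W mulrDr; lra.
apply: H => //.
- apply: continuous_in_subspaceT => x /set_mem /in2 x2; apply: contZ.
  apply: (@contD R 'rV[R]_n.+1); last exact: cst_continuous.
  exact: cw.
- by move=> x /wA h; rewrite mulr_ge0 ?(ltW a0)//; lra.
- move=> x xp l0 q0; apply/OmegaP; split; first by apply: in2; exact: ltW.
  have E0 := eucl_norm_ge0 (xprime x - xprime p).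
  have : m * eucl_norm (xprime x - xprime p) < xlast x - xlast p.
    apply: sqr_lt => //; first by rewrite mulr_ge0// ltW.
    by move: q0; rewrite quadE subr_gt0 exprMn.
  have : L * eucl_norm (xprime x - xprime p) <= m * eucl_norm (xprime x - xprime p).
    by rewrite ler_wpM2r// ltW.
  have := gL x; rewrite hx; lra.
- move=> x xp l0 q0.
  have E0 := eucl_norm_ge0 (xprime x - xprime p).
  set e := eucl_norm (xprime x - xprime p) in E0.
  set l := xlast x - xlast p in l0.
  have me : m * e <= l.
    apply: sqr_le => //; first by rewrite mulr_ge0// ltW.
    by move: q0; rewrite quadE subr_ge0 exprMn.
  have rel : r <= e + l.
    apply: sqr_le; [exact: ltW|exact: addr_ge0|].
    rewrite -xp eucl_norm_split xprimeB xlastB -/e -/l.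
    by have := mulr_ge0 E0 l0; nra.
  have : aperture L m * r <= height g x.
    rewrite /aperture mulrAC ler_pdivrMr; last by lra.
    apply: (@le_trans _ _ ((l - L * e) * (1 + m))); last first.
      rewrite ler_wpM2r//; [lra|]; rewrite hx -/l; have := gL x; rewrite -/e; lra.
    apply: (@le_trans _ _ ((m - L) * (e + l))).
      by rewrite ler_wpM2l//; lra.
    have : 0 <= (1 + L) * (l - m * e) by rewrite mulr_ge0//; lra.
    lra.
  move=> /(wK x (_ : ecball p r x)) h; rewrite /W ler_pdivlMl// mulr1 mulrDl mul1r.
  by rewrite lerD2r; apply: h; rewrite /ecball/= xp.
- apply: (@le_trans _ _ (a * (e0 * A))).
    by rewrite addr0 -mulrA ler_wpM2l// ltW.
  rewrite ler_pdivrMl//.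
  by have : 0 <= K * A * e0 by [rewrite !mulr_ge0// ltW]; lra.
Qed.

Lemma step_high (r A rho k1 eta K h wx : R) k2 : 0 < r -> 0 < A -> 0 < rho -> 0 < k1 ->
  0 < eta -> (rho ^+ 2)^-1 <= K -> 3 <= (1 + eta) ^+ k2 * k1 ^+ 2 -> 2 * rho = (2 ^+ k2)^-1 ->
  k1 / 4 * rho * r <= h <= r / 4 ->
  (forall k, h <= r / 4 / 2 ^+ k ->
     (K + 1) * A * ((1 + eta) ^+ k * (h / (r / 4)) ^+ 2) - A <= wx) ->
  K * (2 * rho ^+ 2) * A <= wx.
Proof.
move=> r0 A0 rho0 k10 eta0 K1 hk2 rho2 /andP[hx h4] cone.
have r2 : 0 < rho ^+ 2 by rewrite exprn_gt0.
have K0 : 0 < K by apply: lt_le_trans K1; rewrite invr_gt0.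
have r40 : 0 < r / 4 by rewrite divr_gt0.
have h0 : 0 <= h by apply: le_trans hx; rewrite !mulr_ge0// ltW// divr_gt0.
have kr : k1 * rho <= h / (r / 4) by rewrite ler_pdivlMr//; lra.
suff : 3 * rho ^+ 2 * ((K + 1) * A) - A <= wx.
  apply: le_trans.
  have h1 : 1 <= K * rho ^+ 2 by rewrite -ler_pdivrMr// mul1r.
  have : 1 * A <= (K * rho ^+ 2) * A by rewrite ler_wpM2r// ltW.
  have : 0 <= rho ^+ 2 * A by rewrite mulr_ge0// ltW.
  by lra.
have KA : 0 <= (K + 1) * A by rewrite mulr_ge0//; lra.
have [ht|ht] := leP h (r / 4 / 2 ^+ k2).
  apply: le_trans (cone k2 ht).
  rewrite lerD2r [leLHS]mulrC ler_wpM2l//.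
  apply: (@le_trans _ _ ((1 + eta) ^+ k2 * (k1 * rho) ^+ 2)).
    by rewrite exprMn [leRHS]mulrA ler_wpM2r// ltW.
  rewrite ler_wpM2l ?exprn_ge0//; first by lra.
  by rewrite lerXn2r// nnegrE; [exact: mulr_ge0 (ltW k10) (ltW rho0)|rewrite divr_ge0// ltW].
apply: le_trans (cone 0%N _); last by rewrite expr0 divr1.
rewrite lerD2r expr0 mul1r [leLHS]mulrC ler_wpM2l//.
apply: (@le_trans _ _ ((2 * rho) ^+ 2)).
  by rewrite exprMn ler_wpM2r ?(ltW r2)// -natrX ler_nat.
have h2 : 2 * rho <= h / (r / 4).
  by rewrite ler_pdivlMr//; apply: le_trans (ltW ht); rewrite rho2 mulrC.
by rewrite lerXn2r// nnegrE; [rewrite mulr_ge0// ltW|rewrite divr_ge0// ltW].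
Qed.

Lemma step_low (r A T K h wx : R) : 0 < r -> 0 < A -> 1 <= T -> T ^+ 2 <= K ->
  T^-1 * (r / 2) <= h -> (K + 1) * A * (h / (r / 4)) ^+ 2 - A <= wx -> 0 <= wx.
Proof.
move=> r0 A0 T1 K2 hT; apply: le_trans.
rewrite subr_ge0 mulrAC ler_peMl ?(ltW A0)//.
have T0 : 0 < T by lra.
have TT : T^-1 <= h / (r / 4).
  rewrite ler_pdivlMr ?divr_gt0//; apply: le_trans hT.
  by rewrite ler_wpM2l ?invr_ge0; lra.
have hT2 : T^-1 ^+ 2 <= (h / (r / 4)) ^+ 2.
  by rewrite lerXn2r// nnegrE ?invr_ge0 ?(ltW T0)//; apply: le_trans TT; rewrite invr_ge0 ltW.
apply: (@le_trans _ _ (T ^+ 2 * T^-1 ^+ 2)).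
  by rewrite -exprMn divff ?gt_eqF// expr1n.
by apply: ler_pM => //; rewrite ?exprn_ge0 ?invr_ge0 ?(ltW T0)//; lra.
Qed.

Definition step_const (L rho delta K eps : R) := forall g w c' c z r A,
  lipschitz_graph L g -> solves g c' c w -> 0 <= c -> 0 < r -> 0 < A ->
  height g z = 0 -> eucl_norm z + r < 2 ->
  (forall x, ecball z r x -> - A <= w x) ->
  (forall x, ecball z r x -> delta * r <= height g x -> K * A <= w x) ->
  c * r ^+ 2 <= eps * A ->
  (forall x, ecball z (r / 2) x -> delta * rho * r <= height g x ->
     K * (2 * rho ^+ 2 * A) <= w x) /\
  (forall x, ecball z (rho * r) x -> - (2 * rho ^+ 2 * A) <= w x).

(* The factor [2 rho^2 > rho^2] per scale [rho] encodes growth of order less than two: this is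
   where the subquadratic cone barrier is used. *)
Lemma step_const_exists (L m c0 c1 : R) : n%:R * m ^+ 2 < 1 -> 0 <= L < m -> m <= 1 ->
  @spread_const R n.+1 c0 c1 -> 0 < c0 -> 0 < c1 <= 1 / 2 ->
  exists rho delta K eps : R, [/\ 0 < rho <= 1 / 256, 0 < delta <= 1 / 4, 0 < K, 0 < eps &
    step_const L rho delta K eps].
Proof.
move=> nm /andP[L0 Lm] m1 HS c00 /andP[c10 c11].
have L1 : L <= 1 by lra.
have m0 : 0 < m by exact: le_lt_trans Lm.
have [eta [e0 [eta0 e00 HC]]] := cone_growth nm.
pose k1 := aperture L m.
have k10 : 0 < k1 by rewrite divr_gt0//; lra.
have k11 : k1 <= 1 by rewrite ler_pdivrMr; lra.
pose delta := k1 / 4.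
have ie : 0 < (1 + eta)^-1 < 1 by rewrite invr_gt0 invf_lt1; lra.
have k13 : 0 < k1 ^+ 2 / 3 by rewrite divr_gt0// exprn_gt0.
have [k0 [_ hk0]] := pow_small ie k13.
have hk : 3 <= (1 + eta) ^+ k0 * k1 ^+ 2.
  move: hk0; rewrite exprVn -[X in _ <= X]invrK lef_pV2 ?posrE ?invr_gt0 ?exprn_gt0//; last lra.
  rewrite invf_div ler_pdivrMr ?exprn_gt0//.
pose k2 := (k0 + 8)%N.
have hk2 : 3 <= (1 + eta) ^+ k2 * k1 ^+ 2.
  apply: le_trans hk _; rewrite ler_wpM2r ?sqr_ge0// ler_weXn2l ?leq_addr//; lra.
pose rho : R := 2^-1 ^+ k2.+1.
have rho0 : 0 < rho by rewrite exprn_gt0// invr_gt0.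
have rho2 : 2 * rho = (2 ^+ k2)^-1 by rewrite /rho exprS mulrA divff// mul1r exprVn.
have rho256 : rho <= 1 / 256.
  have -> : 1 / 256 = 2^-1 ^+ 8 :> R by rewrite !exprS expr0; field.
  apply: ler_wiXn2l; [by rewrite invr_ge0|by lra|exact: leqW (leq_addl k0 8)].
clear hk hk0; clearbody rho k2.
pose a := 2 * rho ^+ 2.
have a0 : 0 < a by rewrite mulr_gt0// exprn_gt0.
have d01 : 0 < 1 - c1 < 1 by apply/andP; split; lra.
have [j [_ hj]] := pow_small d01 a0.
pose T : R := 32 ^+ j.
have T1 : 1 <= T by rewrite exprn_ege1//; lra.
have TE : 32^-1 ^+ j = T^-1 by rewrite exprVn.
clearbody T.
pose K := (rho ^+ 2)^-1 + T ^+ 2.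
have K1 : (rho ^+ 2)^-1 <= K by rewrite lerDl sqr_ge0.
have K2 : T ^+ 2 <= K by rewrite lerDr invr_ge0 sqr_ge0.
have r2 : 0 < rho ^+ 2 by rewrite exprn_gt0.
have K0 : 0 < K by rewrite ltr_wpDr ?sqr_ge0// invr_gt0.
pose eps := Num.min e0 (c0 * (1 - c1) ^+ j).
have dj0 : 0 < (1 - c1) ^+ j by rewrite exprn_gt0//; case/andP: d01.
have eps0 : 0 < eps by rewrite lt_min e00 mulr_gt0.
have eps1 : eps <= e0 by rewrite /eps ge_min lexx.
have eps2 : eps <= c0 * (1 - c1) ^+ j by rewrite /eps ge_min lexx orbT.
have delta4 : 0 < delta <= 1 / 4 by rewrite /delta; apply/andP; split; lra.
exists rho, delta, K, eps; split => //; first by rewrite rho0.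
have kE : aperture L m = k1 by [].
clear ie k13; clearbody K eps k1.
move=> g w c' c z r A hg sw cge0 r0 A0 hz z2 wA wK cr.
have cr2 : 0 <= c * r ^+ 2 by rewrite mulr_ge0// sqr_ge0.
have cA1 : c * r ^+ 2 <= e0 * A.
  by apply: le_trans cr _; rewrite ler_wpM2r ?(ltW A0).
have cA2 : c * r ^+ 2 <= c0 * (1 - c1) ^+ j * A.
  by apply: le_trans cr _; rewrite ler_wpM2r ?(ltW A0).
have r40 : 0 < r / 4 by rewrite divr_gt0.
have r4r : r / 4 <= r by clear - r0; lra.
have r2r : r / 2 <= r by clear - r0; lra.
have csq a' b : 0 <= a' -> a' <= b -> c * a' ^+ 2 <= c * b ^+ 2.
  move=> a'0 ab; rewrite ler_wpM2l// lerXn2r// nnegrE.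
  exact: le_trans ab.
have k1r : k1 * r <= r by rewrite ler_piMl// ltW.
have a1 : a <= 1.
  have : rho * rho <= 1 * (1 / 256).
    by apply: ler_pM => //; rewrite ?(ltW rho0)//; apply: (le_trans rho256); clear; lra.
  by rewrite /a expr2; clear; lra.
(* the cone barrier with vertex at the foot of [x] *)
have cone x k : ecball z (r / 2) x -> 0 <= height g x <= r / 4 / 2 ^+ k ->
    height g x <= r / 4 ->
    (K + 1) * A * ((1 + eta) ^+ k * (height g x / (r / 4)) ^+ 2) - A <= w x.
  move=> xz hx hx4; pose p := foot g x.
  have pz : eucl_norm (p - z) <= 3 / 4 * r.
    apply: le_trans (eucl_norm_dist p x z) _.
    rewrite eucl_norm_foot ger0_norm; last by case/andP: hx.
    by case/andP: hx; move: xz; rewrite /ecball/=; clear - hx4; lra.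
  have sub : ecball p (r / 4) `<=` ecball z r.
    by apply: ecball_sub; clear - pz; lra.
  have pE := eucl_norm_triangle (p - z) z; rewrite subrK in pE.
  rewrite -{2}(footK g x).
  apply: (@cone_at L m eta e0 g w c' c p (r / 4) A K HC) => //.
  - by rewrite L0.
  - exact: ltW.
  - exact: height_foot.
  - by clear - pz pE z2; lra.
  - by move=> y /sub; exact: wA.
  - move=> y /sub yz hy; apply: wK => //; apply: le_trans hy.
    by rewrite kE /delta; clear; lra.
  - by apply: le_trans cA1; apply: csq => //; exact: ltW.
split.
- move=> x xz hx.
  have Ka : K * (2 * rho ^+ 2 * A) = K * a * A by rewrite mulrA.
  rewrite Ka.
  have xz' : ecball z r x by exact: le_trans r2r.
  have [hd|hd] := leP (delta * r) (height g x).
    apply: le_trans (wK x xz' hd); rewrite ler_wpM2r ?(ltW A0)//.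
    by rewrite ler_piMr// ltW.
  have h4 : height g x <= r / 4.
    apply: le_trans (ltW hd) _; rewrite /delta.
    by clear - k1r; lra.
  have h0 : 0 <= height g x.
    apply: le_trans hx; rewrite mulr_ge0 ?(ltW r0)// mulr_ge0 ?(ltW rho0)//.
    by rewrite divr_ge0// ltW.
  by apply: (step_high r0 A0 rho0 k10 eta0 K1 hk2 rho2 _ (fun k hk => cone x k xz _ h4)) => //;
    rewrite ?hx ?h0.
- move=> x xz; rewrite -/a.
  have rr : rho * r <= 1 / 256 * r by rewrite ler_wpM2r// ltW.
  have xz2 : ecball z (r / 2) x by apply: le_trans xz _; clear - rr r0; lra.
  have xz1 : ecball z r x by exact: le_trans r2r.
  have aA : 0 <= a * A by rewrite mulr_ge0// ltW.
  have [hj1|hj1] := leP (height g x) (32^-1 ^+ j * (r / 2)).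
    apply: (@le_trans _ _ (- ((1 - c1) ^+ j * A))).
      by rewrite lerN2 ler_wpM2r// ltW.
    apply: (@decay R n L L1 c0 c1 HS c00 c10 c11 g w c' c x (r / 2)) => //.
    + by rewrite divr_gt0.
    + have := eucl_norm_triangle (x - z) z; rewrite subrK; move: xz2; rewrite /ecball/=.
      by clear - z2; lra.
    + move=> y yx; apply: wA; apply: ecball_sub yx; move: xz2; rewrite /ecball/=.
      by clear; lra.
    + apply: le_trans (_ : _ <= c * r ^+ 2) _; last by rewrite [leRHS]mulrA.
      by apply: csq; [rewrite divr_ge0// ltW|].
  apply: (@le_trans _ _ 0); first by rewrite oppr_le0.
  have [hd|hd] := leP (delta * r) (height g x).
    by apply: le_trans (wK x xz1 hd); rewrite mulr_ge0// ltW.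
  have h4 : height g x <= r / 4.
    apply: le_trans (ltW hd) _; rewrite /delta.
    by clear - k1r; lra.
  have h0 : 0 <= height g x.
    apply: ltW; apply: le_lt_trans hj1; apply: mulr_ge0; last by rewrite divr_ge0// ltW.
    by rewrite TE invr_ge0; exact: le_trans T1.
  apply: (step_low r0 A0 T1 K2 (h := height g x)); first by rewrite -TE; exact: (ltW hj1).
  by have := cone x 0%N xz2; rewrite !expr0 divr1 mul1r; apply; rewrite ?h0.
Qed.

Lemma boundary_lower (L rho delta K eps : R) : 0 < rho <= 1 / 256 ->
  0 < delta <= 1 / 4 -> 0 < K -> step_const L rho delta K eps ->
  forall g w c' c z r A,
  lipschitz_graph L g -> solves g c' c w -> 0 <= c -> 0 < r -> 0 < A ->
  height g z = 0 -> eucl_norm z + r < 2 ->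
  (forall x, ecball z r x -> - A <= w x) ->
  (forall x, ecball z r x -> delta * r <= height g x -> K * A <= w x) ->
  c * r ^+ 2 <= eps * A ->
  forall j t, rho ^+ j * (r / 2) <= t <= r / 2 ->
    K * ((2 * rho ^+ 2) ^+ j.+1 * A) <= w (z + t *: en).
Proof.
move=> /andP[rho0 rho1] /andP[d0 d1] K0 HB g w c' c z r A hg sw cge0 + + hz.
move=> r0 A0 z2 wA wK cr j t; elim: j r A r0 A0 z2 wA wK cr t => [|j IH] r A r0 A0 z2 wA wK cr t /andP[t1 t2].
all: have [S1 S2] := HB g w c' c z r A hg sw cge0 r0 A0 hz z2 wA wK cr.
all: have dr : delta * rho * r <= 1 / 8 * rho * r + 1 / 8 * rho * r by
  have : delta * (rho * r) <= 1 / 4 * (rho * r) by [rewrite ler_wpM2r// mulr_ge0// ltW]; lra.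
all: have rr : rho * r <= 1 / 256 * r by rewrite ler_wpM2r// ltW.
all: have zt : eucl_norm (z + t *: en - z) = `|t| by exact: eucl_norm_shift.
  rewrite expr1; apply: S1.
    by rewrite /ecball/= zt ger0_norm//; move: t1; rewrite expr0 mul1r; lra.
  by rewrite height_shift hz add0r; move: t1; rewrite expr0 mul1r; lra.
set a := 2 * rho ^+ 2 in S1 S2 *.
have a0 : 0 < a by rewrite mulr_gt0// exprn_gt0.
have a1 : a <= 1.
  have : rho ^+ 2 <= 1 * (1 / 256) by rewrite expr2 ler_pM//; lra.
  by rewrite /a; lra.
have t0 : 0 <= t.
  by apply: le_trans t1; rewrite mulr_ge0 ?exprn_ge0 ?divr_ge0 ?(ltW rho0) ?(ltW r0).
have [ht|ht] := leP (delta * rho * r) t.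
  apply: (@le_trans _ _ (K * (a * A))).
    rewrite ler_wpM2l ?(ltW K0)// ler_wpM2r ?(ltW A0)// exprS ler_piMr ?(ltW a0)//.
    by rewrite exprn_ile1// ltW.
  apply: S1; first by rewrite /ecball/= zt ger0_norm.
  by rewrite height_shift hz add0r.
rewrite exprSr -mulrA; apply: (IH (rho * r)).
- by rewrite mulr_gt0.
- by rewrite mulr_gt0.
- lra.
- exact: S2.
- move=> x xz hx; apply: S1; first by move: xz; rewrite /ecball/=; lra.
  by rewrite -mulrA.
- rewrite exprMn mulrCA.
  apply: (@le_trans _ _ (rho ^+ 2 * (eps * A))); first by rewrite ler_wpM2l ?sqr_ge0.
  have : 0 <= rho ^+ 2 * (eps * A).
    by rewrite mulr_ge0 ?sqr_ge0//; apply: le_trans cr; rewrite mulr_ge0// sqr_ge0.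
  by rewrite /a; lra.
- apply/andP; split; last by lra.
  by apply: le_trans t1; rewrite exprSr; lra.
Qed.

End boundary.

(** * The Carleson estimate and the decay of oscillation *)

Lemma climb_to (R : realType) n (L c0 c1 : R) M g u
    (x y : 'rV[R]_n.+1) (sg r A : R) : 0 <= L -> L <= 1 ->
  @spread_const R n.+1 c0 c1 -> 0 < c0 -> 0 < c1 -> c1 <= 1 / 2 ->
  (16 / 17) ^+ M <= c1 -> lipschitz_graph L g ->
  solves g (-1) 0 u -> (forall y, eucl_norm y < 2 -> 0 <= u y) -> 0 < sg -> 0 < A ->
  8 * sg <= height g y -> sg < r -> eucl_norm (y - x) + 8 * sg <= 2 * r ->
  eucl_norm y + 15 * r < 2 -> (forall z, ecball y sg z -> A <= u z) ->
  (sg / r) ^+ M * (c1 * A) <= u (x + (8 * r) *: e_last R n).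
Proof.
move=> L0 L1 HS c00 c10 c11 hM hg su u0 sg0 A0 h8 sgr yx y2 uA; set P := x + _.
have r0 : 0 < r by exact: lt_trans sgr.
have q17 : 1 < 17 / 16 :> R by clear; lra.
have [k /andP[k1 k2]] := geom_find q17 (introT andP (conj sg0 sgr)).
have := @climb R n L L1 c0 c1 HS c00 c10 g u (-1) y sg A k hg su u0 sg0 A0 h8.
move: k1 k2; rewrite exprS -mulrA; set sk := (17 / 16) ^+ k * sg => k1 k2 /(_ _ uA) H.
have sk0 : 0 < sk by rewrite mulr_gt0 ?exprn_gt0.
have sgk : sg <= sk by rewrite ler_peMl ?(ltW sg0)// exprn_ege1//; clear; lra.
have {}H z : ecball (y + (8 * (sk - sg)) *: e_last R n) sk z -> c1 ^+ k * A <= u z.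
  by apply: H; rewrite -/sk; clear - y2 k1 sk0; lra.
have ck : 0 < c1 ^+ k by rewrite exprn_gt0.
have ckM : (sg / r) ^+ M <= c1 ^+ k.
  apply: (@le_trans _ _ (((16 / 17) ^+ M) ^+ k)); last first.
    by rewrite lerXn2r// ?nnegrE ?exprn_ge0 ?(ltW c10)//.
  rewrite exprAC lerXn2r// ?nnegrE ?exprn_ge0 ?divr_ge0 ?(ltW sg0) ?(ltW r0)//.
  rewrite ler_pdivrMr// -ler_pdivrMl ?exprn_gt0//.
  by rewrite -exprVn invf_div; exact: ltW k1.
have pn := eucl_norm_triangle y ((8 * (sk - sg)) *: e_last R n).
rewrite eucl_norm_te ger0_norm ?mulr_ge0 ?subr_ge0// in pn.
have := @spread_graph R n L L1 c0 c1 HS g u 0 (-1) (y + (8 * (sk - sg)) *: e_last R n) sk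
  (c1 ^+ k * A) hg su sk0 (mulr_gt0 ck A0).
move=> /(_ _ _ _ H _ P) H'.
apply: (@le_trans _ _ (c1 * (c1 ^+ k * A))).
  by rewrite [leRHS]mulrCA ler_wpM2r// mulr_ge0// ltW.
apply: H'.
- by clear - pn y2 k1 sg0 sk0; lra.
- by rewrite height_shift; clear - h8 sgk; lra.
- move=> z zp; apply: u0; move: zp; rewrite /ecball/=.
  have := eucl_norm_triangle (z - (y + (8 * (sk - sg)) *: e_last R n)) (y + (8 * (sk - sg)) *: e_last R n).
  by rewrite subrK; clear - pn y2 k1 sg0 sk0; lra.
- by rewrite mul0r !mulr_ge0 ?(ltW c00) ?(ltW ck) ?(ltW A0).
- rewrite /ecball/= /P.
  have -> : x + (8 * r) *: e_last R n - (y + (8 * (sk - sg)) *: e_last R n) =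
    (x - y) + (8 * (r - sk + sg)) *: e_last R n.
    by rewrite opprD addrACA -scaleNr -scalerDl; congr (_ + _ *: _); ring.
  apply: le_trans (eucl_norm_triangle _ _) _.
  rewrite eucl_norm_te ger0_norm; last by clear - k1 sg0; lra.
  by rewrite eucl_normB; clear - yx k2 sk0; lra.
Qed.

(* A point [y] where [u] nearly dominates its neighbourhood at scale [s] is at height comparable
   to [s] by [decay], and climbing from it reaches [x + 8 r en]. *)
Lemma carleson (R : realType) n (L c0 c1 : R) : 0 <= L -> L <= 1 ->
  @spread_const R n.+1 c0 c1 -> 0 < c0 -> 0 < c1 -> c1 <= 1 / 2 ->
  exists C : R, 0 < C /\ forall g u (x : 'rV[R]_n.+1) (r : R), lipschitz_graph L g ->
  solves g (-1) 0 u -> (forall y, eucl_norm y < 2 -> 0 <= u y) ->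
  0 < r -> 0 <= height g x -> eucl_norm x + 20 * r < 2 ->
  forall y, ecball x r y -> u y <= C * (u (x + (8 * r) *: e_last R n) + r ^+ 2).
Proof.
move=> L0 L1 HS c00 c10 c11.
have q1 : 0 < (16 / 17 : R) < 1 by apply/andP; split; lra.
have [M [M0 hM]] := pow_small q1 c10.
have d01 : 0 < 1 - c1 < 1 by apply/andP; split; lra.
have h2M : 0 < 2^-1 ^+ M.+1 :> R by rewrite exprn_gt0.
have [j [_ hj]] := pow_small d01 h2M.
have dj0 : 0 < (1 - c1) ^+ j by rewrite exprn_gt0//; case/andP: d01.
pose TM : R := 2 ^+ M.
have TM1 : 1 <= TM by rewrite exprn_ege1//; lra.
have hjT : (1 - c1) ^+ j * TM <= 1 / 2.
  apply: (@le_trans _ _ (2^-1 ^+ M.+1 * TM)); first by rewrite ler_wpM2r//; lra.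
  by rewrite exprS -mulrA -exprMn mulVf// expr1n; lra.
pose de : R := 32^-1 ^+ j.
have de0 : 0 < de by rewrite exprn_gt0.
have de1 : de <= 1 by rewrite exprn_ile1//; lra.
have [eta [/andP[eta0 eta4] HL]] := @interior_half R n.+1 _ TM1.
have eta2 : eta <= 1 / 2 by lra.
pose kap := Num.min 1 (c0 * ((1 - c1) ^+ j * TM)).
have kap0 : 0 < kap by rewrite lt_min ltr01/= !mulr_gt0//; lra.
have kap1 : kap <= 1 by rewrite /kap ge_min lexx.
have kap2 : kap <= c0 * ((1 - c1) ^+ j * TM) by rewrite /kap ge_min lexx orbT.
pose B := (4 / (de * eta)) ^+ M * (2 / c1).
have B0 : 0 < B by rewrite mulr_gt0 ?exprn_gt0// divr_gt0// mulr_gt0.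
pose C' := kap^-1 + B.
have C'0 : 0 < C' by rewrite addr_gt0// invr_gt0.
exists (4 ^+ M * C'); split; first by rewrite mulr_gt0// exprn_gt0.
move=> g u x r hg su u0 r0 hx x2 y xy.
set P := x + _; set Q := C' * (u P + r ^+ 2).
have P2 : eucl_norm P < 2.
  by apply: le_lt_trans (eucl_norm_triangle _ _) _; rewrite eucl_norm_te ger0_norm; lra.
have uP0 : 0 <= u P by exact: u0.
have Q0 : 0 <= Q by rewrite mulr_ge0 ?(ltW C'0)// addr_ge0// sqr_ge0.
have r20 : 0 < 2 * r by lra.
have in2 z : ecball x (2 * r) z -> eucl_norm z < 2.
  by rewrite /ecball/= => h; have := eucl_norm_triangle (z - x) x; rewrite subrK; lra.
have [cu u00 lu] := su.
rewrite -mulrA; apply: (weighted_max M0 r20 Q0 (w := u) (p := x)).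
- by move=> z /in2; exact: cu.
- by move=> z /in2; exact: u0.
- move=> {xy}{}y s s0 uy' uy dom.
  have yx0 := eucl_norm_ge0 (y - x).
  have sr : s <= r by clear - uy' yx0; lra.
  have y2 : eucl_norm y < 2 by apply: in2; rewrite /ecball/=; clear - uy' s0; lra.
  have yE := eucl_norm_triangle (y - x) x; rewrite subrK in yE.
  have rM : 0 < (2 * r) ^+ M by rewrite exprn_gt0.
  have s2r : s <= 2 * r by clear - sr r0; lra.
  have sM := leXn2 M (ltW s0) s2r.
  have [hs|hs] := ltP (kap * u y) (s ^+ 2).
    apply: (@le_trans _ _ ((2 * r) ^+ M * (kap^-1 * r ^+ 2))).
      apply: ler_pM => //; rewrite ?exprn_ge0 ?(ltW uy) ?(ltW s0)//.
      rewrite ler_pdivlMl//; apply: le_trans (ltW hs) _.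
      by rewrite leXn2// ltW.
    rewrite mulrC ler_wpM2r ?(ltW rM)// /Q; apply: ler_pM; rewrite ?invr_ge0 ?(ltW kap0) ?sqr_ge0//.
      by rewrite lerDl ltW.
    by rewrite lerDr.
  have s2u : s ^+ 2 <= u y.
    by apply: le_trans hs _; rewrite ler_piMl ?(ltW uy).
  have TMu : 0 < TM * u y by rewrite mulr_gt0//; exact: lt_le_trans TM1.
  have [hy|hy] := leP (height g y) (de * s).
    have := @decay R n L L1 c0 c1 HS c00 c10 c11 g (fun z => - u z) _ _ y s (TM * u y) j hg
      (solvesN su).
    rewrite opprK lerN2 => /(_ ler01 s0 TMu _ hy) H; exfalso.
    have : u y <= (1 - c1) ^+ j * (TM * u y).
      apply: H; first by clear - yE uy' x2 r0 s0 sr; lra.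
        by move=> z zy; rewrite lerN2; exact: dom.
      rewrite mul1r; apply: le_trans hs _; rewrite mulrA mulrA -[_ * _ * TM]mulrA.
      by rewrite ler_wpM2r// ltW.
    have : (1 - c1) ^+ j * TM * u y <= 1 / 2 * u y by rewrite ler_wpM2r// ltW.
    by rewrite -mulrA; clear - uy; lra.
  have ds : 0 < de * s by rewrite mulr_gt0.
  have ds1 : de * s <= s by rewrite ler_piMl// ltW.
  pose tau := de * s / 4; have tau0 : 0 < tau by rewrite divr_gt0.
  have tau1 : tau <= s / 4 by rewrite /tau; clear - ds1; lra.
  have taus : tau <= s by clear - tau1 s0; lra.
  have ttau := leXn2 2 (ltW tau0) taus.
  pose sg := eta * tau; have sg0 : 0 < sg by rewrite mulr_gt0.
  have sgt : sg <= 1 / 2 * tau by rewrite ler_wpM2r// ltW.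
  have domU : ecball y tau `<=` Omega g 2.
    move=> z zy; apply/OmegaP; split.
      have := eucl_norm_triangle (z - y) y; rewrite subrK; move: zy; rewrite /ecball/=.
      by clear - yE uy' x2 r0 s0 taus sr; lra.
    have := @height_ge R n L L1 g z y hg; move: zy; rewrite /ecball/= /tau.
    by clear - hy ds; lra.
  have half z : ecball y sg z -> u y / 2 <= u z.
    apply: (HL (Omega g 2) u y tau 1) => //.
    - by move=> a; exact: (@Omega_open R n L L1 g 2 a hg).
    - by move=> a /OmegaP[a2 _]; exact: cu.
    - exact: lap_between_le lu.
    - move=> a ay; rewrite ger0_norm; first by apply: dom; apply: le_trans ay _; clear - tau1 s0; lra.
      by apply: u0; have /OmegaP[] := domU _ ay.
    - by rewrite mul1r; exact: le_trans ttau s2u.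
  have sgr : sg < r by clear - sgt tau1 tau0 sr s0; lra.
  have U2 : 0 < u y / 2 by rewrite divr_gt0.
  have h8 : 8 * sg <= height g y by apply: le_trans (ltW hy); clear - sgt; rewrite /tau in sgt; lra.
  have rM' : 0 < r ^+ M by rewrite exprn_gt0.
  have sgM : sg ^+ M * u y <= (2 / c1) * r ^+ M * u P.
    have H1 : (sg / r) ^+ M * (c1 * (u y / 2)) <= u P.
      apply: (climb_to L0 L1 HS c00 c10 c11 hM hg su u0 sg0 U2 h8 sgr _ _ half) => //.
      + by clear - sgt tau1 uy' sg0; lra.
      + by clear - yE uy' x2 r0 s0; lra.
    rewrite expr_div_n in H1.
    have -> : sg ^+ M * u y = 2 / c1 * r ^+ M * (sg ^+ M / r ^+ M * (c1 * (u y / 2))).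
      by field; rewrite !gt_eqF.
    by rewrite ler_wpM2l// mulr_ge0 ?(ltW rM')// divr_ge0// ltW.
  have -> : s ^+ M * u y = (4 / (de * eta)) ^+ M * (sg ^+ M * u y).
    rewrite mulrA -exprMn; congr (_ ^+ _ * _); rewrite /sg /tau; field.
    by rewrite !gt_eqF.
  apply: (@le_trans _ _ (B * u P * r ^+ M)).
    rewrite [leRHS](_ : _ = (4 / (de * eta)) ^+ M * (2 / c1 * r ^+ M * u P)); last first.
      by rewrite /B; ring.
    by rewrite ler_wpM2l// exprn_ge0// divr_ge0// ltW// mulr_gt0.
  apply: ler_pM; [exact: mulr_ge0 (ltW B0) uP0|exact: ltW| |].
    rewrite /Q; apply: ler_pM; [exact: ltW|by []| |]; first by rewrite lerDr invr_ge0 ltW.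
    by rewrite lerDl sqr_ge0.
  by apply: leXn2; [exact: ltW|clear - r0; lra].
- by rewrite mulrAC divff ?mul1r.
Qed.

Lemma interior_lower (R : realType) n (L c0 c1 de : R) : 0 <= L -> L <= 1 ->
  @spread_const R n.+1 c0 c1 -> 0 < c0 -> 0 < c1 -> c1 <= 1 / 2 -> 0 < de ->
  exists c : R, 0 < c <= 1 /\ forall g w (x : 'rV[R]_n.+1) (s Lam A : R), lipschitz_graph L g ->
  solves g (- Lam) Lam w -> 0 <= Lam -> 0 < s -> 0 <= height g x -> eucl_norm x + 32 * s < 2 ->
  (forall y, ecball x (32 * s) y -> 0 <= w y) -> 0 < A -> A <= w (x + (8 * s) *: e_last R n) ->
  Lam * s ^+ 2 <= c * A ->
  forall y, ecball x s y -> de * s <= height g y -> c * A <= w y.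
Proof.
move=> L0 L1 HS c00 c10 c11 de0.
have c11' : 0 < c1 <= 1 / 2 by rewrite c10.
have [ch [/andP[ch0 ch16] HI]] := interior_harnack HS c00 c11'.
pose ta := Num.min ch (de / 8).
have ta0 : 0 < ta by rewrite lt_min ch0 divr_gt0.
have tach : ta <= ch by rewrite /ta ge_min lexx.
have tade : ta <= de / 8 by rewrite /ta ge_min lexx orbT.
clearbody ta.
have ita : 0 <= 4 / ta by rewrite divr_ge0// ltW.
pose k := Num.bound (4 / ta).
have hk : 8 <= k%:R * (2 * ta).
  have : 4 / ta * ta < k%:R * ta by rewrite ltr_pM2r//; exact: archi_boundP.
  by rewrite divfK ?gt_eqF//; clear; lra.
clearbody k.
have ck0 : 0 < c1 ^+ k.+1 by rewrite exprn_gt0.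
have ck1 : c1 ^+ k.+1 <= 1 by rewrite exprn_ile1// ?(ltW c10)//; clear - c11; lra.
pose c6 := c1 ^+ k.+1 * (c1 ^+ k.+1 / 2).
have c60 : 0 < c6 by rewrite mulr_gt0// divr_gt0.
have c61 : c6 <= c1 ^+ k.+1 / 2 by rewrite ler_piMl// ltW// divr_gt0.
pose c := Num.min (Num.min 1 c6) (c0 * c6).
have cc0 : 0 < c by rewrite !lt_min ltr01 c60 mulr_gt0.
have cc1 : c <= 1 by rewrite /c !ge_min lexx.
have cc2 : c <= c6 by rewrite /c !ge_min lexx orbT.
have cc3 : c <= c0 * c6 by rewrite /c ge_min lexx orbT.
exists c; split; first by rewrite cc0.
clearbody c; move=> g w x s Lam A hg sw Lam0 s0 hx x2 w0 A0 AP LA y xy hy.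
set P := x + (8 * s) *: e_last R n in AP.
pose sg := ta * s; have sg0 : 0 < sg by rewrite mulr_gt0.
have [cw w00 lw] := sw.
have s8 : eucl_norm (P - x) = 8 * s by rewrite eucl_norm_shift ger0_norm// mulr_ge0// ltW.
have sgs : sg <= s / 16.
  have : ta * s <= 1 / 16 * s by rewrite ler_wpM2r ?(ltW s0)//; exact: le_trans ch16.
  by clear; rewrite /sg; lra.
have in2 z r : ecball x r z -> r <= 32 * s -> eucl_norm z < 2.
  rewrite /ecball/= => h1 h2; have := eucl_norm_triangle (z - x) x; rewrite subrK.
  by clear - h1 h2 x2; lra.
have wP : 0 < w P by exact: lt_le_trans AP.
have hP : height g P = height g x + 8 * s by rewrite height_shift.
have PD : ecball P s `<=` Omega g 2.
  move=> z zP; have zP' := zP; rewrite /ecball/= in zP'; apply/OmegaP; split.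
    apply: (in2 z (9 * s)); last by clear - s0; lra.
    by apply: ecball_sub zP; rewrite s8; clear; lra.
  by have := @height_ge R n L L1 g z P hg; rewrite hP; clear - zP' hx s0; lra.
have LA1 : Lam * s ^+ 2 <= w P by apply: (le_trans LA); apply: le_trans AP; rewrite ler_piMl// ltW.
have half z : ecball P sg z -> A / 2 <= w z.
  move=> zP; apply: (@le_trans _ _ (w P / 2)); first by rewrite ler_pM2r// invr_gt0.
  apply: (HI (Omega g 2) w P s Lam) => //.
  - by move=> a; exact: (@Omega_open R n L L1 g 2 a hg).
  - by move=> a /OmegaP[a2 _]; exact: cw.
  - move=> a aP; apply: w0; apply: ecball_sub aP; rewrite s8; clear - s0; lra.
  - by apply: le_trans zP _; rewrite ler_wpM2r// ltW.
have A2 : 0 < A / 2 by rewrite divr_gt0.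
have Ls : Lam * sg ^+ 2 <= c0 * (c6 * A).
  apply: (@le_trans _ _ (Lam * s ^+ 2)).
    by rewrite ler_wpM2l// leXn2 ?(ltW sg0)//; clear - sgs s0; lra.
  by apply: le_trans LA _; rewrite mulrA ler_wpM2r// ltW.
pose Q := y + (8 * s) *: e_last R n.
have QP : Q - P = y - x by rewrite /Q /P opprD addrACA subrr addr0.
have ball z : eucl_norm (z - x) <= 9 * s ->
   eucl_norm z + 4 * sg < 2 /\ forall a, ecball z (4 * sg) a -> 0 <= w a.
  move=> zx; split.
    have := eucl_norm_triangle (z - x) x; rewrite subrK; clear - zx sgs x2 s0; lra.
  move=> a az; apply: w0; apply: ecball_sub az; clear - zx sgs s0; lra.
have xy' := xy; rewrite /ecball/= in xy'.
have step1 : forall z, ecball Q sg z -> c1 ^+ k.+1 * (A / 2) <= w z.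
  apply: (@segment R n L L1 c0 c1 HS c00 c10 c11 g w Lam (- Lam) P Q k sg (A / 2)) => //.
  - move=> t /andP[t0 t1].
    have tx : eucl_norm (t *: (Q - P)) <= s.
      rewrite eucl_normZ ger0_norm// QP; apply: le_trans xy'.
      by rewrite ler_piMl ?eucl_norm_ge0.
    have [|b1 b2] := ball (P + t *: (Q - P)).
      have := eucl_norm_triangle (P - x) (t *: (Q - P)); rewrite addrAC s8.
      by clear - tx; lra.
    split => //; have := @height_ge R n L L1 g (P + t *: (Q - P)) P hg.
    by rewrite hP [P + _ - P]addrAC subrr add0r; clear - tx hx sgs s0; lra.
  - rewrite QP; apply: le_trans xy' _; rewrite /sg mulrA [_ * s]mulrC.
    rewrite -[leLHS]mulr1 [leRHS](_ : _ = s * (k%:R * (2 * ta))); last by ring.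
    by rewrite ler_wpM2l ?(ltW s0)//; clear - hk; lra.
  - apply: le_trans Ls _; rewrite ler_wpM2l ?(ltW c00)//.
    have : c6 * A <= c1 ^+ k.+1 / 2 * A by rewrite ler_wpM2r// ltW.
    by clear; lra.
have A3 : 0 < c1 ^+ k.+1 * (A / 2) by rewrite mulr_gt0.
apply: (@le_trans _ _ (c1 ^+ k.+1 * (c1 ^+ k.+1 * (A / 2)))).
  by rewrite [leRHS](_ : _ = c6 * A); [rewrite ler_wpM2r// ltW|rewrite /c6; ring].
have yQ : y - Q = (- (8 * s)) *: e_last R n by rewrite /Q opprD addrA subrr add0r scaleNr.
apply: (@segment R n L L1 c0 c1 HS c00 c10 c11 g w Lam (- Lam) Q y k sg _ hg sw sg0 A3) => //.
- move=> t /andP[t0 t1].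
  have -> : Q + t *: (y - Q) = y + (8 * (1 - t) * s) *: e_last R n.
    by rewrite yQ scalerA -addrA -scalerDl; congr (_ + _ *: _); ring.
  have ts : 0 <= 8 * (1 - t) * s by rewrite !mulr_ge0 ?subr_ge0 ?(ltW s0).
  have ts' : 8 * (1 - t) * s <= 8 * s by rewrite ler_wpM2r ?(ltW s0)//; clear - t0; lra.
  have [|b1 b2] := ball (y + (8 * (1 - t) * s) *: e_last R n).
    rewrite addrAC; apply: le_trans (eucl_norm_triangle _ _) _; rewrite eucl_norm_te ger0_norm//.
    by clear - ts' xy'; lra.
  split => //; rewrite height_shift; apply: (@le_trans _ _ (de * s)).
    rewrite /sg mulrA ler_wpM2r ?(ltW s0)//; clear - tade; lra.
  by clear - hy ts; lra.
- rewrite yQ eucl_norm_te normrN ger0_norm ?mulr_ge0 ?(ltW s0)//.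
  rewrite [leRHS](_ : _ = (k%:R * (2 * ta)) * s); last by rewrite /sg; ring.
  by rewrite ler_wpM2r// ltW.
- by rewrite [X in c0 * X](_ : _ = c6 * A); [|rewrite /c6; ring].
- exact: ecballxx (ltW sg0).
Qed.

Lemma osc_step (R : realType) n (L c0 c1 rho de K eps : R) : 0 <= L -> L <= 1 ->
  @spread_const R n.+1 c0 c1 -> 0 < c0 -> 0 < c1 -> c1 <= 1 / 2 ->
  0 < rho <= 1 / 256 -> 0 < de <= 1 / 4 -> 0 < K -> 0 < eps ->
  @step_const R n L rho de K eps ->
  exists c4 c5 : R, [/\ 0 < c4 <= 1 / 2, 0 < c5 <= 1 / 2 & forall g u w (x : 'rV[R]_n.+1) (s Lam : R),
  lipschitz_graph L g ->
  solves g (-1) 0 u -> (forall y, eucl_norm y < 2 -> 0 <= u y) ->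
  solves g (- Lam) Lam w -> 0 <= Lam -> 0 < s -> 0 <= height g x -> eucl_norm x + 32 * s < 2 ->
  (forall y, ecball x (32 * s) y -> 0 <= w y) ->
  let P := x + (8 * s) *: e_last R n in
  0 < u P -> u P / 2 <= w P -> (Lam + 1) * s ^+ 2 <= c4 * u P ->
  forall y, ecball x (s / 4) y -> c5 * u y <= w y].
Proof.
move=> L0 L1 HS c00 c10 c11 hrho hde K0 eps0 HB.
have /andP[rho0 rho1] := hrho; have /andP[de0 de1] := hde.
have [C [C0 HC]] := carleson L0 L1 HS c00 c10 c11.
have de40 : 0 < de / 4 by rewrite divr_gt0.
have [c6 [/andP[c60 c61] HL]] := interior_lower L0 L1 HS c00 c10 c11 de40.
have CK : 0 < 4 * C * (K + 1) by rewrite !mulr_gt0// addr_gt0.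
pose c5 := Num.min (1 / 2) (c6 / (4 * C * (K + 1))).
have c50 : 0 < c5 by rewrite lt_min !divr_gt0.
have c51 : c5 <= 1 / 2 by rewrite /c5 ge_min lexx.
have c5K : c5 * (2 * C * (K + 1)) <= c6 / 2.
  have : c5 * (4 * C * (K + 1)) <= c6.
    by rewrite -ler_pdivlMr// /c5 ge_min lexx orbT.
  by clear; lra.
have c5C : 0 < c5 * (2 * C) by rewrite !mulr_gt0.
pose c4 := Num.min (Num.min (1 / 2) (c6 / 2)) (eps * (c5 * (2 * C))).
have c40 : 0 < c4 by rewrite !lt_min !divr_gt0// mulr_gt0.
have c41 : c4 <= 1 / 2 by rewrite /c4 !ge_min lexx.
have c42 : c4 <= c6 / 2 by rewrite /c4 !ge_min lexx orbT.
have c43 : c4 <= eps * (c5 * (2 * C)) by rewrite /c4 ge_min lexx orbT.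
exists c4, c5; split; [by rewrite c40|by rewrite c50|].
clearbody c4 c5; move=> g u w x s Lam hg su u0 sw Lam0 s0 hx x2 w0 P uP wP LP y xy.
have [cu u00 lu] := su; have [cw w00 lw] := sw.
have s20 : 0 <= s ^+ 2 by exact: sqr_ge0.
have Ls0 : 0 <= Lam * s ^+ 2 by rewrite mulr_ge0.
have cu4 : c4 * u P <= 1 / 2 * u P by rewrite ler_wpM2r// ltW.
have x20 : eucl_norm x + 20 * s < 2 by clear - x2 s0; lra.
have up z : ecball x s z -> u z <= 2 * C * u P.
  move=> zx; apply: le_trans (HC g u x s hg su u0 s0 hx x20 z zx) _; rewrite -/P.
  rewrite [leRHS](_ : _ = C * (2 * u P)); last by ring.
  by rewrite ler_wpM2l ?(ltW C0)//; clear - LP Ls0 cu4 uP; lra.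
have uP2 : 0 < u P / 2 by rewrite divr_gt0.
have low z : ecball x s z -> de / 4 * s <= height g z -> c6 * (u P / 2) <= w z.
  apply: (HL g w x s Lam (u P / 2)) => //.
  have : c4 * u P <= c6 / 2 * u P by rewrite ler_wpM2r// ltW.
  by clear - LP s20; lra.
have AB : c5 * (2 * C * u P) * (K + 1) <= c6 * (u P / 2).
  have : c5 * (2 * C * (K + 1)) * u P <= c6 / 2 * u P by rewrite ler_wpM2r// ltW.
  by clear; lra.
pose A := c5 * (2 * C * u P).
have A0 : 0 < A by rewrite !mulr_gt0.
have AK : A <= A * (K + 1) by rewrite ler_peMr ?(ltW A0)//; clear - K0; lra.
have xy' : ecball x s y by apply: le_trans xy _; clear - s0; lra.
have y2 : eucl_norm y < 2.
  by have := eucl_norm_triangle (y - x) x; rewrite subrK; move: xy'; rewrite /ecball/=;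
    clear - x2 s0; lra.
have [hy0|hy0] := leP (height g y) 0; first by rewrite u00// w00// mulr0.
have [hy|hy] := leP (de / 4 * s) (height g y).
  apply: (@le_trans _ _ A); first by rewrite ler_wpM2l ?(ltW c50)//; exact: up.
  by apply: le_trans AK _; apply: le_trans AB _; exact: low.
pose W z := w z + c5 * - u z.
have sW : solves g (- Lam + c5 * - 0) (Lam + c5 * - -1) W.
  by apply: solvesD => //; apply: solvesZ; [exact: ltW|exact: solvesN].
pose z := foot g y; have zK := footK g y; rewrite -/z in zK.
have s4 : 0 < s / 4 by rewrite divr_gt0.
have zx : eucl_norm (z - x) <= 5 / 16 * s.
  apply: le_trans (eucl_norm_dist _ y _) _; rewrite eucl_norm_foot gtr0_norm//.
  have : de / 4 * s <= 1 / 16 * s by rewrite ler_wpM2r ?(ltW s0)//; clear - de1; lra.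
  by move: xy; rewrite /ecball/=; clear - hy; lra.
have zsub : ecball z (s / 4) `<=` ecball x s by apply: ecball_sub; clear - zx s0; lra.
have sub32 a : ecball x s a -> ecball x (32 * s) a.
  by move=> h; apply: le_trans h _; clear - s0; lra.
have hpow : 0 < height g y / (s / 8) by rewrite !divr_gt0.
have r01 : 0 < rho < 1 by rewrite rho0; clear - rho1; lra.
have [j [_ hj]] := pow_small r01 hpow.
suff : 0 <= W y by rewrite /W mulrN subr_ge0.
apply: (@le_trans _ _ (K * ((2 * rho ^+ 2) ^+ j.+1 * A))).
  apply: mulr_ge0; first exact: ltW.
  by rewrite pmulr_lge0// exprn_ge0// mulr_ge0// sqr_ge0.
rewrite -zK; apply: (boundary_lower hrho hde K0 HB hg sW _ s4 A0) => //.
- by rewrite opprK mulr1 addr_ge0// ltW.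
- exact: height_foot.
- by have := eucl_norm_triangle (z - x) x; rewrite subrK; clear - zx s0 x2; lra.
- move=> a /zsub ax; have wa := w0 a (sub32 a ax); have ua := up a ax.
  have : c5 * u a <= A by rewrite ler_wpM2l// ltW.
  by rewrite /W; clear - wa; lra.
- move=> a /zsub ax ha; have ua := up a ax.
  have h1 : c5 * u a <= A by rewrite ler_wpM2l// ltW.
  have h2 : c6 * (u P / 2) <= w a by apply: low => //; apply: le_trans ha; clear; lra.
  by rewrite /W; clear - h1 h2 AB; rewrite /A in h1 *; lra.
- rewrite opprK mulr1.
  have h1 : (Lam + c5) * (s / 4) ^+ 2 <= (Lam + 1) * s ^+ 2.
    apply: ler_pM; rewrite ?sqr_ge0 ?addr_ge0 ?(ltW c50) ?lerD2l//; first by clear - c51; lra.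
    by apply: leXn2; [exact: ltW|clear - s0; lra].
  have h2 : c4 * u P <= eps * (c5 * (2 * C)) * u P by rewrite ler_wpM2r// ltW.
  by clear - h1 h2 LP; rewrite /A; lra.
- apply/andP; split; last by clear - hy de1 s0 hde; nra.
  have := hj; rewrite ler_pdivlMr ?divr_gt0//; clear; lra.
Qed.

Lemma eucl_norm_prime_last (R : realType) n (x : 'rV[R]_n.+1) :
  eucl_norm (xprime x) < 1 -> `|xlast x| <= 5 / 4 -> eucl_norm x < 7 / 4.
Proof.
move=> x1 x2; apply: sqr_lt; [exact: eucl_norm_ge0|lra|].
rewrite eucl_norm_split.
have : eucl_norm (xprime x) ^+ 2 <= 1 ^+ 2 by apply: leXn2; [exact: eucl_norm_ge0|exact: ltW].
have : `|xlast x| ^+ 2 <= (5 / 4) ^+ 2 by exact: leXn2.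
by rewrite real_normK ?num_real//; lra.
Qed.

Lemma global_lower (R : realType) n (L c0 c1 d : R) : 0 <= L -> L <= 1 ->
  @spread_const R n.+1 c0 c1 -> 0 < c0 -> 0 < c1 -> c1 <= 1 / 2 -> 0 < d ->
  exists c : R, 0 < c /\ forall g u (a b : 'rV[R]_n.+1), lipschitz_graph L g ->
  solves g (-1) 0 u -> (forall y, eucl_norm y < 2 -> 0 <= u y) ->
  eucl_norm a < 1 -> eucl_norm b < 1 -> d <= height g a -> d <= height g b ->
  1 <= u a -> c * u a <= u b.
Proof.
move=> L0 L1 HS c00 c10 c11 d0.
have c11' : 0 < c1 <= 1 / 2 by rewrite c10.
have [ch [/andP[ch0 ch16] HI]] := interior_harnack HS c00 c11'.
pose r := Num.min (d / 4) (1 / 4).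
have r0 : 0 < r by rewrite lt_min !divr_gt0.
have rd : r <= d / 4 by rewrite /r ge_min lexx.
have r4 : r <= 1 / 4 by rewrite /r ge_min lexx orbT.
clearbody r.
pose sg := ch * r; have sg0 : 0 < sg by rewrite mulr_gt0.
have sgr : sg <= r / 16.
  have : ch * r <= 1 / 16 * r by rewrite ler_wpM2r// ltW.
  by rewrite /sg; lra.
have isg : 0 <= 4 / sg by rewrite divr_ge0// ltW.
pose k := Num.bound (4 / sg).
have hk : 8 <= k%:R * (2 * sg).
  have : 4 / sg * sg < k%:R * sg by rewrite ltr_pM2r//; exact: archi_boundP.
  by rewrite divfK ?gt_eqF//; clear; lra.
clearbody k.
have ck0 : 0 < c1 ^+ k.+1 by rewrite exprn_gt0.
exists (c1 ^+ k.+1 * (c1 ^+ k.+1 * (c1 ^+ k.+1 / 2))); split.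
  by rewrite !mulr_gt0// divr_gt0.
move=> g u a b hg su u0 a1 b1 ha hb ua.
have [cu u00 lu] := su.
have ua0 : 0 < u a by exact: lt_le_trans ua.
pose A0 := u a / 2; have A00 : 0 < A0 by rewrite divr_gt0.
have half z : ecball a sg z -> A0 <= u z.
  apply: (HI (Omega g 2) u a r 1) => //.
  - by move=> z'; exact: (@Omega_open R n L L1 g 2 z' hg).
  - by move=> z' /OmegaP[z2 _]; exact: cu.
  - move=> z' zr; rewrite /ecball/= in zr; apply/OmegaP; split.
      by have := eucl_norm_triangle (z' - a) a; rewrite subrK; clear - zr a1 r4; lra.
    by have := @height_ge R n L L1 g z' a hg; clear - zr ha rd d0; lra.
  - exact: lap_between_le lu.
  - move=> z' zr; rewrite /ecball/= in zr; apply: u0.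
    by have := eucl_norm_triangle (z' - a) a; rewrite subrK; clear - zr a1 r4; lra.
  - rewrite mul1r; apply: le_trans ua; rewrite expr2 -[leRHS]mulr1.
    by apply: ler_pM; rewrite ?(ltW r0)//; clear - r4; lra.
have seg (p q : 'rV[R]_n.+1) (A : R) : 0 < A -> eucl_norm (q - p) <= 8 ->
    (forall t, 0 <= t <= 1 -> [/\ eucl_norm (xprime (p + t *: (q - p))) < 1,
      `|xlast (p + t *: (q - p))| <= 5 / 4 & 8 * sg <= height g (p + t *: (q - p))]) ->
    (forall x, ecball p sg x -> A <= u x) ->
    forall x, ecball q sg x -> c1 ^+ k.+1 * A <= u x.
  move=> pA pq4 hpq hA.
  apply: (@segment R n L L1 c0 c1 HS c00 c10 c11 g u 0 (-1) p q k sg A) => //.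
  - move=> t /hpq[h1 h2 h3]; have h := eucl_norm_prime_last h1 h2; split => //.
      by clear - h sgr r4; lra.
    move=> x xp; rewrite /ecball/= in xp; apply: u0.
    have := eucl_norm_triangle (x - (p + t *: (q - p))) (p + t *: (q - p)); rewrite subrK.
    by clear - h xp sgr r4; lra.
  - exact: le_trans hk.
  - by rewrite mul0r mulr_ge0 ?(ltW c00)// mulr_ge0 ?(ltW ck0)// ltW.
have sg8 : 8 * sg <= d by clear - sgr rd d0; lra.
have sg14 : 8 * sg <= 1 / 4 by clear - sgr r4; lra.
pose up (p : 'rV[R]_n.+1) : 'rV[R]_n.+1 := p + (5 / 4 - xlast p) *: e_last R n.
have nl (p : 'rV[R]_n.+1) : eucl_norm p < 1 -> `|xlast p| < 1.
  by move=> h; apply: le_lt_trans h; exact: xlast_le_eucl.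
have np (p : 'rV[R]_n.+1) : eucl_norm p < 1 -> eucl_norm (xprime p) < 1.
  by move=> h; apply: le_lt_trans h; exact: eucl_norm_prime.
have upP p : up p - p = (5 / 4 - xlast p) *: e_last R n by rewrite /up addrAC subrr add0r.
have vert (p : 'rV[R]_n.+1) (t : R) : eucl_norm p < 1 -> d <= height g p -> 0 <= t <= 1 ->
    [/\ eucl_norm (xprime (p + (t * (5 / 4 - xlast p)) *: e_last R n)) < 1,
     `|xlast (p + (t * (5 / 4 - xlast p)) *: e_last R n)| <= 5 / 4 &
     8 * sg <= height g (p + (t * (5 / 4 - xlast p)) *: e_last R n)].
  move=> p1 hp /andP[t0 t1]; rewrite xprime_shift xlast_shift height_shift.
  have := nl p p1; rewrite ltr_norml => /andP[l1 l2].
  have h0 : 0 <= t * (5 / 4 - xlast p) by rewrite mulr_ge0//; clear - l2; lra.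
  have h1 : t * (5 / 4 - xlast p) <= 5 / 4 - xlast p.
    by rewrite ler_piMl//; clear - l2; lra.
  split; first exact: np.
    by rewrite ler_norml; apply/andP; split; clear - h0 h1 l1; lra.
  by clear - hp h0 sg8; lra.
have len (p : 'rV[R]_n.+1) : eucl_norm p < 1 -> eucl_norm ((5 / 4 - xlast p) *: e_last R n) <= 8.
  move=> /nl; rewrite eucl_norm_te ltr_norml => /andP[l1 l2].
  by rewrite ger0_norm; clear - l1 l2; lra.
have A1 : 0 < c1 ^+ k.+1 * A0 by rewrite mulr_gt0.
have A2 : 0 < c1 ^+ k.+1 * (c1 ^+ k.+1 * A0) by rewrite mulr_gt0.
rewrite [leLHS](_ : _ = c1 ^+ k.+1 * (c1 ^+ k.+1 * (c1 ^+ k.+1 * A0))); last by rewrite /A0; ring.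
apply: (seg (up b) b _ A2 _ _ _ b (ecballxx b (ltW sg0))).
- by rewrite eucl_normB upP; exact: len.
- move=> t t01; have -> : up b + t *: (b - up b) = b + ((1 - t) * (5 / 4 - xlast b)) *: e_last R n.
    rewrite -opprB upP /up -addrA -scaleNr scalerA -scalerDl; congr (_ + _ *: _); ring.
  by apply: vert => //; case/andP: t01 => ? ?; apply/andP; split; lra.
have xl p : xlast (up p) = 5 / 4 by rewrite xlast_shift; ring.
have xp p : xprime (up p) = xprime p by rewrite xprime_shift.
apply: (seg (up a) (up b) _ A1).
- have h1 := eucl_norm_dist (up b) b (up a); have h2 := eucl_norm_dist b a (up a).
  have h3 := eucl_norm_triangle b (- a); rewrite eucl_normN in h3.
  rewrite [eucl_norm (a - up a)]eucl_normB upP eucl_norm_te in h2.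
  rewrite upP eucl_norm_te in h1.
  have := nl a a1; have := nl b b1; rewrite !ltr_norml => /andP[lb1 lb2] /andP[la1 la2].
  rewrite ger0_norm in h1; last by clear - lb2; lra.
  rewrite ger0_norm in h2; last by clear - la2; lra.
  by clear - h1 h2 h3 a1 b1 lb1 la1; lra.
- move=> t /andP[t0 t1].
  have xt : eucl_norm (xprime (up a + t *: (up b - up a))) < 1.
    rewrite xprimeD xprimeZ xprimeB !xp.
    have -> : xprime a + t *: (xprime b - xprime a) = (1 - t) *: xprime a + t *: xprime b.
      by rewrite scalerBr scalerBl scale1r addrAC addrA.
    apply: le_lt_trans (eucl_norm_triangle _ _) _; rewrite !eucl_normZ !ger0_norm ?subr_ge0//.
    have na := np a a1; have nb := np b b1.
    have [h|h] := leP (eucl_norm (xprime a)) (eucl_norm (xprime b)).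
      have : (1 - t) * eucl_norm (xprime a) <= (1 - t) * eucl_norm (xprime b).
        by rewrite ler_wpM2l// subr_ge0.
      by clear - nb; lra.
    have : t * eucl_norm (xprime b) <= t * eucl_norm (xprime a) by rewrite ler_wpM2l// ltW.
    by clear - na; lra.
  have lt : xlast (up a + t *: (up b - up a)) = 5 / 4.
    by rewrite xlastD xlastZ xlastB !xl subrr mulr0 addr0.
  split; rewrite ?lt ?ger0_norm//.
  rewrite /height lt; have [gL g0] := hg.
  have := gL (xprime (up a + t *: (up b - up a))) 0; rewrite g0 !subr0 => h.
  have : g (xprime (up a + t *: (up b - up a))) <= 1.
    apply: le_trans (ler_norm _) _; apply: le_trans h _; apply: le_trans (ltW xt).
    by rewrite ler_piMl ?eucl_norm_ge0.
  by clear - sg14; lra.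
apply: (seg a (up a) _ A00 _ _ half).
- by rewrite upP; exact: len.
- by move=> t t01; rewrite upP scalerA; exact: vert.
Qed.

Lemma graph_growth (R : realType) n (L rho de K eps : R) : 0 < rho <= 1 / 256 ->
  0 < de <= 1 / 4 -> 0 < K -> @step_const R n L rho de K eps -> 0 < eps ->
  forall g (u : 'rV[R]_n.+1 -> R) (cc : R), lipschitz_graph L g -> solves g (-1) 0 u ->
  (forall y : 'rV[R]_n.+1, eucl_norm y < 2 -> 0 <= u y) -> 0 < cc ->
  (forall y : 'rV[R]_n.+1, eucl_norm y < 1 -> de / 16 <= height g y -> cc <= u y) ->
  forall (p : 'rV[R]_n.+1) k, eucl_norm p <= 3 / 4 -> rho ^+ k / 32 <= height g p ->
  cc * (2 * rho ^+ 2) ^+ k.+1 <= u p.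
Proof.
move=> hrho hde K0 HB eps0 g u cc hg su u0 cc0 ucc p k p34 hp.
have /andP[rho0 rho1] := hrho; have /andP[de0 de1] := hde.
have a0 : 0 <= 2 * rho ^+ 2 by rewrite mulr_ge0 ?sqr_ge0.
have a1 : 2 * rho ^+ 2 <= 1.
  have : rho ^+ 2 <= (1 / 256) ^+ 2 by exact: leXn2 (ltW rho0) rho1.
  by rewrite expr2; lra.
have [h|h] := leP (1 / 32) (height g p).
  apply: (@le_trans _ _ cc); first by rewrite ler_piMr ?(ltW cc0)// exprn_ile1.
  by apply: ucc; clear - p34 h de1; lra.
have r0 : 0 < 1 / 16 :> R by rewrite divr_gt0.
pose A := cc / K; have A0 : 0 < A by rewrite divr_gt0.
have t0 : 0 <= height g p by apply: le_trans hp; rewrite divr_ge0// exprn_ge0// ltW.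
pose z := foot g p; have zp := eucl_norm_foot g p; rewrite -/z ger0_norm// in zp.
have zb : eucl_norm z + 1 / 16 < 1.
  by have := eucl_norm_triangle (z - p) p; rewrite subrK zp; clear - h p34; lra.
have za a : ecball z (1 / 16) a -> eucl_norm a < 1.
  by rewrite /ecball/= => az; have := eucl_norm_triangle (a - z) z;
    rewrite subrK; clear - az zb; lra.
have KA : K * A = cc by rewrite /A mulrC divfK ?gt_eqF.
rewrite -(footK g p) -/z.
rewrite [leLHS](_ : _ = K * ((2 * rho ^+ 2) ^+ k.+1 * A)); last by rewrite -KA; ring.
apply: (boundary_lower hrho hde K0 HB hg su _ r0 A0) => //.
- exact: height_foot.
- by clear - zb; lra.
- move=> a /za a1'; apply: (@le_trans _ _ 0); first by rewrite oppr_le0 ltW.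
  by apply: u0; clear - a1'; lra.
- by move=> a /za a1' ha; rewrite KA; apply: ucc => //; clear - ha; lra.
- by rewrite mul0r mulr_ge0 ?(ltW eps0) ?(ltW A0).
- by apply/andP; split; clear - hp h; lra.
Qed.

Lemma first_bound (R : realType) n (L rho de K eps cc : R) : 0 < rho <= 1 / 256 ->
  0 < de <= 1 / 4 -> 0 < K -> @step_const R n L rho de K eps -> 0 < eps -> 0 < cc ->
  exists C : R, 1 <= C /\ forall g (u v : 'rV[R]_n.+1 -> R), lipschitz_graph L g -> solves g (-1) 0 u ->
  solves g (-1) 1 v ->
  (forall y : 'rV[R]_n.+1, eucl_norm y < 2 -> 0 <= u y) ->
  (forall y : 'rV[R]_n.+1, eucl_norm y < 1 -> `|v y| <= 1) ->
  (forall y : 'rV[R]_n.+1, eucl_norm y < 1 -> de / 16 <= height g y -> cc <= u y) ->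
  forall y : 'rV[R]_n.+1, eucl_norm y <= 5 / 8 -> `|v y| <= C * u y.
Proof.
move=> hrho hde K0 HB eps0 cc0.
have /andP[rho0 rho1] := hrho; have /andP[de0 de1] := hde.
pose A := 1 + eps^-1.
have A1 : 1 <= A by rewrite lerDl invr_ge0 ltW.
have A0 : 0 < A by exact: lt_le_trans A1.
have epsA : 1 <= eps * A by rewrite /A mulrDr mulr1 divff ?gt_eqF// lerDr ltW.
have KA0 : 0 < K * A by rewrite mulr_gt0.
pose C := (K * A + 1) / cc + 1.
have C0 : 0 < (K * A + 1) / cc by rewrite divr_gt0//; lra.
have C1 : 1 <= C by rewrite lerDr ltW.
exists C; split => // g u v hg su sv u0 v1 ucc.
suff main w : solves g (-1) 1 w -> (forall y : 'rV[R]_n.+1, eucl_norm y < 1 -> `|w y| <= 1) ->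
    forall y : 'rV[R]_n.+1, eucl_norm y <= 5 / 8 -> w y <= C * u y.
  move=> y y58; rewrite ler_norml; apply/andP; split; last exact: main.
  rewrite -lerN2 opprK; apply: (main (fun z => - v z)) => //.
    by have := solvesN sv; rewrite opprK.
  by move=> z z1; rewrite normrN; exact: v1.
move=> sw w1 y y58; have [cw w0 lw] := sw; have [cu u00 lu] := su.
have [hy|hy] := leP (height g y) 0.
  by rewrite w0 ?u00 ?mulr0//; clear - y58; lra.
have big z : eucl_norm z < 1 -> de / 16 <= height g z -> K * A + 1 <= C * u z.
  move=> z1 hz; apply: (@le_trans _ _ ((K * A + 1) / cc * cc)).
    by rewrite divfK ?gt_eqF.
  by apply: ler_pM; rewrite ?(ltW C0) ?(ltW cc0) ?ucc// lerDl.
have [hd|hd] := leP (de / 16) (height g y).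
  have y1 : eucl_norm y < 1 by clear - y58; lra.
  apply: le_trans (big y y1 hd); apply: le_trans (ler_norm _) _.
  by apply: le_trans (w1 _ y1) _; rewrite lerDr ltW.
pose W z := C * u z + - w z.
have sW : solves g (C * -1 + - 1) (C * 0 + - -1) W.
  by apply: solvesD; [apply: solvesZ => //; exact: le_trans C1|exact: solvesN].
have r0 : 0 < 1 / 8 :> R by rewrite divr_gt0.
pose z := foot g y; have zp := eucl_norm_foot g y; rewrite -/z gtr0_norm// in zp.
have za a : ecball z (1 / 8) a -> eucl_norm a < 1.
  rewrite /ecball/= => az; have := eucl_norm_triangle (a - z) z; rewrite subrK.
  by have := eucl_norm_triangle (z - y) y; rewrite subrK zp; clear - az hd y58 de1; lra.
have hpow : 0 < height g y / (1 / 16) by rewrite !divr_gt0.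
have r01 : 0 < rho < 1 by rewrite rho0; clear - rho1; lra.
have [j [_ hj]] := pow_small r01 hpow.
suff : 0 <= W y by rewrite /W subr_ge0.
apply: (@le_trans _ _ (K * ((2 * rho ^+ 2) ^+ j.+1 * A))).
  apply: mulr_ge0; first exact: ltW.
  by rewrite pmulr_lge0// exprn_ge0// mulr_ge0// sqr_ge0.
rewrite -(footK g y) -/z; apply: (boundary_lower hrho hde K0 HB hg sW _ r0 A0).
- by rewrite mulr0 add0r opprK.
- exact: height_foot.
- by have := eucl_norm_triangle (z - y) y; rewrite subrK zp; clear - hd y58 de1; lra.
- move=> a /za a1; rewrite /W; have : 0 <= C * u a.
    rewrite mulr_ge0 ?(le_trans ler01 C1)//; apply: u0; apply: lt_trans a1 _.
    by rewrite ltr1n.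
  by have := w1 a a1; rewrite ler_norml => /andP[]; clear - A1; lra.
- move=> a /za a1 ha; rewrite /W; have {}ha : de / 16 <= height g a by clear - ha de0; lra.
  by have := big a a1 ha; have := w1 a a1; rewrite ler_norml => /andP[]; clear; lra.
- by rewrite mulr0 add0r opprK mul1r expr2; clear - epsA; lra.
- apply/andP; split; last by clear - hd de1; lra.
  by have := hj; rewrite ler_pdivlMr ?divr_gt0//; clear; lra.
Qed.

Lemma solves_scale (R : realType) n g u (a : R) : `|a| <= 1 -> @solves R n g (-1) 0 u ->
  solves g (-1) 1 (fun x => a * u x).
Proof.
rewrite ler_norml => /andP[a1 a2] su; have [a0|a0] := leP 0 a.
  by apply: solves_le (solvesZ a0 su); lra.
have Na0 : 0 <= - a by lra.
have -> : (fun x => a * u x) = (fun x => - a * - u x).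
  by apply/funext => x; rewrite mulrNN.
by apply: solves_le (solvesZ Na0 (solvesN su)); lra.
Qed.

Definition osc_const (R : realType) n (L c4 c5 : R) :=
  forall g u w (x : 'rV[R]_n.+1) (s Lam : R), lipschitz_graph L g ->
  solves g (-1) 0 u -> (forall y : 'rV[R]_n.+1, eucl_norm y < 2 -> 0 <= u y) ->
  solves g (- Lam) Lam w -> 0 <= Lam -> 0 < s -> 0 <= height g x -> eucl_norm x + 32 * s < 2 ->
  (forall y, ecball x (32 * s) y -> 0 <= w y) ->
  let P := x + (8 * s) *: e_last R n in
  0 < u P -> u P / 2 <= w P -> (Lam + 1) * s ^+ 2 <= c4 * u P ->
  forall y, ecball x (s / 4) y -> c5 * u y <= w y.

(* The source term is rescaled by [(1 - c5)^-m <= 2^m] at step [m], which the growth factor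
   [(2 rho^2)^m] of [u] compensates. *)
Lemma osc_iter (R : realType) n (L rho c4 c5 c' : R) k0 : 0 < rho <= 1 / 256 ->
  0 < c4 -> 0 < c5 <= 1 / 2 -> @osc_const R n L c4 c5 -> 0 < c' ->
  2 / 256 ^+ 2 <= c4 * c' * 2 ^+ k0 ->
  forall g (u v : 'rV[R]_n.+1 -> R), lipschitz_graph L g -> solves g (-1) 0 u -> solves g (-1) 1 v ->
  (forall y : 'rV[R]_n.+1, eucl_norm y < 2 -> 0 <= u y) ->
  (forall y : 'rV[R]_n.+1, eucl_norm y <= 5 / 8 -> `|v y| <= u y) ->
  (forall (p : 'rV[R]_n.+1) k, eucl_norm p <= 3 / 4 -> rho ^+ k / 32 <= height g p ->
     c' * (2 * rho ^+ 2) ^+ k <= u p) ->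
  forall x : 'rV[R]_n.+1, eucl_norm x <= 1 / 2 -> 0 <= height g x -> forall m,
  exists a b : R, [/\ -1 <= a, b <= 1, b - a = 2 * (1 - c5) ^+ m &
    forall y, ecball x (rho ^+ (k0 + m) / 8) y -> a * u y <= v y <= b * u y].
Proof.
move=> /andP[rho0 rho1] c40 /andP[c50 c51] HO c'0 hk0 g u v hg su sv u0 vu gr x x2 hx.
have mu0 : 0 < 1 - c5 by lra.
elim=> [|m [a [b [a1 b1 ba vab]]]].
  exists (-1), 1; split => //; first by rewrite expr0; lra.
  move=> y xy; rewrite mulN1r mul1r -ler_norml; apply: vu.
  have : rho ^+ (k0 + 0) <= 1 by rewrite exprn_ile1 ?(ltW rho0)//; lra.
  by have := eucl_norm_triangle (y - x) x; rewrite subrK; move: xy; rewrite /ecball/=; clear - x2; lra.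
have mm : 0 < (1 - c5) ^+ m by rewrite exprn_gt0.
have ba0 : 0 < b - a by rewrite ba mulr_gt0.
pose s := rho ^+ (k0 + m) / 256.
have s0 : 0 < s by rewrite divr_gt0 ?exprn_gt0 ?ltr0n.
have s1 : s <= 1 / 256.
  by have : rho ^+ (k0 + m) <= 1 by [rewrite exprn_ile1 ?(ltW rho0)//; lra]; rewrite /s; lra.
have s32 : 32 * s = rho ^+ (k0 + m) / 8 by rewrite /s; field.
pose P := x + (8 * s) *: e_last R n.
have hP : height g P = height g x + 8 * s by rewrite height_shift.
have P34 : eucl_norm P <= 3 / 4.
  by have := eucl_norm_triangle x ((8 * s) *: e_last R n); rewrite eucl_norm_te ger0_norm -/P;
    clear - x2 s0 s1; lra.
have uP : c' * (2 * rho ^+ 2) ^+ (k0 + m) <= u P.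
  by apply: gr => //; rewrite hP /s; clear - hx; lra.
have g0 : 0 < c' * (2 * rho ^+ 2) ^+ (k0 + m) by rewrite mulr_gt0// exprn_gt0// mulr_gt0// exprn_gt0.
have uP0 : 0 < u P by exact: lt_le_trans uP.
pose Lam := ((1 - c5) ^+ m)^-1.
have Lam1 : 1 <= Lam by rewrite invf_ge1// exprn_ile1 ?(ltW mu0)//; clear - c50; lra.
have Lam2 : Lam <= 2 ^+ m.
  rewrite /Lam -exprVn; apply: leXn2; first by rewrite invr_ge0 ltW.
  by rewrite -[leRHS]invrK lef_pV2 ?posrE ?invr_gt0//; clear - c51; lra.
have LP : (Lam + 1) * s ^+ 2 <= c4 * u P.
  apply: (@le_trans _ _ (2 * 2 ^+ m * s ^+ 2)).
    by rewrite ler_wpM2r ?sqr_ge0//; clear - Lam1 Lam2; lra.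
  apply: (@le_trans _ _ (c4 * (c' * (2 * rho ^+ 2) ^+ (k0 + m)))); last by rewrite ler_wpM2l// ltW.
  rewrite [leLHS](_ : _ = 2 / 256 ^+ 2 * (2 ^+ m * (rho ^+ 2) ^+ (k0 + m))); last first.
    by rewrite /s expr_div_n -exprM mulnC exprM; field.
  rewrite [leRHS](_ : _ = c4 * c' * 2 ^+ k0 * (2 ^+ m * (rho ^+ 2) ^+ (k0 + m))); last first.
    by rewrite exprMn [2 ^+ (k0 + m)]exprD; ring.
  by rewrite ler_wpM2r// mulr_ge0// exprn_ge0// sqr_ge0.
have x32 : eucl_norm x + 32 * s < 2 by clear - x2 s1; lra.
have ab1 : a <= 1 by apply: le_trans b1; rewrite -subr_ge0 ltW.
have ab2 : -1 <= b by apply: le_trans a1 _; rewrite -subr_ge0 ltW.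
have aN : `|- a| <= 1 by rewrite normrN ler_norml a1.
have bN : `|b| <= 1 by rewrite ler_norml ab2.
have iba : 0 <= (b - a)^-1 by rewrite invr_ge0 ltW.
have LamE : (b - a)^-1 * 2 = Lam by rewrite ba /Lam; field; rewrite gt_eqF.
pose w1 y := (b - a)^-1 * (v y + - a * u y).
pose w2 y := (b - a)^-1 * (b * u y + - v y).
have sw1 : solves g (- Lam) Lam w1.
  apply: solves_le (solvesZ iba (solvesD sv (solves_scale aN su))); rewrite -LamE; clear; lra.
have sw2 : solves g (- Lam) Lam w2.
  by apply: solves_le (solvesZ iba (solvesD (solves_scale bN su) (solvesN sv))); rewrite -LamE; clear; lra.
have w10 y : ecball x (32 * s) y -> 0 <= w1 y.
  by rewrite s32 => /vab/andP[h1 h2]; rewrite mulr_ge0//; clear - h1 h2; lra.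
have w20 y : ecball x (32 * s) y -> 0 <= w2 y.
  by rewrite s32 => /vab/andP[h1 h2]; rewrite mulr_ge0//; clear - h1 h2; lra.
have w12 y : w1 y + w2 y = u y by rewrite /w1 /w2; field; rewrite gt_eqF.
have sub y : ecball x (rho ^+ (k0 + m.+1) / 8) y ->
    ecball x (s / 4) y /\ ecball x (rho ^+ (k0 + m) / 8) y.
  have q0 : 0 <= rho ^+ (k0 + m) by rewrite exprn_ge0// ltW.
  have : rho * rho ^+ (k0 + m) <= 1 / 256 * rho ^+ (k0 + m) by rewrite ler_wpM2r.
  by rewrite /ecball/= addnS exprS /s; clear - q0 => h1 h2; split; lra.
have bau y : (b - a) * (c5 * u y) = c5 * b * u y - c5 * a * u y by ring.
have w1E y : (b - a) * w1 y = v y - a * u y.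
  by rewrite /w1 mulrA divff ?gt_eqF// mul1r mulNr.
have w2E y : (b - a) * w2 y = b * u y - v y.
  by rewrite /w2 mulrA divff ?gt_eqF// mul1r.
have Lam0 : 0 <= Lam by exact: le_trans Lam1.
have cba : 0 <= c5 * (b - a) by rewrite mulr_ge0// ltW.
have [h|h] := leP (u P / 2) (w1 P).
  exists (a + c5 * (b - a)), b; split => //.
  - by clear - cba a1; lra.
  - rewrite exprS mulrCA -ba; ring.
  - move=> y /sub[ys /vab/andP[h1 h2]]; rewrite h2 andbT.
    have : (b - a) * (c5 * u y) <= (b - a) * w1 y.
      by rewrite ler_wpM2l ?(ltW ba0)//; exact: (HO g u w1 x s Lam).
    by rewrite w1E; clear; lra.
exists a, (b - c5 * (b - a)); split => //.
- by clear - cba b1; lra.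
- rewrite exprS mulrCA -ba; ring.
- move=> y /sub[ys /vab/andP[h1 h2]]; rewrite h1 /=.
  have : (b - a) * (c5 * u y) <= (b - a) * w2 y.
    rewrite ler_wpM2l ?(ltW ba0)//; apply: (HO g u w2 x s Lam) => //.
    by have := w12 P; rewrite -/P; clear - h; lra.
  by rewrite w2E; clear; lra.
Qed.

(** * The Hölder estimate *)

Lemma holder_scale (R : realType) (rho mu R0 beta q D : R) : 0 < rho < 1 -> 0 < mu < 1 ->
  0 < R0 <= 1 -> 0 < beta <= 1 -> mu <= rho `^ beta -> 0 < D -> 0 <= q -> q <= 2 ->
  (forall m, D <= R0 * rho ^+ m -> q <= 2 * mu ^+ m) -> q / D `^ beta <= 2 / (mu * R0).
Proof.
move=> /andP[rho0 rho1] /andP[mu0 mu1] /andP[R00 R01] /andP[b0 b1] mur D0 q0 q2 H.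
have DR : 0 < D `^ beta by exact: powR_gt0.
have Rb : R0 <= R0 `^ beta by apply: ger1_powR; rewrite ?R00.
rewrite ler_pdivrMr// mulrAC ler_pdivlMr ?mulr_gt0//.
have [h|h] := leP R0 D.
  have : R0 `^ beta <= D `^ beta by apply: ge0_ler_powR; rewrite ?nnegrE// ltW.
  move=> h1; apply: ler_pM => //; first by rewrite mulr_ge0// ltW.
  apply: (@le_trans _ _ R0); last exact: le_trans h1.
  by rewrite ler_piMl// ltW.
have ir : 1 < rho^-1 by rewrite invf_gt1.
have [m] := geom_find ir (introT andP (conj D0 h)).
rewrite !exprVn !ler_pdivlMl ?ltr_pdivrMl ?exprn_gt0// => /andP[m1 m2].
apply: (@le_trans _ _ (2 * mu ^+ m * (mu * R0))).
  by rewrite ler_wpM2r ?mulr_ge0 ?(ltW mu0) ?(ltW R00)//; apply: H; rewrite mulrC ltW.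
rewrite -mulrA ler_wpM2l// mulrA -exprSr.
have : (rho ^+ m.+1 * R0) `^ beta <= D `^ beta.
  apply: ge0_ler_powR; rewrite ?nnegrE ?(ltW b0) ?(ltW D0)// mulr_ge0 ?(ltW R00)//.
  by rewrite exprn_ge0// ltW.
apply: le_trans; rewrite powRM ?exprn_ge0 ?(ltW rho0) ?(ltW R00)//.
apply: ler_pM => //; rewrite ?exprn_ge0 ?(ltW mu0) ?(ltW R00)//.
rewrite -[rho ^+ _]powR_mulrn ?(ltW rho0)// powRAC powR_mulrn ?powR_ge0//.
by apply: leXn2 => //; exact: ltW.
Qed.

Definition ratio_estimate (R : realType) n (L beta : R) := forall d, 0 < d ->
  exists C : R, 0 < C /\
  forall (g : 'rV[R]_n -> R) u v x0 V, lipschitz_graph L g ->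
  solves g (-1) 0 u -> solves g (-1) 1 v ->
  (forall y, eucl_norm y < 2 -> 0 <= u y) -> eucl_norm x0 < 1 -> d <= height g x0 ->
  u x0 = 1 -> 1 <= V -> (forall y, eucl_norm y < 1 -> `|v y| <= V) ->
  let U := u (2^-1 *: e_last R n) in
  [/\ 0 < U,
    forall x, eucl_norm x < 1 / 2 -> 0 < height g x -> `|v x / u x| <= C * V / U &
    forall x y, eucl_norm x < 1 / 2 -> eucl_norm y < 1 / 2 -> 0 < height g x ->
      0 < height g y -> x != y ->
      `|v x / u x - v y / u y| / eucl_norm (x - y) `^ beta <= C * V / U].

Lemma main_estimate (R : realType) n (L m : R) : 0 <= L < m -> m <= 1 ->
  n%:R * m ^+ 2 < 1 -> exists beta0 : R, 0 < beta0 <= 1 /\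
  forall beta, 0 < beta <= beta0 -> @ratio_estimate R n L beta.
Proof.
move=> Lm m1 nm; have /andP[L0 Lm'] := Lm.
have L1 : L <= 1 by lra.
have [c0 [c1 [c00 c10' HS]]] := spread_const_exists R n.+1.
have /andP[c10 c11] := c10'.
have [rho [de [K [eps [hrho hde K0 eps0 HB]]]]] := step_const_exists nm Lm m1 HS c00 c10'.
have [c4 [c5 [c40' c50' HO]]] := osc_step L0 L1 HS c00 c10 c11 hrho hde K0 eps0 HB.
have /andP[rho0 rho1] := hrho; have /andP[de0 de1] := hde; have /andP[c40 _] := c40'.
have /andP[c50 c51] := c50'.
pose mu := 1 - c5.
have mu0 : 0 < mu by rewrite /mu; clear - c51; lra.
have mu1 : mu < 1 by rewrite /mu; clear - c50; lra.
have mu01 : 0 < mu < 1 by rewrite mu0.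
have rho01 : 0 < rho < 1 by rewrite rho0; clear - rho1; lra.
have [J [J0 hJ]] := pow_small mu01 rho0.
have J0' : 0 < J%:R :> R by rewrite ltr0n.
exists J%:R^-1; split; first by rewrite invr_gt0 J0' invf_le1// ler1n.
move=> beta /andP[b0 bJ] d d0.
have beta01 : 0 < beta <= 1.
  by rewrite b0; apply: le_trans bJ _; rewrite invf_le1// ler1n.
have mur : mu <= rho `^ beta.
  apply: (@le_trans _ _ (rho `^ J%:R^-1)); last first.
    by apply: ger_powR => //; case/andP: rho01 => -> /ltW.
  apply: (@le_trans _ _ ((mu ^+ J) `^ J%:R^-1)).
    by rewrite -powR_mulrn ?(ltW mu0)// -powRrM divff ?gt_eqF// powRr1// ltW.
  by apply: ge0_ler_powR; rewrite ?nnegrE ?invr_ge0 ?exprn_ge0 ?(ltW mu0) ?(ltW rho0).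
pose d' := Num.min d (Num.min (de / 16) (1 / 2)).
have d'0 : 0 < d' by rewrite !lt_min d0 !divr_gt0.
have d'd : d' <= d by rewrite /d' ge_min lexx.
have d'e : d' <= de / 16 by rewrite /d' !ge_min lexx orbT.
have d'2 : d' <= 1 / 2 by rewrite /d' !ge_min lexx !orbT.
have [c [cc0 HG]] := global_lower L0 L1 HS c00 c10 c11 d'0.
have [C1 [C11 HC]] := first_bound hrho hde K0 HB eps0 cc0.
have C10 : 0 < C1 by exact: lt_le_trans C11.
pose c' := c * (2 * rho ^+ 2).
have c'0 : 0 < c' by rewrite !mulr_gt0// exprn_gt0.
have h256 : 0 < 2 / 256 ^+ 2 :> R by rewrite divr_gt0 ?exprn_gt0 ?ltr0n.
have hk : 0 < c4 * c' / (2 / 256 ^+ 2) := divr_gt0 (mulr_gt0 c40 c'0) h256.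
have half01 : 0 < (2^-1 : R) < 1 by rewrite invr_gt0 ltr0n invf_lt1// ltr1n.
have [k0 [_ hk0]] := pow_small half01 hk.
have {}hk0 : 2 / 256 ^+ 2 <= c4 * c' * 2 ^+ k0.
  move: hk0; rewrite (ler_pdivlMr _ _ h256) exprVn ler_pdivrMl ?exprn_gt0 ?ltr0n//.
  by rewrite [leRHS]mulrC.
pose R0 := rho ^+ k0 / 8.
have R00 : 0 < R0 by rewrite divr_gt0// exprn_gt0.
have R01 : R0 <= 1.
  have : rho ^+ k0 <= 1 by rewrite exprn_ile1 ?(ltW rho0)//; case/andP: rho01 => _ /ltW.
  by rewrite /R0; clear; lra.
pose C3 := 2 / (mu * R0).
have C31 : 1 <= C3.
  have muR : mu * R0 <= 1 by rewrite mulr_ile1// ltW.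
  have muR0 : 0 < mu * R0 by rewrite mulr_gt0.
  by rewrite /C3 ler_pdivlMr// mul1r; apply: le_trans muR _; clear; lra.
have C30 : 0 < C3 by exact: lt_le_trans C31.
pose CU := 1 + c^-1; have CU0 : 0 < CU by rewrite addr_gt0// invr_gt0.
exists (C1 * C3 * CU); split; first by apply: mulr_gt0 => //; exact: mulr_gt0.
have C130 : 0 <= C1 * C3 by rewrite mulr_ge0// ltW.
clear hk hJ; move=> g u v x0 V hg su sv u0 x01 dx0 ux0 V1 vV U.
have V0 : 0 < V by exact: lt_le_trans V1.
have ucc y : eucl_norm y < 1 -> d' <= height g y -> c <= u y.
  move=> y1 hy; rewrite -[c]mulr1 -ux0; apply: (HG g u x0 y) => //; last by rewrite ux0.
  exact: le_trans dx0.
have ucc' y : eucl_norm y < 1 -> de / 16 <= height g y -> c <= u y.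
  by move=> y1 hy; apply: ucc => //; exact: le_trans hy.
pose e2 := 2^-1 *: e_last R n.
have e2n : eucl_norm e2 < 1 by rewrite eucl_norm_te gtr0_norm ?invr_gt0 ?ltr0n// invf_lt1 ?ltr1n ?ltr0n.
have he2 : height g e2 = 1 / 2.
  have [_ g0] := hg; rewrite /height xlastZ xprimeZ xlast_e xprime_e scaler0 g0.
  by rewrite mulr1 subr0 div1r.
have U0 : 0 < U by apply: lt_le_trans (ucc e2 e2n _) => //; rewrite he2.
have UC : U <= CU.
  have ic : 0 < c^-1 by rewrite invr_gt0.
  have [h|h] := leP 1 U; last by rewrite /CU; clear - h ic; lra.
  have : c * U <= 1.
    by rewrite -ux0; apply: (HG g u e2 x0) => //; [rewrite he2|exact: le_trans dx0].
  by rewrite -ler_pdivlMl// mulr1 /CU; clear; lra.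
have final t : t <= V * C1 * C3 -> t <= C1 * C3 * CU * V / U.
  move=> /le_trans; apply; rewrite ler_pdivlMr//.
  rewrite [leRHS](_ : _ = V * C1 * C3 * CU); last by ring.
  by rewrite ler_wpM2l// -mulrA mulr_ge0// ltW.
have gr := graph_growth hrho hde K0 HB eps0 hg su u0 cc0 ucc'.
have {}gr (p : 'rV[R]_n.+1) k : eucl_norm p <= 3 / 4 -> rho ^+ k / 32 <= height g p ->
    c' * (2 * rho ^+ 2) ^+ k <= u p.
  by move=> h1 h2; rewrite /c' -mulrA -exprS; exact: gr.
have upos x : eucl_norm x < 1 / 2 -> 0 < height g x -> 0 < u x.
  move=> x2 hx; have hx' : 0 < height g x * 32 by rewrite mulr_gt0.
  have [k [_ hk]] := pow_small rho01 hx'.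
  have := gr x k (_ : _ <= _) _; rewrite ler_pdivrMr// => H.
  apply: (@lt_le_trans _ _ (c' * (2 * rho ^+ 2) ^+ k)).
    by rewrite mulr_gt0// exprn_gt0// mulr_gt0// exprn_gt0.
  by apply: H => //; clear - x2; lra.
pose v1 x := V^-1 * v x.
have iV : 0 <= V^-1 by rewrite invr_ge0 ltW.
have iV1 : V^-1 <= 1 by rewrite invf_le1.
have sv1 : solves g (-1) 1 v1.
  by apply: solves_le (solvesZ iV sv); rewrite ?mulrN mulr1 ?lerN2.
have v11 y : eucl_norm y < 1 -> `|v1 y| <= 1.
  by move=> /vV h; rewrite normrM ger0_norm// ler_pdivrMl// mulr1.
have vb := HC g u v1 hg su sv1 u0 v11 ucc'.
pose v2 x := C1^-1 * v1 x.
have iC : 0 <= C1^-1 by rewrite invr_ge0 ltW.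
have iC1 : C1^-1 <= 1 by rewrite invf_le1.
have sv2 : solves g (-1) 1 v2.
  by apply: solves_le (solvesZ iC sv1); rewrite ?mulrN mulr1 ?lerN2.
have v2b (y : 'rV[R]_n.+1) : eucl_norm y <= 5 / 8 -> `|v2 y| <= u y.
  by move=> /vb h; rewrite normrM ger0_norm// ler_pdivrMl.
have vE x : v x / u x = V * C1 * (v2 x / u x).
  rewrite /v2 /v1 !mulrA; congr (_ / _); field.
  by rewrite !gt_eqF.
have osc := osc_iter hrho c40 c50' HO c'0 hk0 hg su sv2 u0 v2b gr.
split => //.
- move=> x x2 hx; apply: final; have ux := upos x x2 hx.
  rewrite vE normrM gtr0_norm ?mulr_gt0//.
  rewrite ler_wpM2l ?mulr_ge0 ?(ltW V0) ?(ltW C10)//.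
  apply: le_trans C31; rewrite normrM normfV [`|u x|]gtr0_norm// ler_pdivrMr// mul1r.
  by apply: v2b; clear - x2; lra.
- move=> x y x2 y2 hx hy xy; apply: final.
  have ux := upos x x2 hx; have uy := upos y y2 hy.
  rewrite !vE -mulrBr normrM gtr0_norm ?mulr_gt0// -[leLHS]mulrA.
  rewrite ler_wpM2l ?mulr_ge0 ?(ltW V0) ?(ltW C10)//.
  have D0 : 0 < eucl_norm (x - y).
    rewrite lt_neqAle eucl_norm_ge0 andbT eq_sym; apply/eqP => D0.
    case/eqP: xy; apply/eqP; rewrite -subr_eq0; apply/eqP/rowP => i; rewrite mxE [RHS]mxE.
    have := coord_le_eucl (x - y) i; rewrite D0 normr_le0 => /eqP.
    by rewrite mxE.
  have bd z a b : 0 < u z -> a * u z <= v2 z <= b * u z -> a <= v2 z / u z <= b.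
    by move=> uz /andP[h1 h2]; rewrite ler_pdivlMr// h1 ler_pdivrMr.
  have bd1 z : eucl_norm z < 1 / 2 -> 0 < u z -> -1 <= v2 z / u z <= 1.
    move=> z2 uz; apply: bd => //; rewrite mulN1r mul1r -ler_norml; apply: v2b.
    by clear - z2; lra.
  apply: (@holder_scale R rho mu R0 beta) => //.
  + by rewrite R00.
  + have := bd1 x x2 ux; have := bd1 y y2 uy; rewrite ler_norml => /andP[h1 h2] /andP[h3 h4].
    by apply/andP; split; clear - h1 h2 h3 h4; lra.
  + move=> k; rewrite /R0 mulrAC -exprD => xyk.
    have [a [b [a1 b1 ba H]]] := osc x (ltW x2) (ltW hx) k.
    have kk : 0 <= rho ^+ (k0 + k) / 8 by rewrite divr_ge0// exprn_ge0// ltW.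
    have /(bd x a b ux)/andP[h1 h2] := H x (ecballxx x kk).
    have /(bd y a b uy)/andP[h3 h4] : a * u y <= v2 y <= b * u y.
      by apply: H; rewrite /ecball/= eucl_normB.
    by rewrite -/mu -ba ler_norml; apply/andP; split; clear - h1 h2 h3 h4; lra.
Qed.

(** * The degree of the cone solution *)

Lemma second_difference_at (R : realType) (f f1 : R -> R) (a t0 : R) : 0 < t0 ->
  (forall r : R, `|r| < t0 -> is_derive r 1 f (f1 r)) -> is_derive (0 : R) 1 f1 a ->
  forall eta : R, 0 < eta -> exists2 t1 : R, 0 < t1 & forall t : R, 0 < t < t1 ->
  `|f t + f (- t) - f 0 *+ 2 - a * t ^+ 2| <= eta * t ^+ 2.
Proof.
move=> t00 hf [df1 vf1] eta eta0.
have e2 : 0 < eta / 2 by rewrite divr_gt0.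
have [t2 t20 ht2] : exists2 t2 : R, 0 < t2 & forall r : R, `|r| < t2 ->
    `|f1 r - f1 0 - r * a| <= eta / 2 * `|r|.
  have dl : h^-1 *: ((f1 \o shift 0) (h *: (1 : R)) - f1 0) @[h --> (0 : R)^'] --> a.
    by rewrite -vf1; exact: df1.
  move/cvgrPdist_le : dl => /(_ _ e2).
  rewrite near_withinE => /nbhs_ballP[t2 /= t20 h]; exists t2 => // r rt2.
  have [->|r0] := eqVneq r 0; first by rewrite mul0r !subrr normr0 mulr0.
  have := h r; rewrite /ball/= sub0r normrN => /(_ rt2 r0).
  rewrite addr0 /GRing.scale/= mulr1 => h1.
  have -> : f1 r - f1 0 - r * a = - (r * (a - r^-1 * (f1 r - f1 0))) by field.
  by rewrite normrN normrM mulrC ler_wpM2r.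
exists (Num.min t0 t2); first by rewrite lt_min t00.
move=> t /andP[t_gt0]; rewrite lt_min => /andP[tt0 tt2].
pose chi (r : R) := f r + f (- r) - a * (r * r).
pose dchi (r : R) := f1 r - f1 (- r) - 2 * a * r.
have dP (r : R) : `|r| < t0 -> is_derive r 1 chi (dchi r).
  move=> rt0; have d1 := hf r rt0; have Nrt0 : `|- r| < t0 by rewrite normrN.
  have aff : is_derive r 1 (fun u : R => - u) (- 1) by exact: is_deriveNid.
  have d2 := @is_derive1_comp _ f _ r _ _ (hf (- r) Nrt0) aff.
  have d3 : is_derive r 1 (fun u : R => a * (u * u)) (2 * a * r).
    by apply: is_derive_eq; rewrite /GRing.scale/=; ring.
  have d4 := is_deriveB (is_deriveD d1 d2) d3.
  by apply: is_derive_eq; rewrite /dchi; ring.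
have [||c cab hc] := @MVT R chi dchi 0 t t_gt0.
- move=> r; rewrite in_itv/= => /andP[r0 rt]; apply: dP.
  by rewrite gtr0_norm//; exact: lt_trans tt0.
- apply: derivable_within_continuous => r; rewrite in_itv/= => /andP[r0 rt].
  have /dP[] : `|r| < t0 by rewrite ger0_norm//; exact: le_lt_trans tt0.
  by [].
have -> : f t + f (- t) - f 0 *+ 2 - a * t ^+ 2 = chi t - chi 0.
  by rewrite /chi oppr0; ring.
move: cab; rewrite in_itv/= => /andP[c0 ct].
have ct2 : `|c| < t2 by rewrite gtr0_norm//; exact: lt_trans tt2.
have h1 := ht2 c ct2; have h2 := ht2 (- c); rewrite normrN in h2; have {}h2 := h2 ct2.
rewrite hc subr0 normrM [`|t|]gtr0_norm// expr2 mulrA ler_wpM2r ?(ltW t_gt0)//.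
have -> : dchi c = (f1 c - f1 0 - c * a) - (f1 (- c) - f1 0 - - c * a).
  by rewrite /dchi; ring.
apply: le_trans (ler_normB _ _) _; rewrite [`|c|]gtr0_norm// in h1 h2.
have : eta * c <= eta * t by rewrite ler_wpM2l// ltW.
by clear - h1 h2; lra.
Qed.

Lemma is_derive_line (R : realType) n (u : 'rV[R]_n -> R) y e (r : R) :
  derivable u (y + r *: e) e ->
  is_derive r 1 (fun s : R => u (y + s *: e)) ('D_e u (y + r *: e)).
Proof.
have E : (fun h : R => h^-1 *: (((fun s : R => u (y + s *: e)) \o shift r) (h *: (1 : R)) -
      u (y + r *: e))) =
    (fun h : R => h^-1 *: ((u \o shift (y + r *: e)) (h *: e) - u (y + r *: e))).
  apply/funext => h /=; congr (_ *: (u _ - _)).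
  have -> : h%:A = h by exact: mulr1.
  by rewrite scalerDl addrCA.
by move=> du; split; rewrite /derivable /derive E.
Qed.

Lemma harmonic_haslap (R : realType) n (D : set 'rV[R]_n) u y :
  (forall x, D x -> nbhs x D) -> harmonic_on D u -> D y -> haslap u y 0.
Proof.
move=> oD [cu hu] Dy eta eta0.
have n0 : 0 < n%:R + 1 :> R by rewrite ltr_wpDl.
have en0 : 0 < eta / (n%:R + 1) by rewrite divr_gt0.
have [s s0 hs] := cball_nbhs (oD y Dy).
have H i : exists2 t1, 0 < t1 & forall t, 0 < t < t1 ->
    `|u (y + t *: delta_mx ord0 i) + u (y - t *: delta_mx ord0 i) - u y *+ 2 -
      partials [:: i; i] u y * t ^+ 2| <= eta / (n%:R + 1) * t ^+ 2.
  pose e : 'rV[R]_n := delta_mx ord0 i.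
  have yr (r : R) : `|r| < s -> D (y + r *: e).
    move=> rs; apply: hs; rewrite addrAC subrr add0r normrZ.
    apply: le_trans (ltW rs); rewrite ler_piMr//; apply/rV_norm_le => // j.
    by rewrite mxE eqxx/=; case: eqP => _; rewrite ?normr1 ?normr0.
  have d1 (r : R) : `|r| < s ->
      is_derive r 1 (fun s : R => u (y + s *: e)) (partial i u (y + r *: e)).
    by move=> /yr Dr; apply: is_derive_line; have [_ /(_ isT i)] := cu [::] _ isT Dr.
  have d2 : is_derive (0 : R) 1 (fun r : R => partial i u (y + r *: e)) (partials [:: i; i] u y).
    have -> : partials [:: i; i] u y = 'D_e (partial i u) (y + (0 : R) *: e).
      by rewrite scale0r addr0.
    by apply: is_derive_line; rewrite scale0r addr0; have [_ /(_ isT i)] := cu [:: i] _ isT Dy.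
  have [t1 t10 h] := second_difference_at s0 d1 d2 en0.
  by exists t1 => // t /h; rewrite scale0r addr0 scaleNr.
pose t1 i := sval (cid2 (H i)).
pose T := \big[Num.min/(1 : R)]_i t1 i.
exists T.
  rewrite /T; apply: lt_bigmin => // i _; rewrite /t1; by case: cid2.
move=> t /andP[t0 tT]; rewrite mul0r subr0.
have lap0 : \sum_i partials [:: i; i] u y * t ^+ 2 = 0.
  by rewrite -mulr_suml -/(laplacian u y) hu// mul0r.
have -> : lapdiff t u y = \sum_i (u (y + t *: delta_mx ord0 i) + u (y - t *: delta_mx ord0 i) -
    u y *+ 2 - partials [:: i; i] u y * t ^+ 2) by rewrite sumrB lap0 subr0.
apply: le_trans (ler_norm_sum _ _ _) _.
apply: (@le_trans _ _ (\sum_(i < n) eta / (n%:R + 1) * t ^+ 2)).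
  apply: ler_sum => i _; have : t < t1 i by apply: lt_le_trans tT _; exact: bigmin_le_cond.
  by rewrite /t1; case: cid2 => /= r r0 h tr; apply: h; rewrite t0.
rewrite sumr_const card_ord -[leLHS]mulr_natr.
rewrite [leLHS](_ : _ = eta / (n%:R + 1) * n%:R * t ^+ 2); last by ring.
rewrite ler_wpM2r ?sqr_ge0//.
by rewrite mulrAC ler_pdivrMr// ler_wpM2l ?(ltW eta0)// lerDl.
Qed.

Lemma harmonic_lap_between (R : realType) n (D : set 'rV[R]_n) u :
  (forall x, D x -> nbhs x D) -> harmonic_on D u -> lap_between D 0 0 u.
Proof.
move=> oD hu x Dx; have [s s0 hs] := cball_nbhs (oD x Dx).
exists s => // eta eta0; exists u => y /hs Dy; split.
- by rewrite subrr normr0 ltW.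
- by have [cu _] := hu; have [] := cu [::] y isT Dy.
- by exists 0; rewrite ?lexx//; exact: harmonic_haslap Dy.
Qed.

Section cone.
Variables (R : realType) (n : nat) (M : R).
Hypothesis M0 : 0 < M.
Implicit Types (x : 'rV[R]_n.+1) (m : R).

Lemma xlast0 : xlast (0 : 'rV[R]_n.+1) = 0.
Proof. by rewrite /xlast mxE. Qed.

Lemma xprime0 : xprime (0 : 'rV[R]_n.+1) = 0.
Proof. by apply/rowP => i; rewrite !mxE. Qed.

Lemma lconeE x : lcone M x <-> 0 < xlast x /\ 0 < quad M 0 x.
Proof.
rewrite /lcone/= quadE xlast0 xprime0 !subr0 subr_gt0 -exprMn.
have e0 := mulr_ge0 (ltW M0) (eucl_norm_ge0 (xprime x)).
split=> [h|[x0 /sqr_lt]]; last by apply.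
have x0 : 0 < xlast x by exact: le_lt_trans h.
by split => //; rewrite ltr_pXn2r ?nnegrE// ltW.
Qed.

Lemma lcone_nbhs x : lcone M x -> nbhs x (lcone M).
Proof.
move=> /lconeE[x0 q0].
have H1 : nbhs x [set y | 0 < quad M 0 y] by apply: nbhs_gt q0; exact: cont_quad.
have H2 : nbhs x [set y | 0 < xlast y - xlast (0 : 'rV[R]_n.+1)].
  by apply: nbhs_gt; [exact: cont_xlastB|rewrite xlast0 subr0].
by apply: filterS2 H1 H2 => y /= h1 h2; apply/lconeE; split => //; rewrite xlast0 subr0 in h2.
Qed.

Lemma closure_lcone x : closure (lcone M) x -> 0 <= quad M 0 x.
Proof.
have cl : closed [set y : 'rV[R]_n.+1 | 0 <= quad M 0 y].
  by apply: (@closed_superlevel R n.+1 (quad M 0) 0) => y; exact: cont_quad.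
move=> h; have : closure [set y : 'rV[R]_n.+1 | 0 <= quad M 0 y] x.
  by apply: closureS h => y /lconeE[_ /ltW].
by rewrite -(proj1 (closure_id _) cl).
Qed.

Lemma quad_closure m x : 0 <= m <= M -> closure (lcone M) x ->
  (M ^+ 2 - m ^+ 2) / (M ^+ 2 + 1) * eucl_norm x ^+ 2 <= quad m 0 x.
Proof.
move=> /andP[m0 mM] /closure_lcone; rewrite !quadE xlast0 xprime0 !subr0 eucl_norm_split.
set a := xlast x ^+ 2; set b := eucl_norm _ ^+ 2 => h.
have M1 : 0 < M ^+ 2 + 1 by rewrite ltr_wpDl// sqr_ge0.
rewrite mulrAC ler_pdivrMr//.
have : 0 <= (1 + m ^+ 2) * (a - M ^+ 2 * b) by rewrite mulr_ge0// addr_ge0// sqr_ge0.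
by lra.
Qed.

Lemma lcone_scale x (t : R) : 0 < t -> lcone M x -> lcone M (t *: x).
Proof.
move=> t0; rewrite /lcone/= xprimeZ xlastZ eucl_normZ gtr0_norm// mulrCA.
by rewrite ltr_pM2l.
Qed.

(* If [n M^2 > 1], then [x_n^2 - m^2 |x'|^2] with [m] slightly smaller than [M] is a strictly
   superharmonic barrier of quadratic growth on the cone. *)
Lemma cone_degree (w : 'rV[R]_n.+1 -> R) alpha : cone_solution M w ->
  homogeneous_on (@lcone R n M) alpha w -> 0 < 2 - alpha -> n%:R * M ^+ 2 <= 1.
Proof.
move=> [hw cw w0 wb [x0 cx0 wx0]] hom a2; rewrite leNgt; apply/negP => nM.
pose q := (n%:R * M ^+ 2)^-1.
have nM0 : 0 < n%:R * M ^+ 2 by exact: lt_trans nM.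
have q0 : 0 < q by rewrite invr_gt0.
have q1 : q < 1 by rewrite invf_lt1.
have nMq : n%:R * M ^+ 2 * q = 1 by rewrite divff ?gt_eqF.
pose m := M * ((1 + q) / 2).
have m0 : 0 <= m by rewrite mulr_ge0 ?(ltW M0)//; lra.
have mM : m < M by rewrite gtr_pMr//; lra.
have nm : 1 < n%:R * m ^+ 2.
  have -> : n%:R * m ^+ 2 = n%:R * M ^+ 2 * q + n%:R * M ^+ 2 * ((1 - q) / 2) ^+ 2.
    by rewrite /m; field.
  by rewrite nMq ltrDl mulr_gt0// exprn_gt0//; lra.
clearbody m q.
have mM' : 0 <= m <= M by rewrite m0 ltW.
pose ka := (M ^+ 2 - m ^+ 2) / (M ^+ 2 + 1).
have ka0 : 0 < ka.
  rewrite divr_gt0//; last by rewrite ltr_wpDl// sqr_ge0.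
  by rewrite subr_gt0 ltr_pXn2r// nnegrE// ltW.
have QC x : closure (lcone M) x -> ka * eucl_norm x ^+ 2 <= quad m 0 x.
  exact: quad_closure.
clearbody ka.
have npos x : lcone M x -> 0 < eucl_norm x.
  move=> /lconeE[h _]; apply: lt_le_trans h _; apply: le_trans (ler_norm _) _.
  exact: xlast_le_eucl.
have unit x : lcone M x -> lcone M ((eucl_norm x)^-1 *: x) /\
    eucl_norm ((eucl_norm x)^-1 *: x) = 1.
  move=> cx; have x_gt0 := npos x cx; split; first by apply: lcone_scale => //; rewrite invr_gt0.
  by rewrite eucl_normZ gtr0_norm ?invr_gt0// mulVf ?gt_eqF.
pose K r := ecball (0 : 'rV[R]_n.+1) r `&` closure (lcone M).
have cK r : compact (K r).
  by apply: compact_closedI; [exact: ecball_compact|exact: closed_closure].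
have cwK r : {within K r, continuous w}.
  by apply: continuous_subspaceW cw => x [].
have sub := @subset_closure _ (@lcone R n M).
have [S hS] : exists S, forall x, lcone M x -> eucl_norm x = 1 -> w x <= S.
  have K1 : (K 1) !=set0.
    exists ((eucl_norm x0)^-1 *: x0); have [h1 h2] := unit x0 cx0.
    by split; [rewrite /ecball/= subr0 h2|exact: sub].
  have [c _ hc] := EVT_max_rV K1 (cK 1) (cwK 1).
  exists (w c) => x cx x1; apply: hc; apply/mem_set; split; last exact: sub.
  by rewrite /ecball/= subr0 x1.
have S0 : 0 <= S by have [h1 h2] := unit x0 cx0; exact: le_trans (w0 _ h1) (hS _ h1 h2).
have x00 := npos x0 cx0.
have wx00 : 0 < w x0 by rewrite lt_neqAle eq_sym wx0 w0.
have qx0 : 0 < quad m 0 x0.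
  by apply: lt_le_trans (QC x0 (sub _ cx0)); rewrite mulr_gt0// exprn_gt0.
pose ep := w x0 / (2 * quad m 0 x0).
have ep0 : 0 < ep by rewrite divr_gt0// mulr_gt0.
have epq : ep * quad m 0 x0 = w x0 / 2 by rewrite /ep; field; rewrite gt_eqF.
clearbody ep.
pose r := Num.max (eucl_norm x0 + 1) ((S / (ep * ka) + 1) `^ (2 - alpha)^-1).
have B0 : 0 < S / (ep * ka) + 1 by rewrite ltr_wpDl// divr_ge0// mulr_ge0// ltW.
have rx0 : eucl_norm x0 < r by rewrite lt_max ltrDl ltr01.
have r0 : 0 < r by exact: lt_trans rx0.
have rS : S <= ep * ka * r `^ (2 - alpha).
  rewrite -ler_pdivrMl ?mulr_gt0// mulrC.
  apply: (@le_trans _ _ (S / (ep * ka) + 1)); first by rewrite lerDl.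
  have -> : S / (ep * ka) + 1 = ((S / (ep * ka) + 1) `^ (2 - alpha)^-1) `^ (2 - alpha).
    by rewrite -powRrM mulVf ?gt_eqF// powRr1// ltW.
  apply: ge0_ler_powR; rewrite ?nnegrE ?powR_ge0 ?(ltW a2) ?(ltW r0)//.
  by rewrite /r le_max lexx orbT.
have wr x : lcone M x -> eucl_norm x = r -> w x <= ep * quad m 0 x.
  move=> cx xr; have [h1 h2] := unit x cx; rewrite xr in h1 h2.
  have -> : x = r *: (r^-1 *: x) by rewrite scalerA divff ?gt_eqF// scale1r.
  rewrite hom//; apply: (@le_trans _ _ (r `^ alpha * (ep * ka * r `^ (2 - alpha)))).
    by rewrite ler_wpM2l ?powR_ge0//; apply: le_trans rS; exact: hS.
  rewrite mulrCA -powRD; last by rewrite (gt_eqF r0) implybT.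
  rewrite addrCA subrr addr0 powR_mulrn ?(ltW r0)// -mulrA ler_wpM2l ?(ltW ep0)//.
  by rewrite scalerA divff ?gt_eqF// scale1r -xr; apply: QC; exact: sub.
pose D := [set x | eucl_norm x < r] `&` @lcone R n M.
have oD x : D x -> nbhs x D.
  move=> [xr cx]; apply: filterI; last exact: lcone_nbhs.
  apply: nbhs_lt xr; have := @cont_eucl_dist R n.+1 0 x.
  by have -> : (fun y : 'rV[R]_n.+1 => eucl_norm (y - 0)) = @eucl_norm R n.+1
    by apply/funext => y; rewrite subr0.
have lw : lap_between D (- 0) (- 0) (fun x => - w x).
  apply: lap_betweenN => x Dx; have [s s0 hs] := cball_nbhs (oD x Dx).
  have [s' s'0 hs'] := harmonic_lap_between lcone_nbhs hw (proj2 Dx).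
  by exists s'.
have cwN : {within K r, continuous (fun x => - w x)}.
  by move=> x; apply: (@contN R (subspace (K r))); exact: cwK.
have mu0 : 0 < 2 * ep * (n%:R * m ^+ 2 - 1) by rewrite !mulr_gt0// subr_gt0.
suff : - ep * quad m 0 x0 <= - w x0 by rewrite mulNr epq; lra.
apply: (comparison (cK r) oD _ cwN _ lw mu0 (b := fun x => - ep * quad m 0 x)).
- move=> x [xr cx]; split; last exact: sub.
  by rewrite /ecball/= subr0 ltW.
- by move=> x; apply: contZ; exact: cont_quad.
- move=> x Dx; exists (- ep * (2 * (1 - n%:R * m ^+ 2))); first by lra.
  by apply: haslapZ; exact: haslap_quad.
- move=> x [xr clx] nD; rewrite mulNr lerN2.
  have [cx|ncx] := pselect (lcone M x).
    apply: wr => //; apply/eqP; rewrite eq_le; move: xr; rewrite /ecball/= subr0 => -> /=.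
    by rewrite leNgt; apply/negP => xr; apply: nD.
  rewrite wb; last by split => //; apply: contra_not ncx; exact: interior_subset.
  rewrite mulr_ge0 ?(ltW ep0)//; apply: le_trans (QC x clx).
  by rewrite mulr_ge0 ?(ltW ka0)// sqr_ge0.
- split; last exact: sub.
  by rewrite /ecball/= subr0 ltW.
Qed.

End cone.

Lemma uniform_exponent (R : realType) (M L : R) : 0 <= L < M ->
  exists beta : R, 0 < beta <= 1 /\ forall n, n%:R * M ^+ 2 <= 1 ->
  exists L' : R, [/\ 0 <= L' <= 1,
    forall g : 'rV[R]_n -> R, lipschitz_graph L g -> lipschitz_graph L' g &
    @ratio_estimate R n L' beta].
Proof.
move=> /andP[L0 LM]; have M0 : 0 < M by exact: le_lt_trans LM.
pose P n (beta : R) := exists L' : R, [/\ 0 <= L' <= 1,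
    forall g : 'rV[R]_n -> R, lipschitz_graph L g -> lipschitz_graph L' g &
    @ratio_estimate R n L' beta].
have H n : n%:R * M ^+ 2 <= 1 -> exists beta0 : R, 0 < beta0 <= 1 /\
    forall beta, 0 < beta <= beta0 -> P n beta.
  case: n => [_|n nM].
    have h1 : 0 <= (0 : R) < 1 / 2 by apply/andP; split; lra.
    have h2 : (1 / 2 : R) <= 1 by lra.
    have h3 : 0%:R * (1 / 2 : R) ^+ 2 < 1 by rewrite mul0r.
    have [beta0 [b0 hb]] := main_estimate h1 h2 h3; exists beta0; split => // beta hbeta.
    exists 0; split; [by rewrite lexx ler01| |exact: hb].
    move=> g [_ g0]; split => // x y; rewrite [x]thinmx0 [y]thinmx0.
    by rewrite !subrr normr0 eucl_norm0 mulr0.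
  have n1 : 1 <= n.+1%:R :> R by rewrite ler1n.
  have M1 : M <= 1.
    rewrite -(@ler_pXn2r _ 2)// ?nnegrE ?(ltW M0)// expr1n; apply: le_trans nM.
    by rewrite ler_peMl// sqr_ge0.
  pose m := (L + M) / 2.
  have h1 : 0 <= L < m by rewrite L0 /m; lra.
  have mM : m < M by rewrite /m; lra.
  have m1 : m <= 1 by lra.
  have h3 : n.+1%:R * m ^+ 2 < 1.
    apply: lt_le_trans nM; rewrite ltr_pM2l; last by exact: lt_le_trans n1.
    by rewrite ltr_pXn2r// nnegrE ?(ltW M0)//; rewrite /m; lra.
  have [beta0 [b0 hb]] := main_estimate h1 m1 h3; exists beta0; split => // beta hbeta.
  by exists L; split => //; [rewrite L0; lra|exact: hb].
have [beta [b0 hb]] : exists beta : R, 0 < beta <= 1 /\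
    forall n, (n < Num.bound (M ^+ 2)^-1)%N -> n%:R * M ^+ 2 <= 1 ->
      forall b, 0 < b <= beta -> P n b.
  elim: (Num.bound _) => [|B [beta [/andP[b0 b1] hb]]].
    by exists 1; rewrite ltr01 lexx.
  have [hB|hB] := leP (B%:R * M ^+ 2) 1; last first.
    exists beta; rewrite b0 b1; split => // n; rewrite ltnS leq_eqVlt => /orP[/eqP ->|nB].
      by rewrite leNgt hB.
    exact: hb.
  have [beta' [/andP[b0' b1'] hb']] := H B hB.
  exists (Num.min beta beta'); split; first by rewrite lt_min b0 b0' ge_min b1.
  move=> n; rewrite ltnS leq_eqVlt => /orP[/eqP ->|nB] nM b; rewrite le_min => /and3P[h1 h2 h3].
    by apply: hb'; rewrite h1.
  by apply: hb => //; rewrite h1.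
exists beta; split => // n nM; apply: hb => //; last by case/andP: b0 => -> _ /=.
have M2 : 0 < M ^+ 2 by rewrite exprn_gt0.
have iM : 0 <= (M ^+ 2)^-1 by rewrite invr_ge0 ltW.
rewrite -(@ltr_nat R); apply: le_lt_trans (archi_boundP iM).
by rewrite -[leRHS]mul1r ler_pdivlMr.
Qed.

Lemma Linfty_bound (R : realType) n (D : set 'rV[R]_n) f (V : R) :
  (forall x, D x -> nbhs x D) -> (forall x, D x -> {for x, continuous f}) ->
  Linfty_norm D f = V%:E -> forall x, D x -> `|f x| <= V.
Proof.
move=> oD cf; rewrite /Linfty_norm unlock.
case: ifPn => [_ hV|]; last first.
  rewrite -leNgt measure_le0 => /eqP mu0 _ x Dx; exfalso.
  suff : `|f x| <= -1 by have := normr_ge0 (f x); lra.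
  apply: (ae_le_continuous oD cf _ Dx).
  by exists setT; split => //; exact: measurableT.
apply: ae_le_continuous => //.
have := @ess_sup_ge _ _ _ (leb R n) (abse \o (fun x => (\1_D x * f x)%:E)).
rewrite hV; apply: filterS => z /= h Dz.
by move: h; rewrite indicE (mem_set Dz) mul1r lee_fin.
Qed.

Lemma classS_solves (R : realType) n (L c1 c2 : R) g (u Du : 'rV[R]_n.+1 -> R) : L <= 1 ->
  lipschitz_graph L g -> classS g 2 u Du ->
  {ae leb R n.+1, forall x, Omega g 2 x -> c1 <= Du x <= c2} -> solves g c1 c2 u.
Proof.
move=> L1 hg [cu u0 wu _] hc; split => //.
- move=> x x2 hx; apply: u0 => // /OmegaP[_]; lra.
- apply: weak_lap_between wu hc; first by move=> x; exact: (@Omega_open R n L L1 g 2 x hg).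
  by move=> x /OmegaP[x2 _]; exact: cu.
Qed.

Lemma dist_boundary (R : realType) n (L d : R) g (x0 : 'rV[R]_n.+1) : 0 <= L -> L <= 1 ->
  lipschitz_graph L g -> boundary (Omega g 2) 0 -> Omega g 1 x0 ->
  eucl_dist x0 (boundary (Omega g 2)) = d -> 0 < d <= height g x0.
Proof.
move=> L0 L1 hg b0 /OmegaP[x01 hx0] <-.
have oO x := @Omega_open R n L L1 g 2 x hg.
have Ox0 : Omega g 2 x0 by apply/OmegaP; split => //; lra.
apply/andP; split.
  have [r r0 hr] := cball_nbhs (oO _ Ox0).
  apply: lt_le_trans r0 _; apply: lb_le_inf; first by exists (eucl_norm (x0 - 0)); exists 0.
  move=> _ [y [_ yO] <-]; rewrite leNgt; apply/negP => yr; apply: yO.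
  apply: oO; apply: hr; apply: le_trans (norm_le_eucl _) _.
  by rewrite eucl_normB ltW.
set z := foot g x0.
have -> : height g x0 = eucl_norm (x0 - z) by rewrite eucl_normB eucl_norm_foot gtr0_norm.
have hz : height g z = 0 by exact: height_foot.
have z2 : eucl_norm z < 7 / 4.
  have xz : xprime z = xprime x0 by rewrite xprime_shift.
  have x1 : eucl_norm (xprime x0) < 1 by apply: le_lt_trans x01; exact: eucl_norm_prime.
  apply: eucl_norm_prime_last; first by rewrite xz.
  have -> : xlast z = g (xprime x0) by move: hz; rewrite /height xz; lra.
  have [gL g0] := hg; have := gL (xprime x0) 0; rewrite g0 !subr0.
  have : L * eucl_norm (xprime x0) <= 1 * eucl_norm (xprime x0).
    by rewrite ler_wpM2r ?eucl_norm_ge0.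
  by lra.
apply: ge_inf; first by exists 0 => _ [y _ <-]; exact: eucl_norm_ge0.
exists z; last by [].
split; last first.
  by move=> /interior_subset /OmegaP[_]; rewrite hz ltxx.
move=> B /cball_nbhs[r r0 hr].
pose t := Num.min r (1 / 8); have t0 : 0 < t by rewrite lt_min r0 divr_gt0.
have tr : t <= r by rewrite /t ge_min lexx.
have t8 : t <= 1 / 8 by rewrite /t ge_min lexx orbT.
have tz := eucl_norm_shift z t; rewrite gtr0_norm// in tz.
exists (z + t *: e_last R n); split; last first.
  by apply: hr; apply: le_trans (norm_le_eucl _) _; rewrite tz.
apply/OmegaP; rewrite height_shift hz add0r; split => //.
apply: le_lt_trans (eucl_norm_triangle _ _) _; rewrite eucl_norm_te gtr0_norm//; lra.
Qed.

Theorem corollary3p12 (R : realType) (M L : R) (L_ge0 : 0 <= L) (LM : L < M) :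
  exists beta : R, 0 < beta <= 1 /\
  forall (n : nat) (d : R), exists C : R,
  forall (uM : 'rV[R]_n.+1 -> R) (alpha1 : R)
    (g : 'rV[R]_n -> R) (x0 : 'rV[R]_n.+1) (u Du v f : 'rV[R]_n.+1 -> R),
    cone_solution M uM -> homogeneous_on (lcone M) alpha1 uM ->
    0 < 2 - alpha1 ->
    lipschitz_graph L g ->
    boundary (Omega g 2) 0 ->
    Omega g 1 x0 -> eucl_dist x0 (boundary (Omega g 2)) = d ->
    eucl_ball 1 `&` [set x | 4^-1 < xlast x] `<=` Omega g 2 ->
    classS g 2 u Du -> classS g 2 v f ->
    (forall x, Omega g 2 x -> 0 <= u x) ->
    {ae leb R n.+1, forall x, Omega g 2 x -> Du x <= 0} ->
    u x0 = 1 -> v x0 = 1 ->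
    (holder_norm beta (eucl_ball (2^-1) `&` Omega g 1) (fun x => v x / u x)%R <=
     C%:E * (Linfty_norm (Omega g 1) v + Linfty_norm (Omega g 1) f) *
       ((u (2^-1 *: e_last R n))^-1)%R%:E)%E.
Proof.
have M0 : 0 < M by exact: le_lt_trans LM.
have [|beta [b01 hbeta]] := @uniform_exponent R M L; first by rewrite L_ge0.
exists beta; split => // n d.
have [nM|nM] := leP (n%:R * M ^+ 2) 1; last first.
  exists 0 => uM alpha1 g x0 u Du v f hM hom a2; exfalso.
  by have := cone_degree M0 hM hom a2; rewrite leNgt nM.
have [L' [/andP[L0 L1] hL est]] := hbeta n nM.
have [d0|d0] := leP d 0.
  exists 0 => uM alpha1 g x0 u Du v f _ _ _ /hL hg b0 Ox0 dd; exfalso.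
  by have := dist_boundary L0 L1 hg b0 Ox0 dd; rewrite ltNge d0.
have [C [C0 hC]] := est d d0.
exists (C + C) => uM alpha1 g x0 u Du v f _ _ _ /hL hg b0 Ox0 dd _ Su Sv u_ge0 Du0 ux0 vx0.
have /andP[_ dx0] := dist_boundary L0 L1 hg b0 Ox0 dd.
have su : solves g (-1) 0 u.
  have [_ _ _ Du1] := Su; apply: (classS_solves L1 hg Su).
  apply: filterS2 Du0 Du1 => x h1 h2 Ox.
  by have := h2 Ox; rewrite h1// andbT ler_norml => /andP[].
have sv : solves g (-1) 1 v.
  have [_ _ _ f1] := Sv; apply: (classS_solves L1 hg Sv).
  by apply: filterS f1 => x h Ox; rewrite -ler_norml h.
have u0 y : eucl_norm y < 2 -> 0 <= u y.
  move=> y2; have [hy|hy] := leP (height g y) 0; last by apply: u_ge0; apply/OmegaP.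
  by have [_ -> //] := su.
have [x01 hx0] := proj1 (OmegaP _ _ _) Ox0.
have [cv v0 _] := sv.
have oO x := @Omega_open R n L' L1 g 1 x hg.
have cvO x : Omega g 1 x -> {for x, continuous v}.
  by move=> /OmegaP[x1 _]; apply: cv; lra.
have f_ge0 := Lnorm_ge0 (leb R n.+1) +oo%E (fun x => (\1_(Omega g 1) x * f x)%:E).
rewrite -/(Linfty_norm (Omega g 1) f) in f_ge0.
have v_ge0 := Lnorm_ge0 (leb R n.+1) +oo%E (fun x => (\1_(Omega g 1) x * v x)%:E).
rewrite -/(Linfty_norm (Omega g 1) v) in v_ge0.
set U := u _.
have CC0 : (0 < (C + C)%:E)%E by rewrite lte_fin addr_gt0.
have U0 : 0 < U.
  have z1 : `|0 : R| <= 1 by rewrite normr0.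
  have z2 y : eucl_norm y < 1 -> `|0 * u y| <= 1 by rewrite mul0r normr0.
  by have [] := hC g u _ x0 1 hg su (solves_scale z1 su) u0 x01 dx0 ux0 (lexx 1) z2.
have U1 : (0 < (U^-1)%:E)%E by rewrite lte_fin invr_gt0.
case Nv : (Linfty_norm (Omega g 1) v) v_ge0 => [V| |] //= v_ge0; last first.
  rewrite addye; last by rewrite gt_eqF// (lt_le_trans _ f_ge0)// ltNye.
  by rewrite gt0_muley// gt0_mulye// leey.
have vV1 := Linfty_bound oO cvO Nv.
have V1 : 1 <= V by have := vV1 x0 Ox0; rewrite vx0 normr1.
have vV y : eucl_norm y < 1 -> `|v y| <= V.
  move=> y1; have [hy|hy] := leP (height g y) 0; last by apply: vV1; apply/OmegaP.
  by rewrite v0 ?normr0//; lra.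
have [_ h1 h2] := hC g u v x0 V hg su sv u0 x01 dx0 ux0 V1 vV.
have inB x : (eucl_ball 2^-1 `&` Omega g 1) x -> eucl_norm x < 1 / 2 /\ 0 < height g x.
  by move=> [x2 /OmegaP[_ hx]]; split => //; move: x2; rewrite /eucl_ball/=; lra.
apply: (@le_trans _ _ ((C + C)%:E * V%:E * (U^-1)%:E)%E); last first.
  rewrite lee_pmul2r//.
  by rewrite lee_pmul2l// leeDl.
rewrite -!EFinM mulrDl mulrDl EFinD /holder_norm; apply: leeD.
- by apply: ge_ereal_sup => _ [x /inB[x1 x2] <-]; rewrite lee_fin; exact: h1.
- apply: ge_ereal_sup => _ [x [y [/inB[x1 x2] /inB[y1 y2] xy ->]]].
  by rewrite lee_fin; exact: h2.
Qed.
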